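(* Let $m\ge 2$ and let $M$ be a connected smooth manifold such that $H^1(M,\mathbb R)=\dots=H^{m-1}(M,\mathbb R)=0$. Let $\omega_0$ be a nonzero $m$-form on $\mathbb R^n$ with constant coefficients and let $\omega_M$ be an exact $m$-form on $M$. Consider $\omega=\omega_0+\omega_M$ as an $m$-form on $\mathbb R^n\times M$ (sum of the pullbacks under the two projections), and let $G=\operatorname{Diff}(\mathbb R^n\times M,\omega)$ be the group of diffeomorphisms of $\mathbb R^n\times M$ preserving $\omega$. Then for a point $x\in\mathbb R^n\times M$, taken as a zero-dimensional cycle $\alpha$ with homology class $a$, the $m$-cocycle $c_a(\omega)$ is defined and is nontrivial in the complex $C^*(G,\mathbb R)$, i.e. it is not a coboundary.
   Context: For a group $G$ and a right $G$-module $A$, $C^s(G,A)$ is the set of all maps $G^s\to A$ for $s>0$, $C^0(G,A)=A$, with differential $$(Df)(g_1,\dots,g_{s+1})=f(g_2,\dots,g_{s+1})+\sum_{i=1}^s(-1)^if(g_1,\dots,g_ig_{i+1},\dots,g_{s+1})+(-1)^{s+1}f(g_1,\dots,g_s)g_{s+1}.$$ $C^*(G,\mathbb R)$ is this complex for the trivial $G$-module $\mathbb R$ ($G$ considered as an abstract group). Definition of $c_a(\omega)$. Let $G$ be a group acting on a smooth manifold $N$ by diffeomorphisms; $G$ acts on forms from the right by $\beta g=g^*\beta$. On $C^s(G,\Omega^q(N))$ let $\delta'=D$ and $(\delta''c)(g_1,\dots,g_s)=(-1)^s\,d\,c(g_1,\dots,g_s)$. Let $\omega$ be a $G$-invariant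 exact $m$-form on $N$ and $1\le p\le m-1$ with $H^{m-p}(N)=\dots=H^{m-1}(N)=0$, $H^{m-p-1}(N)\ne0$ (real cohomology). Then there are cochains $\varphi_{i,m-i-1}\in C^i(G,\Omega^{m-i-1}(N))$, $i=0,\dots,p$, with $\omega=-d\varphi_{0,m-1}$ and $\delta'\varphi_{i-1,m-i}+\delta''\varphi_{i,m-i-1}=0$ for $i=1,\dots,p$. For a smooth singular $(m-p-1)$-cycle $\alpha$ of $N$ whose homology class $a\in H_{m-p-1}(N)$ is $G$-invariant put $$c_a(\omega)(g_1,\dots,g_{p+1})=\int_\alpha(\delta'\varphi_{p,m-p-1})(g_1,\dots,g_{p+1}).$$ This is a $(p+1)$-cocycle of $C^*(G,\mathbb R)$ whose cohomology class does not depend on the choice of the $\varphi_{i,m-i-1}$. ''Defined'' means that these conditions are satisfied; here $N=\mathbb R^n\times M$, $p=m-1$, and $\int_\alpha$ is evaluation at the point $x$. *)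

(* Defs.v *)
From HB Require Import structures.
From mathcomp Require Import all_boot all_order all_algebra.
From mathcomp Require Import all_classical all_reals all_analysis.
Set Implicit Arguments.
Unset Strict Implicit.
Unset Printing Implicit Defensive.
Import Order.TTheory GRing.Theory Num.Theory.
Import numFieldNormedType.Exports.
Local Open Scope classical_set_scope.
Local Open Scope ring_scope.

(* k-fold continuous differentiability; intended for open U only. *)
Fixpoint Ck {R : realType} (k : nat) {a : nat} {F : normedModType R}
    (U : set 'rV[R]_a) (f : 'rV[R]_a -> F) : Prop :=
  if k is k'.+1 then
    (forall x, U x -> differentiable f x) /\ (forall v, Ck k' U ('D_v f))
  else forall x, U x -> {for x, continuous f}.

Definition smooth_on {R : realType} {a : nat} {F : normedModType R}
    (U : set 'rV[R]_a) (f : 'rV[R]_a -> F) : Prop := forall k, Ck k U f.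

Section NearDiff.
Context {R : realType} {V W : normedModType R}.

Lemma near_diff (f g : V -> W) (x : V) :
  (\near x, f x = g x) -> differentiable g x ->
  differentiable f x /\ 'd f x = 'd g x :> (V -> W).
Proof.
move=> fg dg.
have fgx : f x = g x by exact: nbhs_singleton fg.
have E : f \o shift x = cst (f x) + 'd g x +o_ 0 id.
  have := diff_locally dg; move/eqaddoP => H; apply/eqaddoP => e e0.
  have fg0 : \forall y \near 0, f (y + x) = g (y + x).
    have cs : (fun y : V => y + x) y @[y --> 0] --> x.
      by rewrite -[X in _ --> X]add0r; apply: cvgD => //; exact: cvg_cst.
    exact: cs _ fg.
  near=> y.
  have -> : (f \o shift x - (cst (f x) + 'd g x)) y
          = (g \o shift x - (cst (g x) + 'd g x)) y.
    rewrite !fctE /= fgx; congr (_ - _).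
    by near: y.
  by near: y; exact: H.
have D : 'd f x = 'd g x :> (V -> W).
  by apply: diff_unique E; exact: diff_continuous dg.
split=> //; apply/diff_locallyP; rewrite D; split=> //; exact: diff_continuous dg.
Unshelve. all: by end_near. Qed.

End NearDiff.

Section ScaleBilin.
Context {R : realType} {V F : normedModType R}.

Lemma scale_is_bilinear :
  bilinear_for
    (GRing.Scale.Law.clone _ _ *:%R _) (GRing.Scale.Law.clone _ _ *:%R _)
    (@GRing.scale R F : R^o -> F -> F).
Proof.
split=> [u'|u] a x y /=.
- by rewrite scalerDl -scalerA.
- by rewrite scalerDr !scalerA mulrC.
Qed.
HB.instance Definition _ := bilinear_isBilinear.Build R R^o F F _ _
  (@GRing.scale R F : R^o -> F -> F) scale_is_bilinear.

Lemma diff_scale (s : V -> R) (f : V -> F) x :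
  differentiable s x -> differentiable f x ->
  differentiable (fun y => s y *: f y) x /\
  forall v, 'D_v (fun y => s y *: f y) x = s x *: 'D_v f x + 'D_v s x *: f x.
Proof.
move=> ds df.
pose B : {bilinear R^o -> F -> F} := (@GRing.scale R F : R^o -> F -> F).
have cB : continuous (fun p => B p.1 p.2) by exact: scale_continuous.
have E : (fun y => s y *: f y) = (fun p => B p.1 p.2) \o (fun y => (s y, f y)).
  by [].
have dp : differentiable (fun y => (s y, f y)) x by exact: differentiable_pair.
have dB := differentiable_bilin (s x, f x) cB.
split=> [|v]; first by rewrite E; exact: differentiable_comp.
rewrite deriveE; last by rewrite E; exact: differentiable_comp.
by rewrite E diff_comp // /= diff_pair // diff_bilin // /= -!deriveE.
Qed.
End ScaleBilin.

Section CkTheory.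
Context {R : realType} {a : nat}.
Implicit Types (U V : set 'rV[R]_a) (F : normedModType R).

Lemma CkW k F U (f : 'rV[R]_a -> F) : Ck k.+1 U f -> Ck k U f.
Proof.
elim: k f => [|k IH] f [df Df].
  by move=> x Ux; apply: differentiable_continuous; exact: df.
by split=> // v; exact: IH.
Qed.

Lemma Ck_sub k F U V (f : 'rV[R]_a -> F) : V `<=` U -> Ck k U f -> Ck k V f.
Proof.
move=> VU; elim: k f => [|k IH] f /=; first by move=> H x /VU; exact: H.
by move=> [df Df]; split=> [x /VU/df //|v]; exact: IH.
Qed.

Lemma Ck_local k F U (f : 'rV[R]_a -> F) :
  (forall x, U x -> exists V (g : 'rV[R]_a -> F),
     [/\ open V, V x, (forall y, V y -> f y = g y) & Ck k V g]) -> Ck k U f.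
Proof.
elim: k f => [|k IH] f H.
  move=> x Ux; have [V [g [oV Vx fg Cg]]] := H x Ux.
  have nV : nbhs x V by exact: open_nbhs_nbhs.
  have fgx : \forall y \near x, g y = f y.
    by apply: filterS nV => y Vy; rewrite fg.
  rewrite /prop_for /continuous_at (fg _ Vx).
  exact: cvg_trans (near_eq_cvg fgx) (Cg x Vx).
split=> [x Ux|v].
  have [V [g [oV Vx fg [dg _]]]] := H x Ux.
  apply: (near_diff _ (dg x Vx)).1.
  by apply: filterS (open_nbhs_nbhs (conj oV Vx)) => y; exact: fg.
apply: IH => x Ux; have [V [g [oV Vx fg [dg Cg]]]] := H x Ux.
exists V, ('D_v g); split=> //; last exact: Cg.
move=> y Vy; apply: near_eq_derive.
by apply: filterS (open_nbhs_nbhs (conj oV Vy)) => z; exact: fg.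
Qed.

Lemma Ck_eq k F U (f g : 'rV[R]_a -> F) : open U ->
  (forall x, U x -> f x = g x) -> Ck k U g -> Ck k U f.
Proof. by move=> oU fg Cg; apply: Ck_local => x Ux; exists U, g. Qed.

Lemma Ck_cst k F U (c : F) : Ck k U (cst c).
Proof.
elim: k c => [|k IH] c; first by move=> x _; exact: cst_continuous.
split=> [x _|v]; first exact: differentiable_cst.
by rewrite (_ : 'D_v _ = cst 0) //; apply/funext => x; exact: derive_cst.
Qed.

Lemma Ck_add k F U (f g : 'rV[R]_a -> F) : open U ->
  Ck k U f -> Ck k U g -> Ck k U (f \+ g).
Proof.
move=> oU; elim: k f g => [|k IH] f g.
  by move=> cf cg x Ux; apply: continuousD; [exact: cf|exact: cg].
move=> [df Df] [dg Dg]; split=> [x Ux|v].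
  by apply: differentiableD; [exact: df|exact: dg].
apply: (@Ck_eq _ _ _ _ ('D_v f \+ 'D_v g)) => //;
  last by apply: IH; [exact: Df|exact: Dg].
by move=> x Ux /=; rewrite deriveD //; apply: diff_derivable; [exact: df|exact: dg].
Qed.

Lemma Ck_sum k F U n (f : 'I_n -> 'rV[R]_a -> F) : open U ->
  (forall i, Ck k U (f i)) -> Ck k U (fun x => \sum_i f i x).
Proof.
move=> oU; elim: n f => [|n IH] f H.
  by apply: (Ck_eq oU _ (Ck_cst k U 0)) => x _; rewrite big_ord0.
apply: (@Ck_eq _ _ _ _ ((fun x => \sum_i f (widen_ord (leqnSn n) i) x) \+ f ord_max)) => //.
  by move=> x _; rewrite big_ord_recr.
by apply: Ck_add => //; apply: IH.
Qed.

Lemma Ck_scale k F U (s : 'rV[R]_a -> R) (f : 'rV[R]_a -> F) : open U ->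
  Ck k U s -> Ck k U f -> Ck k U (fun x => s x *: f x).
Proof.
move=> oU; elim: k s f => [|k IH] s f.
  by move=> cs cf x Ux; apply: continuousZ; [exact: cs|exact: cf].
move=> Cs Cf; have [[ds Ds] [df Df]] := (Cs, Cf); split=> [x Ux|v].
  by apply: (diff_scale (ds _ Ux) (df _ Ux)).1.
apply: (@Ck_eq _ _ _ _
  ((fun x => s x *: 'D_v f x) \+ (fun x => 'D_v s x *: f x))) => //.
  by move=> x Ux /=; apply: (diff_scale (ds _ Ux) (df _ Ux)).2.
apply: Ck_add => //; apply: IH; do ?exact: CkW.
- exact: Df.
- exact: Ds.
Qed.

Lemma Ck_lin k (F F' : normedModType R) U (f : 'rV[R]_a -> F)
    (L : {linear F -> F'}) : open U -> continuous L -> Ck k U f -> Ck k U (L \o f).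
Proof.
move=> oU cL; elim: k f => [|k IH] f.
  by move=> cf x Ux; apply: continuous_comp; [exact: cf|exact: cL].
move=> [df Df]; split=> [x Ux|v].
  by apply: differentiable_comp; [exact: df|exact: linear_differentiable].
apply: (@Ck_eq _ _ _ _ (L \o 'D_v f)) => //; last exact/IH/Df.
move=> x Ux; have dfx := df _ Ux; have dL := linear_differentiable (f x) cL.
rewrite deriveE; last exact: differentiable_comp.
by rewrite diff_comp //= diff_lin // deriveE.
Qed.

End CkTheory.

Section CkComp.
Context {R : realType} {a b : nat}.

Lemma Ck_comp k (F : normedModType R) (U : set 'rV[R]_a) (V : set 'rV[R]_b)
    (f : 'rV[R]_a -> 'rV[R]_b) (g : 'rV[R]_b -> F) :
  open U -> (forall x, U x -> V (f x)) ->
  Ck k U f -> Ck k V g -> Ck k U (g \o f).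
Proof.
move=> oU fUV; elim: k g => [|k IH] g.
  move=> cf cg x Ux; apply: continuous_comp; [exact: cf|exact/cg/fUV].
move=> Cf [dg Dg]; have [df Df] := Cf; split=> [x Ux|v].
  by apply: differentiable_comp; [exact: df|exact/dg/fUV].
apply: (@Ck_eq _ _ _ _ _ _ (fun x => \sum_(i < b)
    ('D_v f x) 0 i *: ('D_(delta_mx 0 i) g \o f) x)) => //.
  move=> x Ux; have dfx := df _ Ux; have dgfx := dg _ (fUV _ Ux).
  rewrite deriveE; last exact: differentiable_comp.
  rewrite diff_comp //= -(deriveE v dfx) {1}(row_sum_delta ('D_v f x)).
  rewrite linear_sum; apply: eq_bigr => i _.
  by rewrite linearZ /= (deriveE _ dgfx).
apply: Ck_sum => // i; apply: Ck_scale => //;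
  last by apply: IH; [exact: CkW|exact: Dg].
have -> : (fun x => 'D_v f x 0 i) = (fun M : 'rV[R]_b => M 0 i) \o 'D_v f by [].
have li : linear (fun M : 'rV[R]_b => M 0 i) by move=> c u w; rewrite !mxE.
pose Lm := GRing.isLinear.Build _ _ _ _ _ li.
pose L : {linear 'rV[R]_b -> R} := HB.pack (fun M : 'rV[R]_b => M 0 i) Lm.
apply: (@Ck_lin _ _ _ _ _ _ _ L) => //; last exact: Df.
by move=> M; exact: coord_continuous.
Qed.

End CkComp.

Section CkLinear.
Context {R : realType} {a : nat} {F : normedModType R}.

Lemma Ck_id k (U : set 'rV[R]_a) : Ck k U (@id 'rV[R]_a).
Proof.
case: k => [|k]; first by move=> x _; exact: cvg_id.
split=> [x _|v]; first exact: ex_diff.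
rewrite (_ : 'D_v _ = cst v); first exact: Ck_cst.
by apply/funext => x; exact: derive_id.
Qed.

Lemma rV_linear_continuous (L : {linear 'rV[R]_a -> F}) : continuous L.
Proof.
have -> : (L : 'rV[R]_a -> F) = fun u => \sum_(i < a) u 0 i *: L (delta_mx 0 i).
  apply/funext => u; rewrite {1}(row_sum_delta u) linear_sum.
  by apply: eq_bigr => i _; rewrite linearZ.
move=> x; apply: (@Ck_sum _ _ 0 _ setT) => // [|i]; first exact: openT.
apply: Ck_scale; first exact: openT.
  by move=> u _; exact: coord_continuous.
exact: (Ck_cst 0).
Qed.

Lemma Ck_linear k (U : set 'rV[R]_a) (L : {linear 'rV[R]_a -> F}) :
  open U -> Ck k U L.
Proof.
move=> oU; rewrite -[X in Ck _ _ X]/(L \o id); apply: Ck_lin => //.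
  exact: rV_linear_continuous.
exact: Ck_id.
Qed.

End CkLinear.

Section SecondCountable.

Lemma second_countable_rV {R : realType} (n : nat) : @second_countable 'rV[R]_n.
Proof.
pose b (qk : 'rV[rat]_n * nat) := ball (map_mx ratr qk.1 : 'rV[R]_n) (qk.2.+1%:R^-1).
exists (range b); first exact: sub_countable (card_image_le _ _) (countableP _).
split=> [_ [[q k] _ <-]|x A].
  by apply: ball_open; rewrite invr_gt0 ltr0n.
move=> /nbhs_ballP[e /= e0 eA].
have [k ke] : exists k : nat, (k.+1%:R^-1 : R) < e / 2.
  have e20 : 0 < e / 2 by rewrite divr_gt0.
  near \oo => k; exists k; near: k; exact: (near_infty_natSinv_lt (PosNum e20)).
have k0 : 0 < (k.+1%:R^-1 : R) by rewrite invr_gt0 ltr0n.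
have qx (i : 'I_n) : exists q : rat, `|x 0 i - ratr q| < k.+1%:R^-1.
  have [|q] := @rat_in_itvoo R (x 0 i - k.+1%:R^-1) (x 0 i + k.+1%:R^-1).
    by rewrite ltrBlDr -addrA ltrDl addr_gt0.
  by rewrite in_itv /= => q_itv; exists q; rewrite distrC ltr_distl.
have [q Hq] := choice qx.
pose qq : 'rV[rat]_n := \row_i q i.
have xq : ball (map_mx ratr qq : 'rV[R]_n) k.+1%:R^-1 x.
  split=> // i j; rewrite !mxE ord1 -ball_normE /= distrC; exact: Hq.
exists (b (qq, k)); first by split=> //; exists (qq, k).
move=> y yq; apply: eA.
rewrite [e]splitr; apply: (@ball_triangle R 'rV[R]_n (map_mx ratr qq)).
  by apply: ball_sym; apply: le_ball xq; exact: ltW.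
by apply: le_ball yq; exact: ltW.
Unshelve. all: by end_near. Qed.

Lemma open_setX (T U : topologicalType) (V : set T) (W : set U) :
  open V -> open W -> open (V `*` W).
Proof.
move=> oV oW; rewrite openE => -[x y] [/= Vx Wy].
by exists (V, W) => //=; split; exact: open_nbhs_nbhs.
Qed.

Lemma second_countable_prod (T U : topologicalType) :
  @second_countable T -> @second_countable U -> @second_countable (T * U)%type.
Proof.
move=> [B cB [oB bB]] [C cC [oC bC]].
exists ((fun p => p.1 `*` p.2) @` (B `*` C)).
  by apply: sub_countable (card_image_le _ _) _; exact: countableX.
split=> [_ [[V W] /= [BV CW] <-]|[x y] A].
  by apply: open_setX; [exact: oB|exact: oC].
move=> [[P Q] /= [xP yQ] PQA].
have [V [BV Vx] VP] := bB x P xP.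
have [W [CW Wy] WQ] := bC y Q yQ.
exists (V `*` W); first by split=> //; exists (V, W).
by move=> [u v] [/= /VP Pu /WQ Qv]; apply: PQA.
Qed.

Lemma hausdorff_prod (T U : topologicalType) :
  hausdorff_space T -> hausdorff_space U -> hausdorff_space (T * U)%type.
Proof.
move=> hT hU [x y] [x' y'] H; congr (_, _).
  apply: hT => A B xA xB.
  have [[u v] [/= Au Bu]] := H (fst @^-1` A) (fst @^-1` B)
    (cvg_fst xA) (cvg_fst xB).
  by exists u.
apply: hU => A B yA yB.
have [[u v] [/= Au Bu]] := H (snd @^-1` A) (snd @^-1` B)
  (cvg_snd yA) (cvg_snd yB).
by exists v.
Qed.
End SecondCountable.

(* Smooth manifold without boundary, with one chart of its atlas selected
   around each point: chart x : dom x -> img x is the selected chart around x,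
   chartV x its inverse. Outside dom x and img x their values are irrelevant. *)
Record manifold (R : realType) := Manifold {
  point_of :> topologicalType;
  dim : nat;
  dom : point_of -> set point_of;
  img : point_of -> set 'rV[R]_dim;
  chart : point_of -> point_of -> 'rV[R]_dim;
  chartV : point_of -> 'rV[R]_dim -> point_of;
  open_dom : forall x, open (dom x);
  open_img : forall x, open (img x);
  mem_dom : forall x, dom x x;
  chart_img : forall x y, dom x y -> img x (chart x y);
  chartV_dom : forall x u, img x u -> dom x (chartV x u);
  chartK : forall x y, dom x y -> chartV x (chart x y) = y;
  chartVK : forall x u, img x u -> chart x (chartV x u) = u;
  chart_continuous : forall x y, dom x y -> {for y, continuous (chart x)};
  chartV_continuous : forall x u, img x u -> {for u, continuous (chartV x)};
  transition_smooth : forall x y,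
    smooth_on (img x `&` chartV x @^-1` dom y) (chart y \o chartV x);
  manifold_hausdorff : hausdorff_space point_of;
  manifold_second_countable : @second_countable point_of
}.

Section Euclid.
Context {R : realType} (n : nat).

Lemma euclid_transition :
  smooth_on ([set: 'rV[R]_n] `&` @id 'rV[R]_n @^-1` setT) (id \o @id 'rV[R]_n).
Proof. by move=> k; exact: Ck_id. Qed.

Definition euclid : manifold R := @Manifold R 'rV[R]_n n
  (fun=> setT) (fun=> setT) (fun=> id) (fun=> id)
  (fun=> openT) (fun=> openT) (fun=> I) (fun _ _ => id) (fun _ _ => id)
  (fun _ _ _ => erefl) (fun _ _ _ => erefl)
  (fun _ _ _ => cvg_id) (fun _ _ _ => cvg_id)
  (fun _ _ => euclid_transition) (@norm_hausdorff _ _) (second_countable_rV n).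

End Euclid.

Section RowMx.
Context {R : realType} {a b : nat}.

Definition inl_rV (u : 'rV[R]_a) : 'rV[R]_(a + b) := row_mx u 0.
Definition inr_rV (u : 'rV[R]_b) : 'rV[R]_(a + b) := row_mx 0 u.

Lemma inl_rV_linear : linear inl_rV.
Proof. by move=> c u v; rewrite /inl_rV scale_row_mx add_row_mx scaler0 addr0. Qed.
Lemma inr_rV_linear : linear inr_rV.
Proof. by move=> c u v; rewrite /inr_rV scale_row_mx add_row_mx scaler0 addr0. Qed.
HB.instance Definition _ := GRing.isLinear.Build _ _ _ _ inl_rV inl_rV_linear.
HB.instance Definition _ := GRing.isLinear.Build _ _ _ _ inr_rV inr_rV_linear.

Lemma row_mxE_inlr (u : 'rV[R]_a) (v : 'rV[R]_b) :
  row_mx u v = inl_rV u + inr_rV v.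
Proof. by rewrite /inl_rV /inr_rV add_row_mx addr0 add0r. Qed.

End RowMx.

Section ProdManifold.
Context {R : realType} (M1 M2 : manifold R).
Local Notation d1 := (dim M1).
Local Notation d2 := (dim M2).
Local Notation T := (M1 * M2)%type.

Definition prod_dom (x : T) : set T := dom x.1 `*` dom x.2.
Definition prod_img (x : T) : set 'rV[R]_(d1 + d2) :=
  [set u | img x.1 (lsubmx u) /\ img x.2 (rsubmx u)].
Definition prod_chart (x y : T) : 'rV[R]_(d1 + d2) :=
  row_mx (chart x.1 y.1) (chart x.2 y.2).
Definition prod_chartV (x : T) (u : 'rV[R]_(d1 + d2)) : T :=
  (chartV x.1 (lsubmx u), chartV x.2 (rsubmx u)).

Lemma prod_open_dom x : open (prod_dom x).
Proof. by apply: open_setX; exact: open_dom. Qed.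

Lemma prod_open_img x : open (prod_img x).
Proof.
apply: (@openI _ (lsubmx @^-1` img x.1) (rsubmx @^-1` img x.2));
  (apply: open_comp; last exact: open_img) => u _.
  exact: continuous_lsubmx.
exact: continuous_rsubmx.
Qed.

Lemma prod_chart_img x y : prod_dom x y -> prod_img x (prod_chart x y).
Proof.
by case=> h1 h2; rewrite /prod_img /= row_mxKl row_mxKr; split; exact: chart_img.
Qed.

Lemma prod_chartV_dom x u : prod_img x u -> prod_dom x (prod_chartV x u).
Proof. by case=> h1 h2; split; exact: chartV_dom. Qed.

Lemma prod_chartK x y : prod_dom x y -> prod_chartV x (prod_chart x y) = y.
Proof.
case: y => y1 y2 [/= h1 h2].
by rewrite /prod_chartV /prod_chart row_mxKl row_mxKr !chartK.
Qed.

Lemma prod_chartVK x u : prod_img x u -> prod_chart x (prod_chartV x u) = u.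
Proof.
by case=> h1 h2; rewrite /prod_chart /= !chartVK // hsubmxK.
Qed.

Lemma prod_chart_continuous x y :
  prod_dom x y -> {for y, continuous (prod_chart x)}.
Proof.
case=> h1 h2.
have -> : prod_chart x = (inl_rV \o (chart x.1 \o fst)) \+
                         (inr_rV \o (chart x.2 \o snd)) :> (T -> _).
  by apply/funext => z; rewrite /prod_chart row_mxE_inlr.
apply: continuousD; (apply: continuous_comp; last exact: rV_linear_continuous).
  by apply: continuous_comp; [exact: cvg_fst|exact: chart_continuous].
by apply: continuous_comp; [exact: cvg_snd|exact: chart_continuous].
Qed.

Lemma prod_chartV_continuous x u :
  prod_img x u -> {for u, continuous (prod_chartV x)}.
Proof.
case=> h1 h2.
have c1 : {for u, continuous (chartV x.1 \o lsubmx)}.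
  apply: continuous_comp; first exact: continuous_lsubmx.
  exact: chartV_continuous.
have c2 : {for u, continuous (chartV x.2 \o rsubmx)}.
  apply: continuous_comp; first exact: continuous_rsubmx.
  exact: chartV_continuous.
exact: cvg_pair c1 c2.
Qed.

Lemma open_chartV_pre (M : manifold R) (x : M) (A : set M) :
  open A -> open (img x `&` chartV x @^-1` A).
Proof.
move=> oA; rewrite openE => u [xu Au].
apply: filterI; first by apply: open_nbhs_nbhs; split=> //; exact: open_img.
by apply: chartV_continuous => //; exact: open_nbhs_nbhs.
Qed.

Lemma prod_transition x y :
  smooth_on (prod_img x `&` prod_chartV x @^-1` prod_dom y)
            (prod_chart y \o prod_chartV x).
Proof.
move=> k; set U := _ `&` _.
have oU : open U.
  have -> : U = (lsubmx @^-1` (img x.1 `&` chartV x.1 @^-1` dom y.1)) `&`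
                (rsubmx @^-1` (img x.2 `&` chartV x.2 @^-1` dom y.2)).
    by apply/seteqP; split=> u; rewrite /U /prod_img /prod_dom /=; tauto.
  apply: openI; (apply: open_comp; last exact/open_chartV_pre/open_dom) => u _.
    exact: continuous_lsubmx.
  exact: continuous_rsubmx.
have -> : prod_chart y \o prod_chartV x =
    (inl_rV \o ((chart y.1 \o chartV x.1) \o lsubmx)) \+
    (inr_rV \o ((chart y.2 \o chartV x.2) \o rsubmx)).
  by apply/funext => u; rewrite /= /prod_chart row_mxE_inlr.
apply: Ck_add => //; (apply: Ck_lin => //; first exact: rV_linear_continuous).
  apply: (Ck_comp oU _ _ (transition_smooth x.1 y.1 k)).
    by move=> u [[? ?] [? ?]].
  exact: Ck_linear.
apply: (Ck_comp oU _ _ (transition_smooth x.2 y.2 k)).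
  by move=> u [[? ?] [? ?]].
exact: Ck_linear.
Qed.

Definition prod_manifold : manifold R := @Manifold R T (d1 + d2)
  prod_dom prod_img prod_chart prod_chartV prod_open_dom prod_open_img
  (fun x => conj (mem_dom x.1) (mem_dom x.2)) prod_chart_img prod_chartV_dom
  prod_chartK prod_chartVK prod_chart_continuous prod_chartV_continuous
  prod_transition
  (hausdorff_prod (@manifold_hausdorff R M1) (@manifold_hausdorff R M2))
  (second_countable_prod (@manifold_second_countable R M1)
                         (@manifold_second_countable R M2)).

End ProdManifold.

Section SmoothMaps.
Context {R : realType}.

Definition smooth_map {M N : manifold R} (f : M -> N) : Prop :=
  continuous f /\
  forall x y, smooth_on (img x `&` (f \o chartV x) @^-1` dom y)
                        (chart y \o f \o chartV x).

(* The tangent space at x is identified with 'rV_(dim M) through the selected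
   chart around x; tangent f x is the matrix of the differential of f at x,
   acting on row vectors from the right. *)
Definition tangent {M N : manifold R} (f : M -> N) (x : M) :
    'M[R]_(dim M, dim N) :=
  jacobian (chart (f x) \o f \o chartV x) (chart x x).

Lemma smooth_id (M : manifold R) : smooth_map (@id M).
Proof. by split=> [x|]; [exact: cvg_id|exact: transition_smooth]. Qed.

Section OpenPre.
Variables (M N : manifold R) (f : M -> N).
Lemma open_pre (x : M) (B : set N) : continuous f -> open B ->
  open (img x `&` (f \o chartV x) @^-1` B).
Proof.
move=> cf oB; have -> : (f \o chartV x) @^-1` B = chartV x @^-1` (f @^-1` B) by [].
apply: open_chartV_pre; apply: open_comp => // z _; exact: cf.
Qed.
End OpenPre.

Lemma smooth_comp (M N P : manifold R) (f : M -> N) (g : N -> P) :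
  smooth_map f -> smooth_map g -> smooth_map (g \o f).
Proof.
move=> [cf sf] [cg sg]; have cgf : continuous (g \o f).
  by move=> x; apply: continuous_comp; [exact: cf|exact: cg].
split=> // x z k; apply: Ck_local => u [xu uz].
set y := f (chartV x u).
pose V := img x `&` (f \o chartV x) @^-1` (dom y `&` g @^-1` dom z).
have oV : open V.
  apply: open_pre => //; apply: openI; first exact: open_dom.
  by apply: open_comp; [move=> ? _; exact: cg|exact: open_dom].
exists V, ((chart z \o g \o chartV y) \o (chart y \o f \o chartV x)); split => //.
- by split=> //; split=> //; exact: mem_dom.
- by move=> v [xv [yv zv]] /=; rewrite chartK.
- apply: (Ck_comp oV _ _ (sg y z k)).
    move=> v [xv [yv zv]]; split; first exact: chart_img.
    by rewrite /= chartK.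
  apply: Ck_sub (sf x y k) => v [xv [yv _]]; by split.
Qed.

Lemma diff_jacobian a b c (f : 'rV[R]_a -> 'rV[R]_b) (g : 'rV[R]_b -> 'rV[R]_c) u :
  differentiable f u -> differentiable g (f u) ->
  jacobian (g \o f) u = jacobian f u *m jacobian g (f u).
Proof.
move=> df dg; apply/row_matrixP => i; rewrite !rowE mulmxA.
by rewrite !mul_rV_lin1 diff_comp.
Qed.

Lemma near_jacobian a b (f g : 'rV[R]_a -> 'rV[R]_b) u :
  (\near u, f u = g u) -> differentiable g u -> jacobian f u = jacobian g u.
Proof.
move=> fg dg; have [_ E] := near_diff fg dg.
exact: (congr1 (fun h => lin1_mx h) E).
Qed.

Lemma tangent_id (M : manifold R) (x : M) : tangent id x = 1%:M.
Proof.
rewrite /tangent (@near_jacobian _ _ _ id); last exact: ex_diff.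
  apply/row_matrixP => i; rewrite rowE mul_rV_lin1.
  by rewrite diff_val rowE mulmx1.
have nx : nbhs (chart x x) (img x).
  by apply: open_nbhs_nbhs; split; [exact: open_img|exact/chart_img/mem_dom].
apply: filterS nx.
by move=> u /= xu; rewrite chartVK.
Qed.

Lemma smooth_map_diff (M N : manifold R) (f : M -> N) (x : M) :
  smooth_map f -> differentiable (chart (f x) \o f \o chartV x) (chart x x).
Proof.
move=> [cf sf]; apply: (sf x (f x) 1%N).1; split.
  exact: chart_img (mem_dom x).
by rewrite /= chartK; exact: mem_dom.
Qed.

Lemma tangent_comp (M N P : manifold R) (f : M -> N) (g : N -> P) (x : M) :
  smooth_map f -> smooth_map g ->
  tangent (g \o f) x = tangent f x *m tangent g (f x).
Proof.
move=> sf sg; rewrite /tangent.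
have E : (chart (f x) \o f \o chartV x) (chart x x) = chart (f x) (f x).
  by rewrite /= chartK //; exact: mem_dom.
have df := smooth_map_diff x sf; have dg := smooth_map_diff (f x) sg.
have := diff_jacobian df; rewrite E => /(_ _ _ dg) <-.
apply: near_jacobian; last by apply: differentiable_comp => //; rewrite E.
have oV := @open_pre _ _ f x _ sf.1 (open_dom (f x)).
apply: filterS (open_nbhs_nbhs (conj oV _)) => [u [_ fu] /=|].
  by rewrite chartK.
split; first exact: chart_img (mem_dom x).
by rewrite /= chartK; exact: mem_dom.
Qed.

End SmoothMaps.

Section Forms.
Context {R : realType}.

Definition multilinear_rows {q d : nat} (f : 'M[R]_(q, d) -> R) : Prop :=
  forall (A B C : 'M[R]_(q, d)) (i : 'I_q) (b c : R),
    row i A = b *: row i B + c *: row i C ->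
    row' i B = row' i A -> row' i C = row' i A -> f A = b * f B + c * f C.

Definition alternating_rows {q d : nat} (f : 'M[R]_(q, d) -> R) : Prop :=
  forall (A : 'M[R]_(q, d)) (i j : 'I_q), i != j -> row i A = row j A -> f A = 0.

(* Fields of functions of q tangent vectors, given as the rows of a matrix;
   the differential q-forms are those satisfying is_form. *)
Definition qfield (N : manifold R) (q : nat) : Type :=
  N -> 'M[R]_(q, dim N) -> R.
HB.instance Definition _ (N : manifold R) (q : nat) :=
  GRing.Zmodule.on (qfield N q).

Definition pullback {M N : manifold R} {q : nat} (f : M -> N) (w : qfield N q) :
    qfield M q :=
  fun x A => w (f x) (A *m tangent f x).

(* The expression of w in the coordinates of the selected chart around x. *)
Definition local_expr {N : manifold R} {q : nat} (w : qfield N q) (x : N)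
    (u : 'rV[R]_(dim N)) (A : 'M[R]_(q, dim N)) : R :=
  let y := chartV x u in w y (A *m jacobian (chart y \o chartV x) u).

Definition is_form {N : manifold R} {q : nat} (w : qfield N q) : Prop :=
  (forall x, multilinear_rows (w x) /\ alternating_rows (w x)) /\
  (forall x A, smooth_on (img x) (fun u => local_expr w x u A)).

Definition extd {N : manifold R} {q : nat} (w : qfield N q) : qfield N q.+1 :=
  fun x A => \sum_(i < q.+1) (-1) ^+ i *
    'D_(row i A) (fun u => local_expr w x u (row' i A)) (chart x x).

Definition exact_form {N : manifold R} {q : nat} : qfield N q -> Prop :=
  if q is q'.+1 then
    fun w => exists2 h : qfield N q', is_form h & w = extd h
  else fun w => w = 0.

(* H^q(N) = 0, in de Rham cohomology. *)
Definition deRham_trivial (N : manifold R) (q : nat) : Prop :=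
  forall w : qfield N q, is_form w -> extd w = 0 -> exact_form w.

Definition const_form {n q : nat} (w0 : 'M[R]_(q, n) -> R) : qfield (euclid n) q :=
  fun _ => w0.

(* x and y are homologous 0-cycles: y - x is the boundary of the smooth singular
   1-chain \sum_i a i * sigma i. A smooth simplex is given by an extension to
   the whole line. *)
Definition homologous_points {N : manifold R} (x y : N) : Prop :=
  exists (r : nat) (a : 'I_r -> int) (sigma : 'I_r -> euclid (R := R) 1 -> N),
    (forall i, smooth_map (sigma i)) /\
    forall z : N, (y == z)%:Z - (x == z)%:Z =
      \sum_(i < r) a i * ((sigma i (const_mx 1) == z)%:Z
                          - (sigma i (const_mx 0) == z)%:Z).

Lemma pullback_id (N : manifold R) (q : nat) (w : qfield N q) :
  pullback id w = w.
Proof.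
by apply/funext => x; apply/funext => A; rewrite /pullback tangent_id mulmx1.
Qed.

Lemma pullback_comp (M N P : manifold R) (q : nat) (f : M -> N) (g : N -> P)
    (w : qfield P q) : smooth_map f -> smooth_map g ->
  pullback (g \o f) w = pullback f (pullback g w).
Proof.
move=> sf sg; apply/funext => x; apply/funext => A.
by rewrite /pullback tangent_comp // mulmxA.
Qed.

End Forms.

Section DiffGroup.
Context {R : realType} {N : manifold R} {q : nat}.

Definition preserving_diffeo (w : qfield N q) (f : N -> N) : Prop :=
  [/\ smooth_map f,
      exists g : N -> N, [/\ smooth_map g, cancel f g & cancel g f]
    & pullback f w = w].

Variable w : qfield N q.

Record Diff := MkDiff {
  diff_fun :> N -> N;
  diffP : `[< preserving_diffeo w diff_fun >]
}.
HB.instance Definition _ := [isSub for diff_fun].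
HB.instance Definition _ := [Choice of Diff by <:].

Lemma preserving_id : `[< preserving_diffeo w id >].
Proof.
apply/asboolP; split; [exact: smooth_id| |exact: pullback_id].
by exists id; split=> //; exact: smooth_id.
Qed.

Lemma preserving_comp (f g : Diff) : `[< preserving_diffeo w (f \o g) >].
Proof.
have /asboolP[sf [f' [sf' fK f'K]] fw] := diffP f.
have /asboolP[sg [g' [sg' gK g'K]] gw] := diffP g.
apply/asboolP; split; first exact: smooth_comp.
  by exists (g' \o f'); split; [exact: smooth_comp|exact: can_comp|exact: can_comp].
by rewrite (pullback_comp w sg sf) fw.
Qed.

Lemma preserving_inv_ex (f : Diff) :
  exists g : N -> N, [/\ `[< preserving_diffeo w g >], cancel f g & cancel g f].
Proof.
have /asboolP[sf [g [sg fK gK]] fw] := diffP f.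
exists g; split; [apply/asboolP|exact: fK|exact: gK].
split; [exact: sg|by exists f|].
transitivity (pullback (f \o g) w); first by rewrite (pullback_comp w sg sf) fw.
have -> : f \o g = id by apply/funext => x; exact: gK.
exact: pullback_id.
Qed.

Definition Diff_one : Diff := MkDiff preserving_id.
Definition Diff_mul (f g : Diff) : Diff := MkDiff (preserving_comp f g).
Definition Diff_inv (f : Diff) : Diff :=
  let: exist _ h := cid (preserving_inv_ex f) in let: And3 hw _ _ := h in MkDiff hw.

Lemma Diff_invK (f : Diff) : cancel f (Diff_inv f) /\ cancel (Diff_inv f) f.
Proof. by rewrite /Diff_inv; case: cid => g [? ? ?]. Qed.

Lemma Diff_mulA : associative Diff_mul.
Proof. by move=> f g h; exact: val_inj. Qed.
Lemma Diff_mul1 : left_id Diff_one Diff_mul.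
Proof. by move=> f; exact: val_inj. Qed.
Lemma Diff_1mul : right_id Diff_one Diff_mul.
Proof. by move=> f; exact: val_inj. Qed.
Lemma Diff_mulV : left_inverse Diff_one Diff_inv Diff_mul.
Proof. by move=> f; apply/val_inj/funext => x; exact: (Diff_invK f).1. Qed.
Lemma Diff_Vmul : right_inverse Diff_one Diff_inv Diff_mul.
Proof. by move=> f; apply/val_inj/funext => x; exact: (Diff_invK f).2. Qed.

HB.instance Definition _ := isGroup.Build Diff
  Diff_mulA Diff_mul1 Diff_1mul Diff_mulV Diff_Vmul.

End DiffGroup.

Section GroupCochains.
Context {G : groupType} {A : zmodType}.

(* (g_1, ..., g_i g_(i+1), ..., g_(s+1)), with i counted from 0. *)
Definition contract {s : nat} (i : 'I_s) (g : 'I_s.+1 -> G) : 'I_s -> G :=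
  fun j => let a := g (widen_ord (leqnSn s) j) in let b := g (lift ord0 j) in
    if (j < i)%N then a else if j == i then (a * b)%g else b.

Definition cobd (act : A -> G -> A) {s : nat} (f : ('I_s -> G) -> A) :
    ('I_s.+1 -> G) -> A :=
  fun g => f (fun j => g (lift ord0 j))
    + \sum_(i < s) f (contract i g) *~ ((-1) ^+ i.+1)
    + act (f (fun j => g (widen_ord (leqnSn s) j))) (g ord_max) *~ ((-1) ^+ s.+1).

Definition trivial_act (a : A) (_ : G) : A := a.

End GroupCochains.

Section PointCocycle.
Context {R : realType} {N : manifold R} {G : groupType}.
Variable rho : G -> N -> N.

Definition form_act {q : nat} (b : qfield N q) (g : G) : qfield N q :=
  pullback (rho g) b.

Definition delta1 {s q : nat} (c : ('I_s -> G) -> qfield N q) :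
    ('I_s.+1 -> G) -> qfield N q := cobd form_act c.

Definition delta2 {s q : nat} (c : ('I_s -> G) -> qfield N q) :
    ('I_s -> G) -> qfield N q.+1 := fun g => extd (c g) *~ ((-1) ^+ s).

(* The cochains phi_{i,m-i-1} attached to a form w of degree m = p + 1; only the
   components phi i j with i + j = p = m - 1 are relevant. *)
Record zigzag {p : nat} (w : qfield N p.+1)
    (phi : forall i j : nat, ('I_i -> G) -> qfield N j) : Prop := Zigzag {
  zigzag_form : forall i j g, (i + j)%N = p -> is_form (phi i j g);
  zigzag_start : forall g, w = - extd (phi 0 p g);
  zigzag_step : forall i j, (i + j.+1)%N = p ->
    delta1 (phi i j.+1) + delta2 (phi i.+1 j) = 0
}.

(* The conditions under which c_a(w) is defined, for a form w of degree m = p + 1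
   and a the class of the 0-cycle x, hence with H^(m-p-1)(N) = H^0(N). *)
Record point_cocycle_defined {p : nat} (w : qfield N p.+1) (x : N) : Prop :=
  PointCocycleDefined {
    pcd_invariant : forall g, form_act w g = w;
    pcd_form : is_form w;
    pcd_exact : exact_form w;
    pcd_degree : (1 <= p)%N;
    pcd_trivial : forall k, (1 <= k <= p)%N -> deRham_trivial N k;
    pcd_nontrivial : ~ deRham_trivial N 0;
    pcd_class : forall g, homologous_points x (rho g x)
  }.

Definition point_cocycle (p : nat)
    (phi : forall i j : nat, ('I_i -> G) -> qfield N j) (x : N) :
    ('I_p.+1 -> G) -> R :=
  fun g => delta1 (phi p 0) g x 0.

End PointCocycle.

(* Main.v *)
(* On N = R^n x M the translations of R^n form an abelian group of
   diffeomorphisms preserving w, and the class of the point cocycle is already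
   nontrivial on it. By contracting R^n (Poincare lemma with parameters), N has
   the same vanishing cohomology as M, so zigzags exist, and two of them give
   cohomologous point cocycles: their difference can be pushed down the double
   complex to a cochain of closed functions, i.e. of constants.
   On the translation group one zigzag is explicit: up to constants,
   phi_(i,j) at (g_1, ..., g_i) is the form w0(g_1, ..., g_i, u, ...), whose
   coefficients are linear in the position u in R^n. It yields the m-cocycle
   w0(g_1, ..., g_m) / m!. Antisymmetrizing over the permutations of
   (g_1, ..., g_m) kills every coboundary on commuting elements, but turns this
   cocycle into the nonzero number w0(g_1, ..., g_m). *)
Require Import Defs.
From HB Require Import structures.
From mathcomp Require Import all_boot all_order all_algebra all_fingroup.
From mathcomp Require Import all_classical all_reals all_analysis.
From mathcomp Require Import zify ring lra.
Set Implicit Arguments.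
Unset Strict Implicit.
Unset Printing Implicit Defensive.
Import Order.TTheory GRing.Theory Num.Theory.
Import numFieldNormedType.Exports.
Local Open Scope classical_set_scope.
Local Open Scope ring_scope.
(* The libraries above shadow [dim] and [dom]. *)
Import Defs.

(** * Alternating multilinear functions of matrix rows *)

(** The explicit zigzag is available only over translations, since a general element of G moves a
    primitive of w in no prescribed way. So an arbitrary zigzag over G is restricted along the
    homomorphism [iota] from the translations and compared with the explicit one there. The
    primitive of omega_M enters the explicit zigzag only in phi_(0,m-1); it is translation invariant
    and leaves no trace in the cocycle. The factor 1/m! arises because d of the contraction of a
    constant (j+1)-form with u is j+1 times that form, and the zigzag divides by j+1 once for each j
    from m-1 down to 0.

    The analytic work comes from the encoding: a form at x is read in the chart selected at x, so
    [extd] at different points is computed in different charts. That these values fit together is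
    the naturality of d, which rests on the symmetry of second derivatives. The homotopy operator
    needs differentiation under the integral sign; its formula is proved for closed forms only,
    which removes the term containing dw. *)

Section AlternatingForms.
Context {R : realType}.

Definition setrow {q d} (i : 'I_q) (r : 'rV[R]_d) (A : 'M[R]_(q, d)) : 'M[R]_(q, d) :=
  \matrix_(k, j) (if k == i then r 0 j else A k j).

Lemma row_setrow {q d} (i : 'I_q) (r : 'rV[R]_d) (A : 'M[R]_(q, d)) :
  row i (setrow i r A) = r.
Proof. by apply/rowP => j; rewrite !mxE eqxx. Qed.

Lemma row_setrow_neq {q d} (i k : 'I_q) (r : 'rV[R]_d) (A : 'M[R]_(q, d)) :
  k != i -> row k (setrow i r A) = row k A.
Proof. by move=> /negPf ki; apply/rowP => j; rewrite !mxE ki. Qed.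

Lemma row'_setrow {q d} (i : 'I_q) (r : 'rV[R]_d) (A : 'M[R]_(q, d)) :
  row' i (setrow i r A) = row' i A.
Proof. by apply/matrixP => k j; rewrite !mxE eq_sym (negPf (neq_lift _ _)). Qed.

Lemma setrow_id {q d} (i : 'I_q) (A : 'M[R]_(q, d)) : setrow i (row i A) A = A.
Proof. by apply/matrixP => k j; rewrite !mxE; case: eqP => [->|]. Qed.

Lemma setrow_row' {q d} (i : 'I_q) (A B : 'M[R]_(q, d)) r :
  row' i A = row' i B -> setrow i r A = setrow i r B.
Proof.
move=> /matrixP AB; apply/matrixP => k j; rewrite !mxE; case: (unliftP i k) => [l ->|->].
  by rewrite eq_sym (negPf (neq_lift _ _)); have := AB l j; rewrite !mxE.
by rewrite eqxx.
Qed.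

Lemma setrow_mul {q d e} (i : 'I_q) (r : 'rV[R]_d) (A : 'M[R]_(q, d)) (J : 'M[R]_(d, e)) :
  setrow i r A *m J = setrow i (r *m J) (A *m J).
Proof.
apply/row_matrixP => k; rewrite row_mul; have [->|ki] := eqVneq k i.
  by rewrite !row_setrow.
by rewrite !row_setrow_neq // row_mul.
Qed.

Lemma setrow_col_mxu {q d} (r x : 'rV[R]_d) (B : 'M[R]_(q, d)) :
  setrow (ord0 : 'I_(1 + q)) r (col_mx x B) = col_mx r B.
Proof.
apply/matrixP => k j; rewrite mxE; case: (split_ordP k) => l ->.
  have l0 : lshift q l = ord0 :> 'I_(1 + q) by apply/val_inj; rewrite ord1.
  by rewrite !col_mxEu l0 eqxx ord1.
by rewrite !col_mxEd (_ : rshift 1 l == ord0 = false).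
Qed.

Lemma setrow_col_mxd {q d} (i : 'I_q) (r x : 'rV[R]_d) (B : 'M[R]_(q, d)) :
  setrow (rshift 1 i) r (col_mx x B) = col_mx x (setrow i r B).
Proof.
apply/matrixP => k j; rewrite mxE; case: (split_ordP k) => l ->.
  by rewrite !col_mxEu ord1.
by rewrite !col_mxEd mxE eq_rshift.
Qed.

(** Trades the condition on three matrices for linearity in one row with the others frozen, so that
    the theory of linear maps applies. *)
Lemma multilinearP {q d} (f : 'M[R]_(q, d) -> R) :
  multilinear_rows f <-> forall i A, linear (fun r => f (setrow i r A) : R^o).
Proof.
split=> [mf i A c u v|lf A B C i b c Ai AB AC].
  rewrite -[X in setrow i (_ + X)]scale1r -[X in _ = _ + X]mul1r.
  by apply: (mf _ _ _ i); rewrite ?row_setrow // !row'_setrow.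
have lin (x : 'rV[R]_d) (y : 'rV[R]_d) : f (setrow i (b *: x + c *: y) A)
    = b * f (setrow i x A) + c * f (setrow i y A).
  (* The coefficient -1 at two zero vectors; this vanishing turns linearity into homogeneity. *)
  have l0 : f (setrow i 0 A) = 0.
    by have := lf i A (-1) 0 0; rewrite scaler0 addr0 scaleN1r addNr.
  rewrite lf; congr (_ + _).
  by have := lf i A c y 0; rewrite addr0 l0 addr0.
rewrite -{1}(setrow_id i A) Ai lin -(setrow_row' _ AB) -(setrow_row' _ AC).
by rewrite !setrow_id.
Qed.

Lemma multilinear_col_mx {q d} (f : 'M[R]_(q.+1, d) -> R) (B : 'M[R]_(q, d)) :
  multilinear_rows f -> linear (fun r : 'rV[R]_d => f (col_mx r B : 'M[R]_(1 + q, d)) : R^o).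
Proof.
move=> /multilinearP mf c u v; have := mf ord0 (col_mx 0 B : 'M[R]_(1 + q, d)) c u v.
by rewrite !setrow_col_mxu.
Qed.

Lemma multilinear_dsub {q d} (f : 'M[R]_(q.+1, d) -> R) (r : 'rV[R]_d) :
  multilinear_rows f ->
  multilinear_rows (fun B : 'M[R]_(q, d) => f (col_mx r B : 'M[R]_(1 + q, d))).
Proof.
move=> /multilinearP mf; apply/multilinearP => i B c u v.
have := mf (rshift 1 i) (col_mx r B : 'M[R]_(1 + q, d)) c u v.
by rewrite !setrow_col_mxd.
Qed.

Lemma multilinear_mulmx {q d e} (f : 'M[R]_(q, e) -> R) (J : 'M[R]_(d, e)) :
  multilinear_rows f -> multilinear_rows (fun A : 'M[R]_(q, d) => f (A *m J)).
Proof.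
move=> /multilinearP mf; apply/multilinearP => i B c u v.
by rewrite !setrow_mul mulmxDl -scalemxAl mf.
Qed.

Lemma alternating_mulmx {q d e} (f : 'M[R]_(q, e) -> R) (J : 'M[R]_(d, e)) :
  alternating_rows f -> alternating_rows (fun A : 'M[R]_(q, d) => f (A *m J)).
Proof.
by move=> af A i j ij Aij; apply: (af _ i j) => //; rewrite !row_mul Aij.
Qed.

Section Alternating.
Context {q d : nat} (f : 'M[R]_(q, d) -> R).
Hypotheses (mf : multilinear_rows f) (af : alternating_rows f).

(** Polarization: put the sum of rows i and j in both places and expand; the two diagonal terms
    vanish, so the two mixed ones are opposite. *)
Lemma alternating_xrow (i j : 'I_q) A : i != j -> f (xrow i j A) = - f A.
Proof.
move=> ij; have mfl := multilinearP f; have [/(_ mf) lf _] := mfl.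
have ji : j != i by rewrite eq_sym.
pose X u v := setrow i u (setrow j v A).
have Xc u v : X u v = setrow j v (setrow i u A).
  apply/row_matrixP => k; rewrite /X.
  have [->|kj] := eqVneq k j; first by rewrite row_setrow row_setrow_neq // row_setrow.
  rewrite [RHS]row_setrow_neq //; have [->|ki] := eqVneq k i; first by rewrite !row_setrow.
  by rewrite !row_setrow_neq.
have addl u v w : f (X (u + v) w) = f (X u w) + f (X v w).
  by have := lf i (setrow j w A) 1 u v; rewrite !scale1r.
have addr u v w : f (X u (v + w)) = f (X u v) + f (X u w).
  by rewrite !Xc; have := lf j (setrow i u A) 1 v w; rewrite !scale1r.
have X0 u : f (X u u) = 0.
  by apply: (af ij); rewrite /X row_setrow row_setrow_neq // row_setrow.
have := X0 (row i A + row j A); rewrite addl !addr !X0 add0r addr0.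
have -> : X (row i A) (row j A) = A by rewrite /X !setrow_id.
have -> : X (row j A) (row i A) = xrow i j A.
  apply/matrixP => k l; rewrite !mxE.
  have [->|ki] := eqVneq k i; first by rewrite tpermL.
  by have [->|kj] := eqVneq k j; [rewrite tpermR|rewrite tpermD // eq_sym].
by move/eqP; rewrite addr_eq0 => /eqP ->; rewrite opprK.
Qed.

Lemma alternating_row_perm (s : 'S_q) A : f (row_perm s A) = (-1) ^+ s * f A.
Proof.
have [ts -> dts] := prod_tpermP s.
elim: ts dts A => [|t ts IH] /= dts A.
  by rewrite big_nil odd_perm1 mul1r row_perm1.
have /andP[dt dts'] := dts.
rewrite big_cons odd_permM row_permM -[row_perm (tperm _ _) _]/(xrow t.1 t.2 _).
by rewrite alternating_xrow // IH // odd_tperm dt signr_addb /= expr1 -mulrA mulN1r.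
Qed.

End Alternating.

(** Moving row i to the front is a cycle of sign (-1)^i. This links the signs of [extd] with the
    insertion of a vector as first argument. *)
Lemma alternating_front {q d} (f : 'M[R]_(q.+1, d) -> R) (i : 'I_q.+1) r (A : 'M[R]_(q.+1, d)) :
  multilinear_rows f -> alternating_rows f ->
  f (setrow i r A) = (-1) ^+ i * f (col_mx r (row' i A) : 'M[R]_(1 + q, d)).
Proof.
move=> mf af; have -> : col_mx r (row' i A) = row_perm (lift_perm ord0 i 1) (setrow i r A) :>
  'M[R]_(1 + q, d).
  apply/matrixP => k j; rewrite [RHS]mxE; case: (split_ordP k) => l ->.
    have -> : lshift q l = ord0 :> 'I_(1 + q) by apply/val_inj; rewrite ord1.
    have {1}-> : ord0 = lshift q ord0 :> 'I_(1 + q) by exact: val_inj.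
    by rewrite col_mxEu lift_perm_id mxE eqxx ord1.
  have rl : rshift 1 l = lift ord0 l by exact: val_inj.
  by rewrite col_mxEd rl lift_perm_lift perm1 !mxE eq_sym (negPf (neq_lift _ _)).
rewrite alternating_row_perm // odd_lift_perm /= odd_perm1 addbF signr_odd.
by rewrite mulrA -expr2 sqrr_sign mul1r.
Qed.

End AlternatingForms.

(** * Symmetry of second derivatives *)

(** A pair (i, j) records the omission of i and then of j among the remaining indices. Performing
    the two omissions in the other order is an involution [h] that reverses the sign, so twice the
    sum is zero. *)
Lemma alternating_double_sum (V : zmodType) (q : nat) (f : 'I_q.+1 -> 'I_q -> V) :
  (forall v : V, v + v = 0 -> v = 0) ->
  (forall i j i' j', lift i j = i' -> lift i' j' = i -> f i j = f i' j') ->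
  \sum_(i < q.+1) \sum_(j < q) f i j *~ (-1) ^+ (i + j) = 0.
Proof.
move=> V2 sf; rewrite pair_big /=.
pose h (p : 'I_q.+1 * 'I_q) := (lift p.1 p.2, odflt p.2 (unlift (lift p.1 p.2) p.1)).
have hP p : lift (h p).1 (h p).2 = p.1.
  rewrite /h /=; case: unliftP => [j' {2}->//|/= e].
  by have := neq_lift p.1 p.2; rewrite -e eqxx.
have hK : involutive h.
  case=> i j; have := hP (i, j); case E : (h (i, j)) => [i' j'] /= l'.
  have li : i' = lift i j by case: E.
  rewrite /h /= l'; congr (_, _); rewrite li.
  by case: unliftP => [j'' /lift_inj ->//|e]; have := neq_lift i j; rewrite e eqxx.
have hl p : lift p.1 p.2 = (h p).1 by [].
move: h hP hK hl => h hP hK hl.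
set S := \sum_(p | _) _; suff : S + S = 0 by exact: V2.
rewrite {2}/S (reindex_inj (inv_inj hK)) /= -big_split /= big1 // => p _.
have := hP p; have := hl p; case: p (h p) => [i j] [i' j'] /= li l'.
rewrite -(sf _ _ _ _ li l').
suff -> : (-1) ^+ (i' + j') = - (-1) ^+ (i + j) :> int by rewrite mulrNz addrN.
move/(congr1 val): li; move/(congr1 val): l' => /= l' li.
rewrite -signr_odd -[in RHS]signr_odd.
suff -> : odd (i' + j') = ~~ odd (i + j) by case: odd; rewrite ?expr0 ?expr1 ?opprK.
move: l' li; rewrite /bump; case: leqP => h1; case: leqP => h2 /=; lia.
Qed.

Lemma row'_row' (T : Type) q d (A : 'M[T]_(q.+2, d)) (i i' : 'I_q.+2) (j j' : 'I_q.+1) :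
  lift i j = i' -> lift i' j' = i -> row' j (row' i A) = row' j' (row' i' A).
Proof.
move=> li l'; apply/matrixP => k l; rewrite !mxE; congr (A _ _); apply/val_inj => /=.
move/(congr1 val): li; move/(congr1 val): l' => /=; rewrite /bump.
by do 6?[case: leqP => ? /=]; lia.
Qed.

Lemma subrACA (V : zmodType) (p q r t : V) : p - q - (r - t) = p - r - (q - t).
Proof. by rewrite !opprB (addrC t (- r)) addrACA (addrC (- q)). Qed.

Section Schwarz.
Context {R : realType}.

Lemma derive_line (V : normedModType R) (f : V -> R) (x v : V) (t : R) :
  differentiable f (x + t *: v) ->
  is_derive t 1 (fun s : R => f (x + s *: v)) ('D_v f (x + t *: v)).
Proof.
move=> df.
have dl : is_diff t (fun s : R => x + s *: v) (fun s => s *: v).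
  by apply: is_diff_eq; rewrite add0r.
have dc : differentiable (f \o (fun s : R => x + s *: v)) t.
  by apply: differentiable_comp.
apply: DeriveDef; first exact: diff_derivable.
by rewrite deriveE // diff_comp // /= diff_val scale1r deriveE.
Qed.

Lemma MVT_line (V : normedModType R) (f : V -> R) (x v : V) :
  (forall t : R, 0 <= t <= 1 -> differentiable f (x + t *: v)) ->
  exists2 t : R, 0 < t < 1 & f (x + v) - f x = 'D_v f (x + t *: v).
Proof.
move=> df.
have [| | |t t01] := @MVT R (fun s => f (x + s *: v)) (fun s => 'D_v f (x + s *: v)) 0 1.
- exact: ltr01.
- move=> t; rewrite in_itv /= => /andP[t0 t1]; apply: derive_line; apply: df.
  by rewrite !ltW.
- apply: continuous_in_subspaceT => t; rewrite inE /= in_itv /= => t01.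
  have [dt _] := derive_line (df _ t01).
  by apply: differentiable_continuous; apply/derivable1_diffP.
rewrite scale1r scale0r addr0 subr0 mulr1 => E; exists t => //.
Qed.

Lemma derive_linear (V W : normedModType R) (f : V -> W) (x : V) :
  differentiable f x -> linear (fun v => 'D_v f x).
Proof. by move=> df c u v; rewrite !deriveE // linearP. Qed.

Lemma deriveZr (V W : normedModType R) (f : V -> W) (x : V) c v :
  differentiable f x -> 'D_(c *: v) f x = c *: 'D_v f x.
Proof. by move=> df; rewrite !deriveE // linearZ. Qed.

Lemma differentiable_shift (V W : normedModType R) (f : V -> W) (x v : V) :
  differentiable f (x + v) -> differentiable (fun y => f (y + v)) x /\
  forall u, 'D_u (fun y => f (y + v)) x = 'D_u f (x + v).
Proof.
move=> df; have ds : is_diff x (fun y => y + v) id.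
  by apply: is_diff_eq; rewrite addr0.
have dc : differentiable (f \o (fun y => y + v)) x by apply: differentiable_comp.
by split=> // u; rewrite deriveE // diff_comp // /= diff_val deriveE.
Qed.

(* The second difference of f is computed by applying the mean value theorem
   first to the increment y |-> f (y + v) - f y and then to its derivative. *)
Lemma second_difference (V : normedModType R) (f : V -> R) (x u v : V) :
  (forall a b : R, 0 <= a <= 1 -> 0 <= b <= 1 ->
    differentiable f (x + a *: u + b *: v) /\
    differentiable ('D_u f) (x + a *: u + b *: v)) ->
  exists a b : R, [/\ 0 <= a <= 1, 0 <= b <= 1 &
    f (x + u + v) - f (x + u) - (f (x + v) - f x) = 'D_v ('D_u f) (x + a *: u + b *: v)].
Proof.
move=> df; pose g y := f (y + v) - f y.
have i0 : 0 <= (0 : R) <= 1 by rewrite lexx ler01.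
have i1 : 0 <= (1 : R) <= 1 by rewrite lexx ler01.
have dg (t : R) : 0 <= t <= 1 -> differentiable g (x + t *: u) /\
    'D_u g (x + t *: u) = 'D_u f (x + t *: u + v) - 'D_u f (x + t *: u).
  move=> t01; have [d1 _] := df t 1 t01 i1; have [d0 _] := df t 0 t01 i0.
  rewrite scale1r in d1; rewrite scale0r addr0 in d0.
  have [ds Ds] := differentiable_shift d1.
  split; first exact: differentiableB.
  by rewrite deriveB ?Ds //; exact: diff_derivable.
have [t t01 Eg] := MVT_line (fun t h => (dg t h).1).
have t01' : 0 <= t <= 1 by case/andP: t01 => /ltW-> /ltW->.
have [|b b01 Eb] := @MVT_line V ('D_u f) (x + t *: u) v.
  by move=> b b01; have [] := df t b t01' b01.
exists t, b; split=> //; first by case/andP: b01 => /ltW-> /ltW->.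
by rewrite -Eb -(dg t t01').2 -Eg.
Qed.

(** The mean value theorem gives the two mixed derivatives equal values only at different points
    near x; continuity then forces equality at x. *)
Lemma eq_of_close (V : normedModType R) (g h : V -> R) (x : V) (U : set V) :
  nbhs x U -> {for x, continuous g} -> {for x, continuous h} ->
  (forall d, 0 < d -> (forall y, ball x d y -> U y) ->
    exists p q, [/\ ball x d p, ball x d q & g p = h q]) -> g x = h x.
Proof.
move=> nU cg ch close.
apply/eqP; rewrite -subr_eq0 -normr_le0; apply/ler_addgt0Pl => e e0; rewrite addr0.
have e20 : 0 < e / 2 by rewrite divr_gt0.
have /cvgrPdist_lt/(_ _ e20) cuv := cg.
have /cvgrPdist_lt/(_ _ e20) cvu := ch.
have : \forall y \near x, [/\ U y, `|g x - g y| < e / 2 & `|h x - h y| < e / 2].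
  by apply: filterS3 nU cuv cvu => y ? ? ?; split.
case/nbhs_ballP=> d /= d0 dN.
have [|p [q [Bp Bq pq]]] := close _ d0; first by move=> y /dN[].
have [_ N2 _] := dN _ Bp; have [_ _ N1] := dN _ Bq.
rewrite -pq in N1; rewrite distrC in N1.
have := ler_distD (g p) (g x) (h x).
lra.
Qed.

(** The second difference of f is symmetric in the two increments, so expressing it as a mixed
    derivative in both orders equates the two derivatives at nearby points. Small increments s u, s
    v bring these points to x. *)
Lemma schwarz a (U : set 'rV[R]_a) (f : 'rV[R]_a -> R) x u v :
  open U -> U x -> Ck 2 U f -> 'D_u ('D_v f) x = 'D_v ('D_u f) x.
Proof.
move=> oU Ux [df Df].
have [_ Duv] := Df v; have [_ Dvu] := Df u.
have dDu w y : U y -> differentiable ('D_w f) y by have [+ _] := Df w; apply.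
apply: (eq_of_close _ (Duv u x Ux) (Dvu v x Ux)).
  by apply: open_nbhs_nbhs; split; [exact: oU|].
move=> d d0 dN.
(* The choice s (|u| + |v| + 1) = d / 2 keeps the whole parallelogram in the ball; the summand 1
   makes the divisor positive. *)
have [s s0 sd] : exists2 s : R, 0 < s & forall a b : R, 0 <= a <= 1 -> 0 <= b <= 1 ->
    ball x d (x + a *: (s *: u) + b *: (s *: v)).
  have M0 : 0 < `|u| + `|v| + 1 by rewrite ltr_wpDl // addr_ge0.
  have [s s0 sM] : exists2 s : R, 0 < s & s * (`|u| + `|v| + 1) = d / 2.
    exists (d / 2 / (`|u| + `|v| + 1)); first by rewrite !divr_gt0.
    by rewrite divfK // gt_eqF.
  exists s => // b c /andP[b0 b1] /andP[c0 c1].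
  rewrite -ball_normE /= -addrA opprD addNKr normrN.
  apply: le_lt_trans (ler_normD _ _) _; rewrite !normrZ (ger0_norm b0) (ger0_norm c0)
    (ger0_norm (ltW s0)).
  apply: (@le_lt_trans _ _ (s * (`|u| + `|v| + 1))).
    rewrite !mulrDr mulr1 ler_wpDr // ?(ltW s0) // lerD //.
      by rewrite ler_piMl // mulr_ge0 // ltW.
    by rewrite ler_piMl // mulr_ge0 // ltW.
  by rewrite sM ltr_pdivrMr // ltr_pMr // ltr1n.
(* Both mixed derivatives acquire the same factor s^2, which cancels at the end. *)
have scal : forall (p q : 'rV[R]_a) (b c : R), 0 <= b <= 1 -> 0 <= c <= 1 ->
   let y := x + b *: (s *: u) + c *: (s *: v) in
   differentiable ('D_(s *: q) f) y /\
   'D_(s *: p) ('D_(s *: q) f) y = s ^+ 2 * 'D_p ('D_q f) y.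
  move=> p q b c hb hc y; have Uy := dN _ (sd b c hb hc).
  have dsq : differentiable (s \*: 'D_q f) y by apply: differentiableZ; exact: dDu.
  have E : \forall z \near y, 'D_(s *: q) f z = (s \*: 'D_q f) z.
    apply: filterS (open_nbhs_nbhs (conj oU Uy)) => z Uz.
    by rewrite deriveZr //; exact: df.
  split; first exact: (near_diff E dsq).1.
  rewrite (near_eq_derive _ E) deriveZr // deriveZ /= ?scalerA -?expr2 //.
  by apply/diff_derivable/dDu.
have sub : forall b c : R, 0 <= b <= 1 -> 0 <= c <= 1 ->
    ball x d (x + b *: (s *: v) + c *: (s *: u)).
  by move=> b c hb hc; rewrite addrAC; exact: sd.
have [|b [c [hb hc Ebc]]] := @second_difference _ f x (s *: u) (s *: v).
  move=> b c hb hc; have Uy := dN _ (sd b c hb hc).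
  by split; [exact: df|exact: (scal u u b c hb hc).1].
have [|b' [c' [hb' hc' Ebc']]] := @second_difference _ f x (s *: v) (s *: u).
  move=> b' c' hb' hc'; have Uy := dN _ (sub b' c' hb' hc').
  split; first exact: df.
  by rewrite addrAC; exact: (scal u v c' b' hc' hb').1.
rewrite (addrAC x (b' *: _)) (scal u v c' b' hc' hb').2 in Ebc'.
rewrite (scal v u b c hb hc).2 in Ebc.
have E : 'D_v ('D_u f) (x + b *: (s *: u) + c *: (s *: v)) =
         'D_u ('D_v f) (x + c' *: (s *: u) + b' *: (s *: v)).
  apply: (mulfI (x := s ^+ 2)); first by rewrite expf_neq0 // gt_eqF.
  rewrite (addrAC x (s *: v)) in Ebc'.
  rewrite subrACA in Ebc.
  exact: (etrans (esym Ebc) Ebc').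
exists (x + c' *: (s *: u) + b' *: (s *: v)), (x + b *: (s *: u) + c *: (s *: v)).
split; [exact: (sd _ _ hc' hb')|exact: (sd _ _ hb hc)|exact: (esym E)].
Qed.
End Schwarz.

(** * Calculus of multilinear expressions *)

Section MultilinearCalculus.
Context {R : realType}.

Lemma linear_row_expand d (f : 'rV[R]_d -> R) (r : 'rV[R]_d) :
  linear (f : _ -> R^o) -> f r = \sum_(j < d) r 0 j * f (delta_mx 0 j).
Proof.
move=> lf; pose Lm := GRing.isLinear.Build _ _ _ _ _ lf.
pose L : {linear 'rV[R]_d -> R^o} := HB.pack (f : _ -> R^o) Lm.
rewrite {1}(row_sum_delta r) -[LHS]/(L _) linear_sum; apply: eq_bigr => j _.
by rewrite linearZ.
Qed.

(** Serves as induction step on the number of rows: a multilinear expression becomes a sum of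
    products of a scalar with an expression in one row less. *)
Lemma multilinear_row_expand q d (f : 'M[R]_(q.+1, d) -> R) (A : 'M[R]_(q.+1, d)) :
  multilinear_rows f ->
  f A = \sum_(j < d) A 0 j * f (col_mx (delta_mx 0 j) (row' 0 A) : 'M[R]_(1 + q, d)).
Proof.
move=> mf; have EA r : setrow 0 r A = col_mx r (row' 0 A) :> 'M[R]_(1 + q, d).
  apply/matrixP => k j; rewrite mxE; case: (split_ordP k) => l ->.
    have l0 : lshift q l = ord0 :> 'I_(1 + q) by apply/val_inj; rewrite ord1.
    by rewrite !col_mxEu l0 eqxx ord1.
  have rl : rshift 1 l = lift ord0 l by exact: val_inj.
  by rewrite col_mxEd rl mxE eq_sym (negPf (neq_lift _ _)).
rewrite -{1}(setrow_id 0 A) EA (linear_row_expand (row 0 A) (multilinear_col_mx _ mf)).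
by apply: eq_bigr => j _; rewrite mxE.
Qed.

Lemma Ck_mul k a (U : set 'rV[R]_a) (f g : 'rV[R]_a -> R) : open U ->
  Ck k U f -> Ck k U g -> Ck k U (fun x => f x * g x).
Proof. exact: (@Ck_scale _ _ k R^o). Qed.

Lemma Ck_multi k a b q c (U : set 'rV[R]_a) (V : set 'rV[R]_b)
    (w : 'rV[R]_b -> 'M[R]_(q, c) -> R) (F : 'rV[R]_a -> 'rV[R]_b)
    (B : 'rV[R]_a -> 'M[R]_(q, c)) :
  open U -> (forall u, U u -> V (F u)) ->
  (forall u, multilinear_rows (w u)) -> (forall A, Ck k V (fun u => w u A)) ->
  Ck k U F -> (forall i j, Ck k U (fun u => B u i j)) ->
  Ck k U (fun u => w (F u) (B u)).
Proof.
move=> oU UV; elim: q w B => [|q IH] w B mw sw sF sB.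
  apply: (@Ck_eq _ _ _ _ _ _ ((fun u => w u 0) \o F)) => //; last exact: Ck_comp (sw 0).
  by move=> u _; rewrite /= flatmx0.
apply: (@Ck_eq _ _ _ _ _ _ (fun u => \sum_(j < c) B u 0 j *
    w (F u) (col_mx (delta_mx 0 j) (row' 0 (B u)) : 'M[R]_(1 + q, c)))) => //.
  by move=> u _; exact: multilinear_row_expand.
apply: Ck_sum => // j; apply: Ck_mul => //.
apply: (IH (fun u A => w u (col_mx (delta_mx 0 j) A : 'M[R]_(1 + q, c)))) => //.
- by move=> u; exact: multilinear_dsub.
- move=> i l; rewrite (_ : (fun u => _) = fun u => B u (lift 0 i) l) //.
  by apply/funext => u; rewrite mxE.
Qed.

Lemma derive_mul (V : normedModType R) (f g : V -> R) x v :
  differentiable f x -> differentiable g x ->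
  'D_v (fun y => f y * g y) x = f x * 'D_v g x + 'D_v f x * g x.
Proof. by move=> df dg; exact: (@diff_scale _ _ R^o _ _ _ df dg).2. Qed.

Lemma differentiable_mul (V : normedModType R) (f g : V -> R) x :
  differentiable f x -> differentiable g x -> differentiable (fun y => f y * g y) x.
Proof. by move=> df dg; exact: (@diff_scale _ _ R^o _ _ _ df dg).1. Qed.

Lemma derive_sumfun (V : normedModType R) n (f : 'I_n -> V -> R) x v :
  (forall i, differentiable (f i) x) ->
  differentiable (fun y => \sum_i f i y) x /\
  'D_v (fun y => \sum_i f i y) x = \sum_i 'D_v (f i) x.
Proof.
move=> df; have -> : (fun y => \sum_i f i y) = \sum_i f i.
  by apply/funext => y; rewrite fct_sumE.
split; first exact: differentiable_sum.
by rewrite derive_sum // => i; exact: diff_derivable.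
Qed.

(** Product rule when the base point and all q vectors move: one term for the point, one for each
    row. The expansion along row 0 reduces it to the product rule for scalar functions. *)
Lemma derive_multi (V : normedModType R) b q c (w : 'rV[R]_b -> 'M[R]_(q, c) -> R)
  (F : V -> 'rV[R]_b)
    (B : V -> 'M[R]_(q, c)) x v :
  (forall u, multilinear_rows (w u)) -> (forall A, differentiable (fun u => w u A) (F x)) ->
  differentiable F x -> (forall i j, differentiable (fun u => B u i j) x) ->
  differentiable (fun u => w (F u) (B u)) x /\
  'D_v (fun u => w (F u) (B u)) x = 'D_('D_v F x) (fun u => w u (B x)) (F x)
    + \sum_(i < q) w (F x) (setrow i (\row_j 'D_v (fun u => B u i j) x) (B x)).
Proof.
elim: q w B => [|q IH] w B mw dw dF dB.
  have E : (fun u => w (F u) (B u)) = (fun u => w u (B x)) \o F.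
    by apply/funext => u; rewrite /= (flatmx0 (B u)) (flatmx0 (B x)).
  have dc : differentiable ((fun u => w u (B x)) \o F) x by exact: differentiable_comp.
  rewrite E big_ord0 addr0; split=> //.
  by rewrite deriveE // diff_comp // deriveE //= deriveE.
pose W j u A := w u (col_mx (delta_mx 0 j) A : 'M[R]_(1 + q, c)).
have mW j u : multilinear_rows (W j u) by exact: multilinear_dsub.
have dB' i j : differentiable (fun u => (row' 0 (B u)) i j) x.
  rewrite (_ : (fun u => _) = fun u => B u (lift 0 i) j) //.
  by apply/funext => u; rewrite mxE.
have IHj j := IH (W j) (fun u => row' 0 (B u)) (mW j) (fun A => dw _) dF dB'.
have E : (fun u => w (F u) (B u)) = fun u => \sum_(j < c) B u 0 j * W j (F u) (row' 0 (B u)).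
  by apply/funext => u; exact: multilinear_row_expand.
have dt j : differentiable (fun u => B u 0 j * W j (F u) (row' 0 (B u))) x.
  by apply: differentiable_mul => //; have [] := IHj j.
have [dS DS] := derive_sumfun v dt.
rewrite E; split => //; rewrite DS.
rewrite big_ord_recl /= addrCA.
have Dj j : 'D_v (fun u => B u 0 j * W j (F u) (row' 0 (B u))) x = _ :=
  derive_mul v (dB 0 j) (IHj j).1.
rewrite (eq_bigr _ (fun j _ => Dj j)) big_split /= addrC; congr (_ + _).
  rewrite (multilinear_row_expand _ (mw _)) row'_setrow; apply: eq_bigr => j _.
  by rewrite !mxE eqxx.
under eq_bigr => j _ do rewrite (IHj j).2 mulrDr.
rewrite big_split /=; congr (_ + _).
  have -> : (fun u => w u (B x)) = fun u => \sum_(j < c) B x 0 j * W j u (row' 0 (B x)).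
    by apply/funext => u; exact: multilinear_row_expand.
  rewrite (derive_sumfun _ _).2; last by move=> j; apply: differentiableZ; exact: dw.
  by apply: eq_bigr => j _; rewrite (derive_mul _ (differentiable_cst _ _) (dw _))
    [X in _ + X * _]derive_cst mul0r addr0.
under eq_bigr => j _ do rewrite mulr_sumr.
rewrite exchange_big /=; apply: eq_bigr => i _.
rewrite [RHS](multilinear_row_expand _ (mw _)); apply: eq_bigr => j _.
set r1 := \row_j0 _; set r2 := \row_j0 _.
have -> : row' 0 (setrow (lift ord0 i) r2 (B x)) = setrow i r1 (row' 0 (B x)).
  apply/matrixP => k l; rewrite !mxE (inj_eq lift_inj); case: eqP => // _.
  by congr ('D_v _ x); apply/funext => u; rewrite mxE.
by congr (_ * _); rewrite mxE.
Qed.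

Lemma derive_multi_eq (V : normedModType R) b q c (w : 'rV[R]_b -> 'M[R]_(q, c) -> R)
  (F : V -> 'rV[R]_b)
    (B : V -> 'M[R]_(q, c)) x v (Fv : 'rV[R]_b) (Bx : 'M[R]_(q, c))
    (Bv : 'I_q -> 'rV[R]_c) (mw : forall u, multilinear_rows (w u))
    (dw : forall A, differentiable (fun u => w u A) (F x))
    (dF : differentiable F x) (dB : forall i j, differentiable (fun u => B u i j) x) :
  'D_v F x = Fv -> B x = Bx -> (forall i, \row_j 'D_v (fun u => B u i j) x = Bv i) ->
  'D_v (fun u => w (F u) (B u)) x = 'D_Fv (fun u => w u Bx) (F x)
    + \sum_(i < q) w (F x) (setrow i (Bv i) Bx).
Proof.
move=> <- <- HB; rewrite (derive_multi v mw dw dF dB).2; congr (_ + _).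
by apply: eq_bigr => i _; rewrite HB.
Qed.

End MultilinearCalculus.

Lemma mulrz_sign (S : pzRingType) (x : S) n : x *~ (-1) ^+ n = (-1) ^+ n * x.
Proof. by rewrite -mulrzl rmorphXn rmorphN1. Qed.

Lemma row'_mul (S : pzSemiRingType) q d e (i : 'I_q.+1) (A : 'M[S]_(q.+1, d)) (J : 'M[S]_(d, e)) :
  row' i A *m J = row' i (A *m J).
Proof. by apply/matrixP => k l; rewrite !mxE; apply: eq_bigr => m _; rewrite mxE. Qed.

(** * The exterior derivative in coordinates and its naturality *)

Section LocalExteriorDerivative.
Context {R : realType}.

Definition local_extd {a q} (w : 'rV[R]_a -> 'M[R]_(q, a) -> R) (u : 'rV[R]_a)
    (A : 'M[R]_(q.+1, a)) : R :=
  \sum_(i < q.+1) (-1) ^+ i * 'D_(row i A) (fun u => w u (row' i A)) u.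

Lemma near_local_extd {a q} (w w' : 'rV[R]_a -> 'M[R]_(q, a) -> R) u A :
  (forall B, \forall v \near u, w v B = w' v B) -> local_extd w u A = local_extd w' u A.
Proof.
move=> ww'; apply: eq_bigr => i _; congr (_ * _).
exact: near_eq_derive.
Qed.

Lemma realV2 (x : R) : x + x = 0 -> x = 0.
Proof. by move=> h; lra. Qed.

Lemma derive_jacobian {a b} (F : 'rV[R]_a -> 'rV[R]_b) u v :
  differentiable F u -> v *m jacobian F u = 'D_v F u.
Proof. by move=> dF; rewrite mul_rV_lin1 -deriveE. Qed.

Lemma derive_coord {a b} (F : 'rV[R]_a -> 'rV[R]_b) u v l :
  differentiable F u ->
  differentiable (fun y => F y 0 l) u /\ 'D_v (fun y => F y 0 l) u = 'D_v F u 0 l.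
Proof.
move=> dF; have lC : linear (fun M : 'rV[R]_b => M 0 l : R^o) by move=> c p q; rewrite !mxE.
pose Lm := GRing.isLinear.Build _ _ _ _ _ lC.
pose C : {linear 'rV[R]_b -> R^o} := HB.pack (fun M : 'rV[R]_b => M 0 l : R^o) Lm.
have cC : continuous C by move=> M; exact: coord_continuous.
have dc : differentiable (C \o F) u.
  by apply: differentiable_comp => //; exact: linear_differentiable.
split; first exact: dc.
rewrite -[LHS]/('D_v (C \o F) u) deriveE // diff_comp //; last exact: linear_differentiable.
by rewrite -[LHS]/('d C (F u) ('d F u v)) diff_lin // deriveE.
Qed.

Lemma Ck_coord k {a b} (U : set 'rV[R]_a) (F : 'rV[R]_a -> 'rV[R]_b) l :
  open U -> Ck k U F -> Ck k U (fun u => F u 0 l).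
Proof.
move=> oU; elim: k F => [|k IH] F.
  move=> cF x Ux; have -> : (fun u => F u 0 l) = (fun M : 'rV[R]_b => M 0 l) \o F by [].
  by apply: continuous_comp; [exact: cF|exact: coord_continuous].
move=> [dF DF]; split=> [x Ux|v]; first by have [] := derive_coord 0 l (dF x Ux).
apply: (Ck_eq oU _ (IH _ (DF v))) => x Ux.
by have [_ ->] := derive_coord v l (dF x Ux).
Qed.

Lemma Ck_jacobian k {a b} (U : set 'rV[R]_a) (F : 'rV[R]_a -> 'rV[R]_b) i l :
  open U -> Ck k.+1 U F -> Ck k U (fun u => jacobian F u i l).
Proof.
move=> oU [dF DF]; apply: (Ck_eq oU _ (Ck_coord l oU (DF (delta_mx 0 i)))) => x Ux.
by rewrite -(derive_jacobian _ (dF x Ux)) -rowE [RHS]mxE.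
Qed.

Lemma Ck_mulmx k {a q b c} (U : set 'rV[R]_a) (A : 'M[R]_(q, b)) (J : 'rV[R]_a -> 'M[R]_(b, c)) :
  open U -> (forall i j, Ck k U (fun u => J u i j)) ->
  forall i j, Ck k U (fun u => (A *m J u) i j).
Proof.
move=> oU sJ i j; apply: (@Ck_eq _ _ _ _ _ _ (fun u => \sum_l A i l * J u l j)) => //.
  by move=> u _; rewrite mxE.
apply: Ck_sum => // l; apply: Ck_mul => //; exact: Ck_cst.
Qed.

(** Differentiating the pullback produces the pullback of the derivative and terms containing second
    derivatives of F. The latter are symmetric in the two directions involved, while the signs are
    antisymmetric, so [alternating_double_sum] cancels them. *)
Lemma local_extd_pullback {a b q} (U : set 'rV[R]_a) (V : set 'rV[R]_b) (F : 'rV[R]_a -> 'rV[R]_b)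
    (w : 'rV[R]_b -> 'M[R]_(q, b) -> R) x A :
  open U -> U x -> (forall u, U u -> V (F u)) -> Ck 2 U F ->
  (forall u, multilinear_rows (w u)) -> (forall u, alternating_rows (w u)) ->
  (forall B, Ck 1 V (fun u => w u B)) ->
  local_extd (fun u A => w (F u) (A *m jacobian F u)) x A = local_extd w (F x) (A *m jacobian F x).
Proof.
move=> oU Ux UV sF mw aw sw; have dF := sF.1; have dFx := dF x Ux.
have sJ i l := Ck_jacobian i l oU sF.
have sB q' (C : 'M[R]_(q', a)) i l : Ck 1 U (fun u => (C *m jacobian F u) i l).
  exact: Ck_mulmx.
(* The second derivatives of the components of F at x, kept opaque behind the equation [HE]. *)
have [H HE] : exists H : 'rV[R]_a -> 'rV[R]_a -> 'I_b -> R,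
    forall c d l, H c d l = 'D_c ('D_d (fun u => F u 0 l)) x
      by exists (fun c d l => 'D_c ('D_d (fun u => F u 0 l)) x).
have HC c d l : H c d l = H d c l.
  by rewrite !HE; exact: (schwarz _ _ oU Ux (Ck_coord l oU sF)).
pose r c d := \row_l H c d l.
have rC c d : r c d = r d c by apply/rowP => l; rewrite /r !mxE HC.
have dB q' (C : 'M[R]_(q', a)) v i :
    \row_l 'D_v (fun u => (C *m jacobian F u) i l) x = r v (row i C).
  apply/rowP => l; rewrite mxE [RHS]mxE HE; apply: near_eq_derive.
  apply: filterS (open_nbhs_nbhs (conj oU Ux)) => u Uu.
  have dFu := dF u Uu.
  by rewrite (derive_coord _ l dFu).2 -(derive_jacobian _ dFu) -row_mul [RHS]mxE.
have step i : 'D_(row i A) (fun u => w (F u) (row' i A *m jacobian F u)) x =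
    'D_(row i (A *m jacobian F x)) (fun u => w u (row' i (A *m jacobian F x))) (F x) +
    \sum_(j < q) w (F x) (setrow j (r (row i A) (row (lift i j) A)) (row' i (A *m jacobian F x))).
  apply: (@derive_multi_eq R _ _ _ _ w F (fun u => row' i A *m jacobian F u) x (row i A) _ _ _ mw
    _ dFx).
  - by move=> C; have [+ _] := sw C; apply; exact: UV.
  - by move=> k l; have [+ _] := sB _ (row' i A) k l; apply.
  - by rewrite row_mul; exact: esym (derive_jacobian _ dFx).
  - exact: (row'_mul i A (jacobian F x)).
  - by move=> j; rewrite dB; congr r; apply/rowP => l; rewrite !mxE.
rewrite /local_extd; under eq_bigr => i _ do rewrite step mulrDr.
rewrite big_split /= [X in _ + X](_ : _ = 0) ?addr0 //.
case: q w A mw aw sw {step sB dB} => [|q] w A mw aw sw.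
  by rewrite big1 // => i _; rewrite big_ord0 mulr0.
rewrite -[RHS](@alternating_double_sum _ _ (fun i j => w (F x) (col_mx
   (r (row i A) (row (lift i j) A)) (row' j (row' i (A *m jacobian F x))) : 'M[R]_(1 + q, b)))
   realV2).
  apply: eq_bigr => i _; rewrite mulr_sumr; apply: eq_bigr => j _.
  by rewrite alternating_front // mulrz_sign mulrA -exprD.
by move=> i j i' j' li l'; rewrite (row'_row' _ li l') li l' rC.
Qed.

End LocalExteriorDerivative.

(** * Differentiation under the integral sign *)

Section UnitIntegral.
Context {R : realType}.
Implicit Types g h : R -> R.

Definition int01 g : R := \int[@lebesgue_measure R]_(t in `[0, 1]) g t.

Lemma continuous_integrable01 g : continuous g ->
  (@lebesgue_measure R).-integrable `[0, 1] (EFin \o g).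
Proof.
move=> cg; apply: continuous_compact_integrable; first exact: segment_compact.
exact: continuous_subspaceT.
Qed.

Lemma int01_eq g h : (forall t, 0 <= t <= 1 -> g t = h t) -> int01 g = int01 h.
Proof. by move=> gh; apply: eq_Rintegral => t /[!inE] /=; rewrite in_itv; exact: gh. Qed.

Lemma int01D g h : continuous g -> continuous h -> int01 (fun t => g t + h t) = int01 g + int01 h.
Proof. by move=> cg ch; apply: RintegralD => //; exact: continuous_integrable01. Qed.

Lemma int01Z c g : continuous g -> int01 (fun t => c * g t) = c * int01 g.
Proof. by move=> cg; apply: RintegralZl => //; exact: continuous_integrable01. Qed.

Lemma int01B (g h : R -> R) : continuous g -> continuous h ->
  int01 (fun t => g t - h t) = int01 g - int01 h.
Proof.
move=> cg ch; rewrite -mulN1r -int01Z // -int01D //.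
  by apply: int01_eq => t _; rewrite mulN1r.
by move=> t; apply: cvgM; [exact: cvg_cst|exact: ch].
Qed.

Lemma int01_0 : int01 (fun=> 0) = 0.
Proof.
rewrite -[RHS](mul0r (int01 (cst 0))) -int01Z; last by move=> t; exact: cst_continuous.
by apply: int01_eq => t _; rewrite mul0r.
Qed.

Lemma int01_norm_le g e : continuous g -> (forall t, 0 <= t <= 1 -> `|g t| <= e) -> `|int01 g| <= e.
Proof.
move=> cg ge; have cng : continuous (fun t => `|g t|).
  by move=> t; apply: (continuous_comp (cg t)); exact: norm_continuous.
apply: le_trans (le_normr_Rintegral _ (continuous_integrable01 cg)) _ => //.
have -> : e = int01 (cst e).
  have L1 : @lebesgue_measure R `[0, 1] = 1%E.
    by rewrite lebesgue_measure_itv /= lte_fin ltr01 oppr0 adde0.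
  by rewrite /int01 Rintegral_cst // [X in fine X]L1 mulr1.
apply: le_Rintegral => //; first exact: continuous_integrable01.
  by apply: continuous_integrable01 => t; exact: cst_continuous.
Qed.

Lemma continuous_sumfun (T : topologicalType) n (g : 'I_n -> T -> R) :
  (forall i, continuous (g i)) -> continuous (fun t => \sum_i g i t).
Proof.
elim: n g => [|n IH] g cg.
  rewrite (_ : (fun t => _) = cst 0); first by move=> t; exact: cst_continuous.
  by apply/funext => t; rewrite big_ord0.
rewrite (_ : (fun t => _) = fun t => g ord0 t + \sum_(i < n) g (lift ord0 i) t); last first.
  by apply/funext => t; rewrite big_ord_recl.
by move=> t; apply: cvgD; [exact: cg|apply: (IH (fun i => g (lift ord0 i))) => i; exact: cg].
Qed.

Lemma int01_sum n (g : 'I_n -> R -> R) : (forall i, continuous (g i)) ->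
  int01 (fun t => \sum_i g i t) = \sum_i int01 (g i).
Proof.
elim: n g => [|n IH] g cg.
  by rewrite big_ord0 -[RHS]int01_0; apply: int01_eq => t _; rewrite big_ord0.
rewrite big_ord_recl -IH // -int01D //; last first.
  by apply: continuous_sumfun => i; exact: cg.
by apply: int01_eq => t _; rewrite big_ord_recl.
Qed.

Lemma int01_derive (g dg : R -> R) : (forall t : R, is_derive t 1 g (dg t)) -> continuous dg ->
  int01 dg = g 1 - g 0.
Proof.
move=> Dg cdg; have cg : continuous g.
  by move=> t; apply: differentiable_continuous; apply/derivable1_diffP; have [] := Dg t.
have := @continuous_FTC2 R dg g 0 1 ltr01.
rewrite /int01 /Rintegral => -> //.
- exact: continuous_subspaceT.
- split; first by move=> t _; have [] := Dg t.
    by apply: cvg_at_right_filter; exact: cg.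
  by apply: cvg_at_left_filter; exact: cg.
- by move=> t _; rewrite derive1E; have [] := Dg t.
Qed.

End UnitIntegral.

Lemma continuous_dist (R : realType) (V : normedModType R) (F : V -> R) (x : V) :
  (forall e, 0 < e -> \forall u \near x, `|F u - F x| <= e) -> {for x, continuous F}.
Proof.
move=> H; apply/cvgrPdist_le => e e0.
by apply: filterS (H e e0) => u; rewrite distrC.
Qed.

Lemma near_forall_ord (T : topologicalType) n (P : 'I_n -> T -> Prop) (x : T) :
  (forall i, \forall u \near x, P i u) -> \forall u \near x, forall i, P i u.
Proof. by move=> H; apply: filter_forall. Qed.

Lemma mx_coord_le (R : realType) n (y : 'rV[R]_n) i : `|y 0 i| <= `|y|.
Proof.
rewrite [leRHS]mx_normrE; exact: (le_bigmax _ (fun ij => `|y ij.1 ij.2|) (0, i)).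
Qed.

Lemma differentiable_approx (R : realType) (V W : normedModType R) (F : V -> W)
    (L : {linear V -> W}) (x : V) :
  continuous L ->
  (forall e, 0 < e -> \forall y \near 0, `|F (y + x) - F x - L y| <= e * `|y|) ->
  differentiable F x /\ forall v, 'D_v F x = L v.
Proof.
move=> cL H.
have E : F \o shift x = cst (F x) + L +o_ 0 id.
  apply/eqaddoP => e e0; apply: filterS (H e e0) => y.
  by rewrite !fctE /= opprD addrA.
have DF : 'd F x = L :> (V -> W) by exact: diff_unique.
have dF : differentiable F x by apply/diff_locallyP; rewrite DF.
by split=> // v; rewrite deriveE // DF.
Qed.

Section ParametricIntegral.
Context {R : realType} {a : nat}.

(** The parameter t becomes coordinate 0 of a longer row vector, so that joint smoothness in (t, u)
    is [Ck] of a single function. *)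
Definition cons_rV (t : R) (u : 'rV[R]_a) : 'rV[R]_(1 + a) := row_mx t%:M u.

Lemma cons_rVD t u v : cons_rV t (u + v) = cons_rV t u + inr_rV v.
Proof. by rewrite /cons_rV /inr_rV add_row_mx addr0. Qed.

Lemma cons_rVZ t u s v : cons_rV t (u + s *: v) = cons_rV t u + s *: inr_rV v.
Proof. by rewrite cons_rVD linearZ. Qed.

Lemma continuous_cons_rV : continuous (fun p : R * 'rV[R]_a => cons_rV p.1 p.2).
Proof.
have -> : (fun p : R * 'rV[R]_a => cons_rV p.1 p.2) =
    (fun p => p.1 *: inl_rV (1%:M : 'rV[R]_1)) \+ (inr_rV \o snd) :> (_ -> 'rV[R]_(1 + a)).
  apply/funext => p /=; rewrite /cons_rV row_mxE_inlr -linearZ; congr (inl_rV _ + _).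
  by rewrite scale_scalar_mx mulr1.
move=> p; apply: cvgD.
  by apply: cvgZr_tmp; exact: cvg_fst.
apply: continuous_comp; [exact: cvg_snd|exact: rV_linear_continuous].
Qed.

Variables (U : set 'rV[R]_a) (f : 'rV[R]_(1 + a) -> R).
Hypothesis oU : open U.
(** The cylinder over U with t on the whole line: being open, it avoids one-sided derivatives at the
    ends of [0, 1]. *)
Let W : set 'rV[R]_(1 + a) := [set w | U (rsubmx w)].

(** Compactness of [0, 1] makes the neighbourhood of x independent of t. *)
Lemma near_uniform (g : 'rV[R]_(1 + a) -> R) x e : 0 < e -> U x ->
  (forall w, W w -> {for w, continuous g}) ->
  \forall u \near x, forall t, 0 <= t <= 1 -> `|g (cons_rV t u) - g (cons_rV t x)| <= e.
Proof.
move=> e0 Ux cg.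
have K := (compact_near_coveringP _).1 (@segment_compact R 0 1).
have {}K := K _ (nbhs x) (fun u t => `|g (cons_rV t u) - g (cons_rV t x)| <= e) _.
have e20 : 0 < e / 2 by rewrite divr_gt0.
have : \forall u \near x, `[0, 1] `<=` (fun t : R => `|g (cons_rV t u) - g (cons_rV t x)| <= e).
  apply: K => t _.
  have ct : {for (t, x), continuous (g \o (fun p : R * 'rV[R]_a => cons_rV p.1 p.2))}.
    apply: continuous_comp; first exact: continuous_cons_rV.
    by apply: cg; rewrite /W /= /cons_rV row_mxKr.
  have /cvgrPdist_lt/(_ _ e20) := ct.
  case=> -[A B] /= [tA xB] AB.
  exists (A, B) => //= -[t' u] [/= At' Bu].
  have Bx : B x by exact: nbhs_singleton.
  have /= h1 := AB (t', u) (conj At' Bu); have /= h2 := AB (t', x) (conj At' Bx).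
  have := ler_distD (g (cons_rV t x)) (g (cons_rV t' u)) (g (cons_rV t' x)).
  rewrite distrC in h1; lra.
by apply: filterS => u Hu t t01; apply: Hu; rewrite /= in_itv.
Qed.

Lemma continuous_slice (g : 'rV[R]_(1 + a) -> R) x : U x ->
  (forall w, W w -> {for w, continuous g}) -> continuous (fun t => g (cons_rV t x)).
Proof.
move=> Ux cg t; have Wx : W (cons_rV t x) by rewrite /W /= /cons_rV row_mxKr.
rewrite -[X in continuous_at t X]/(g \o (fun t => cons_rV t x)).
apply: continuous_comp.
  have -> : (fun t => cons_rV t x) = (fun p : R * 'rV[R]_a => cons_rV p.1 p.2) \o
    (fun t => (t, x)) by [].
  apply: continuous_comp; last exact: continuous_cons_rV.
  have c1 : {for t, continuous (@id R)} by exact: cvg_id.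
  have c2 : {for t, continuous (cst x : R -> 'rV[R]_a)} by exact: cst_continuous.
  exact: cvg_pair c1 c2.
exact: (cg (cons_rV t x) Wx).
Qed.

Lemma continuous_int01 (g : 'rV[R]_(1 + a) -> R) x : U x ->
  (forall w, W w -> {for w, continuous g}) ->
  {for x, continuous (fun u => int01 (fun t => g (cons_rV t u)))}.
Proof.
move=> Ux cg; apply: continuous_dist => e e0.
have nU : nbhs x U by exact: open_nbhs_nbhs.
have N := near_uniform e0 Ux cg.
apply: filterS2 nU N => u Uu Hu.
have cx := continuous_slice Ux cg; have cu := continuous_slice Uu cg.
rewrite -int01B //; apply: int01_norm_le => // t.
by apply: cvgB; [exact: cu|exact: cx].
Qed.

(** For each t the mean value theorem writes the increment as a derivative at a nearby point; the
    partial derivatives are close to those at x uniformly in t, so the integrated error is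
    o(|y|). *)
Lemma derive_int01 x : U x -> Ck 1 W f ->
  differentiable (fun u => int01 (fun t => f (cons_rV t u))) x /\
  forall v, 'D_v (fun u => int01 (fun t => f (cons_rV t u))) x
            = int01 (fun t => 'D_(inr_rV v) f (cons_rV t x)).
Proof.
move=> Ux [df Df]; set F := fun u => _.
have WE t u : U u -> W (cons_rV t u) by rewrite /W /= /cons_rV row_mxKr.
have cD v : continuous (fun t => 'D_(inr_rV v) f (cons_rV t x)).
  exact: (continuous_slice Ux (Df (inr_rV v))).
have cf w : W w -> {for w, continuous f}.
  by move=> /df; exact: differentiable_continuous.
have lin : linear (fun v : 'rV[R]_a => int01 (fun t => 'D_(inr_rV v) f (cons_rV t x)) : R^o).
  move=> c u v; rewrite (_ : (fun t => _) =
    fun t => c * 'D_(inr_rV u) f (cons_rV t x) + 'D_(inr_rV v) f (cons_rV t x)).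
    by rewrite int01D ?int01Z // => t; apply: cvgM; [exact: cvg_cst|exact: cD].
  apply/funext => t; rewrite linearP; exact: (derive_linear (df _ (WE t x Ux))).
pose Lm := GRing.isLinear.Build _ _ _ _ _ lin.
pose L : {linear 'rV[R]_a -> R^o} :=
  HB.pack (fun v : 'rV[R]_a => int01 (fun t => 'D_(inr_rV v) f (cons_rV t x)) : R^o) Lm.
have cL : continuous L by exact: rV_linear_continuous.
apply: (differentiable_approx cL) => e e0.
(* The a partial derivatives may each err by e / (a + 1), for a total of at most e; the successor
   also covers a = 0. *)
have a0 : 0 < e / a.+1%:R by rewrite divr_gt0.
pose g (i : 'I_a) := 'D_(inr_rV (delta_mx 0 i)) f.
have [d d0 dN] : exists2 d : R, 0 < d & forall u, ball x d u -> U u /\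
    forall i t, 0 <= t <= 1 -> `|g i (cons_rV t u) - g i (cons_rV t x)| <= e / a.+1%:R.
  have nU : nbhs x U by exact: open_nbhs_nbhs.
  have ng : \forall u \near x, forall i t, 0 <= t <= 1 ->
      `|g i (cons_rV t u) - g i (cons_rV t x)| <= e / a.+1%:R.
    have ngi i := near_uniform a0 Ux (Df (inr_rV (delta_mx 0 i))).
    exact: (near_forall_ord ngi).
  have : \forall u \near x, U u /\ forall i t, 0 <= t <= 1 ->
      `|g i (cons_rV t u) - g i (cons_rV t x)| <= e / a.+1%:R by apply: filterS2 nU ng.
  by move=> /nbhs_ballP[d d0 dN]; exists d.
have : \forall y \near (0 : 'rV[R]_a), ball 0 d y by exact: nbhsx_ballx.
apply: filterS => y By.
have Bxy s : 0 <= s <= 1 -> ball x d (x + s *: y).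
  move=> /andP[s0 s1]; move: By; rewrite -!ball_normE /= sub0r normrN opprD addNKr normrN.
  by rewrite normrZ ger0_norm //; apply: le_lt_trans; rewrite ler_piMl.
have Uxy : U (y + x) by have := Bxy 1; rewrite ler01 lexx scale1r addrC => /(_ isT)/dN[].
have c1 : continuous (fun t => f (cons_rV t (y + x)) - f (cons_rV t x)).
  by move=> t; apply: cvgB; [exact: (continuous_slice Uxy cf)|exact: (continuous_slice Ux cf)].
have -> : F (y + x) - F x - L y =
    int01 (fun t => f (cons_rV t (y + x)) - f (cons_rV t x) - 'D_(inr_rV y) f (cons_rV t x)).
  rewrite int01B //; congr (_ - _).
  by rewrite int01B //; [exact: (continuous_slice Uxy cf)|exact: (continuous_slice Ux cf)].
apply: int01_norm_le => [t|t t01]; first by apply: cvgB; [exact: c1|exact: cD].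
have [|s s01 Es] := @MVT_line R _ f (cons_rV t x) (inr_rV y).
  by move=> s s01; rewrite -cons_rVZ; apply/df/WE; have [] := dN _ (Bxy s s01).
rewrite (addrC y x) cons_rVD Es -cons_rVZ.
have {}s01 : 0 <= s <= 1 by case/andP: s01 => /ltW-> /ltW->.
have [Us gs] := dN _ (Bxy s s01).
have ex w : W w -> 'D_(inr_rV y) f w = \sum_(i < a) y 0 i * g i w.
  move=> Ww; have lD := derive_linear (df _ Ww).
  have lf : linear (fun v : 'rV[R]_a => 'D_(inr_rV v) f w : R^o).
    by move=> c u v; rewrite linearP lD.
  exact: (linear_row_expand y lf).
rewrite !ex; try exact: WE.
rewrite -sumrB; apply: le_trans (ler_norm_sum _ _ _) _.
apply: (@le_trans _ _ (\sum_(i < a) e / a.+1%:R * `|y|)).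
  apply: ler_sum => i _; rewrite -mulrBr normrM mulrC ler_pM //.
    exact: gs.
  exact: mx_coord_le.
rewrite -mulr_suml sumr_const card_ord; apply: ler_wpM2r => //.
rewrite -[leLHS]mulr_natr -mulrA ler_piMr ?(ltW e0) // mulrC ler_pdivrMr // mul1r ler_nat.
exact: leqnSn.
Qed.

End ParametricIntegral.

Lemma Ck_le (R : realType) a (F : normedModType R) (U : set 'rV[R]_a) (f : 'rV[R]_a -> F) j k :
  (j <= k)%N -> Ck k U f -> Ck j U f.
Proof.
elim: k => [|k IH]; first by rewrite leqn0 => /eqP ->.
by rewrite leq_eqVlt => /predU1P[->//|]; rewrite ltnS => /IH{}IH /CkW/IH.
Qed.

Lemma Ck_int01 (R : realType) a (U : set 'rV[R]_a) (f : 'rV[R]_(1 + a) -> R) k :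
  open U -> Ck k [set w | U (rsubmx w)] f -> Ck k U (fun u => int01 (fun t => f (cons_rV t u))).
Proof.
move=> oU; elim: k f => [|k IH] f.
  by move=> cf x Ux; exact: (continuous_int01 oU Ux cf).
move=> Cf; have C1 : Ck 1 [set w | U (rsubmx w)] f by exact: (Ck_le (ltn0Sn k) Cf).
split=> [x Ux|v]; first by have [] := derive_int01 oU Ux C1.
apply: (Ck_eq oU _ (IH _ (Cf.2 (inr_rV v)))) => x Ux.
by have [_ ->] := derive_int01 oU Ux C1.
Qed.

(** * Homotopy formula in a chart *)

Section ColMxRows.
Context {S : Type} {q a : nat}.

Lemma row0_col_mx (r : 'rV[S]_a) (X : 'M[S]_(q, a)) :
  row (ord0 : 'I_(1 + q)) (col_mx r X) = r.
Proof.
have -> : ord0 = lshift q (0 : 'I_1) :> 'I_(1 + q) by exact: val_inj.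
by rewrite rowKu row_id.
Qed.

Lemma row'0_col_mx (r : 'rV[S]_a) (X : 'M[S]_(q, a)) :
  row' (ord0 : 'I_(1 + q)) (col_mx r X) = X.
Proof.
apply/matrixP => k l; rewrite mxE.
have -> : lift ord0 k = rshift 1 k :> 'I_(1 + q) by exact: val_inj.
by rewrite col_mxEd.
Qed.

Lemma rowS_col_mx (r : 'rV[S]_a) (X : 'M[S]_(q, a)) i :
  row (lift ord0 i : 'I_(1 + q)) (col_mx r X) = row i X.
Proof.
have -> : lift ord0 i = rshift 1 i :> 'I_(1 + q) by exact: val_inj.
by rewrite rowKd.
Qed.

End ColMxRows.

Lemma row'S_col_mx (S : Type) q a (r : 'rV[S]_a) (X : 'M[S]_(q.+1, a)) i :
  row' (lift ord0 i : 'I_(1 + q.+1)) (col_mx r X) = col_mx r (row' i X) :> 'M[S]_(1 + q, a).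
Proof.
apply/matrixP => k l; rewrite mxE; case: (split_ordP k) => k' ->.
  have -> : lift (lift ord0 i) (lshift q k') = lshift q.+1 k' :> 'I_(1 + q.+1).
    by apply/val_inj; rewrite /= ord1.
  by rewrite !col_mxEu.
have -> : lift (lift ord0 i) (rshift 1 k') = rshift 1 (lift i k') :> 'I_(1 + q.+1).
  by apply/val_inj => /=; rewrite /bump !add1n; case: ltnP; case: ltnP; lia.
by rewrite !col_mxEd mxE.
Qed.

(** For closed w this expresses the derivative along r through derivatives along the rows of X,
    which is how closedness enters the homotopy formula. *)
Lemma local_extd_col_mx (R : realType) a q (w : 'rV[R]_a -> 'M[R]_(q.+1, a) -> R) u
    (r : 'rV[R]_a) (X : 'M[R]_(q.+1, a)) :
  local_extd w u (col_mx r X : 'M[R]_(1 + q.+1, a)) = 'D_r (fun v => w v X) u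
    - \sum_(i < q.+1) (-1) ^+ i *
      'D_(row i X) (fun v => w v (col_mx r (row' i X) : 'M[R]_(1 + q, a))) u.
Proof.
rewrite /local_extd big_ord_recl expr0 mul1r; congr (_ + _).
  by rewrite row0_col_mx; congr (derive _ _ _); apply/funext => v; rewrite row'0_col_mx.
rewrite -sumrN; apply: eq_bigr => i _; rewrite /= /bump leq0n add1n exprS mulN1r mulNr.
rewrite rowS_col_mx; congr (- (_ * _)); congr (derive _ _ _).
by apply/funext => v; rewrite row'S_col_mx.
Qed.

Section HomotopyFormula.
Context {R : realType} {a : nat}.
Variables (S0 P : 'M[R]_a).

(** A linear deformation with constant velocity [P]. In the application [S0] and [P] are
    complementary projections: t = 1 is the identity and t = 0 the retraction. *)
Definition segment_mx (t : R) : 'M[R]_a := S0 + t *: P.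

(** The classical cochain homotopy: contract with the velocity u P of the deformation, pull back and
    integrate over t. *)
Definition local_homotopy {q} (w : 'rV[R]_a -> 'M[R]_(q.+1, a) -> R) (u : 'rV[R]_a)
    (A : 'M[R]_(q, a)) : R :=
  int01 (fun t => w (u *m segment_mx t) (col_mx (u *m P) (A *m segment_mx t) : 'M[R]_(1 + q, a))).

Lemma differentiable_mulmx b (M : 'M[R]_(a, b)) (u v : 'rV[R]_a) :
  differentiable (fun u => u *m M) u /\ 'D_v (fun u => u *m M) u = v *m M.
Proof.
have cM : continuous (mulmxr M : 'rV[R]_a -> 'rV[R]_b) by exact: rV_linear_continuous.
have dM := linear_differentiable u cM.
split; first exact: dM.
by rewrite -[LHS]/('D_v (mulmxr M : 'rV[R]_a -> 'rV[R]_b) u) deriveE // diff_lin.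
Qed.

Lemma derive_cons_rV (f : 'rV[R]_(1 + a) -> R) t u v :
  'D_v (fun u => f (cons_rV t u)) u = 'D_(inr_rV v) f (cons_rV t u).
Proof.
rewrite /derive; set F := fun h : R => _; set G := fun h : R => _.
suff -> : F = G by [].
apply/funext => h; have E : cons_rV t (h *: v + u) = h *: inr_rV v + cons_rV t u.
  by rewrite addrC cons_rVZ addrC.
by rewrite /F /G /= E.
Qed.

Lemma derive_affine (V : normedModType R) (x v : V) (t : R) :
  differentiable (fun s : R => x + s *: v) t /\ 'D_1 (fun s : R => x + s *: v) t = v.
Proof.
have dl : is_diff t (fun s : R => x + s *: v) (fun s => s *: v).
  by apply: is_diff_eq; rewrite add0r.
by split=> //; rewrite deriveE // diff_val scale1r.
Qed.

Lemma derive_front q (C : 'M[R]_(q, a)) (u v : 'rV[R]_a) (k : 'I_(1 + q)) j :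
  differentiable (fun y => col_mx (y *m P) C k j) u /\
  'D_v (fun y => col_mx (y *m P) C k j) u = col_mx (v *m P) 0 k j.
Proof.
case: (split_ordP k) => l ->.
  rewrite (_ : (fun y => _) = fun y => (y *m P) 0 j); last first.
    by apply/funext => y; rewrite col_mxEu ord1.
  have [d D] := differentiable_mulmx P u v.
  by have [? ->] := derive_coord v j d; rewrite D col_mxEu ord1.
rewrite (_ : (fun y => _) = cst (C l j)); last by apply/funext => y; rewrite col_mxEd.
by split; [exact: differentiable_cst|rewrite derive_cst col_mxEd mxE].
Qed.

Lemma multilinear_setrow0 q d (f : 'M[R]_(q, d) -> R) i A : multilinear_rows f ->
  f (setrow i 0 A) = 0.
Proof.
by move=> /multilinearP mf; have := mf i A (-1) 0 0; rewrite scaler0 addr0 scaleN1r addNr.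
Qed.

Variable U : set 'rV[R]_a.
Hypotheses (oU : open U) (SU : forall t u, U u -> U (u *m segment_mx t)).

Section Fixed.
Context {q : nat} (w : 'rV[R]_a -> 'M[R]_(q.+1, a) -> R).
Hypotheses (mw : forall u, multilinear_rows (w u)) (aw : forall u, alternating_rows (w u)).

(** The integrand as a function of the single vector (t, u), the form required for differentiating
    under the integral. *)
Let f (A : 'M[R]_(q, a)) (z : 'rV[R]_(1 + a)) :=
  w (rsubmx z *m S0 + z 0 0 *: (rsubmx z *m P))
    (col_mx (rsubmx z *m P) (A *m S0 + z 0 0 *: (A *m P)) : 'M[R]_(1 + q, a)).

Let f_cons_rV A t u : f A (cons_rV t u) = w (u *m segment_mx t)
  (col_mx (u *m P) (A *m segment_mx t) : 'M[R]_(1 + q, a)).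
Proof.
have z0 : cons_rV t u 0 0 = t.
  have -> : 0 = lshift a (0 : 'I_1) :> 'I_(1 + a) by exact: val_inj.
  by rewrite row_mxEl mxE eqxx mulr1n.
by rewrite /f z0 /cons_rV row_mxKr /segment_mx !mulmxDr -!scalemxAr.
Qed.

Let Ck_f k A : (forall B, Ck k U (fun u => w u B)) -> Ck k [set z | U (rsubmx z)] (f A).
Proof.
move=> sw; set W := [set z | _].
have oW : open W by apply: (open_comp _ oU) => z _; exact: continuous_rsubmx.
have sr : Ck k W (fun z : 'rV[R]_(1 + a) => rsubmx z) by exact: Ck_linear.
have s0 : Ck k W (fun z : 'rV[R]_(1 + a) => z 0 0) by apply: Ck_coord => //; exact: Ck_id.
have sm b (M : 'M[R]_(a, b)) : Ck k W (fun z : 'rV[R]_(1 + a) => rsubmx z *m M).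
  exact: (@Ck_lin _ _ k _ _ _ _ (mulmxr M : {linear _ -> _}) oW (@rV_linear_continuous _ _ _ _) sr).
apply: (Ck_multi oW (V := U)) => //.
- move=> z Wz; have := SU (z 0 0) Wz.
  by rewrite /segment_mx mulmxDr -scalemxAr.
- by apply: Ck_add => //; exact: Ck_scale.
- move=> i j; case: (split_ordP (i : 'I_(1 + q))) => l ->.
    apply: (@Ck_eq _ _ _ _ _ _ (fun z : 'rV[R]_(1 + a) => (rsubmx z *m P) 0 j)) => //.
      by move=> z _; rewrite col_mxEu ord1.
    exact: Ck_coord.
  apply: (@Ck_eq _ _ _ _ _ _ ((fun=> (A *m S0) l j) \+ fun z => z 0 0 * (A *m P) l j)) => //.
    by move=> z _; rewrite col_mxEd !mxE.
  apply: Ck_add => //; first exact: Ck_cst.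
  by apply: Ck_mul => //; exact: Ck_cst.
Qed.

Lemma Ck_local_homotopy k A : (forall B, Ck k U (fun u => w u B)) ->
  Ck k U (fun u => local_homotopy w u A).
Proof.
move=> sw; have := Ck_int01 oU (Ck_f A sw).
by under eq_fun => u do under eq_fun => t do rewrite f_cons_rV.
Qed.

Lemma local_homotopy_multilinear u : U u -> (forall B, Ck 0 U (fun u => w u B)) ->
  multilinear_rows (local_homotopy w u).
Proof.
move=> Uu sw; apply/multilinearP => i A c x y.
have cK A' : continuous (fun t => w (u *m segment_mx t)
  (col_mx (u *m P) (A' *m segment_mx t) : 'M[R]_(1 + q, a))).
  have := continuous_slice Uu (Ck_f A' sw).
  by under eq_fun => t do rewrite f_cons_rV.
pose K r t := w (u *m segment_mx t) (col_mx (u *m P) (setrow i r A *m segment_mx t)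
  : 'M[R]_(1 + q, a)).
transitivity (int01 (fun t => c * K x t + K y t)).
  apply: int01_eq => t _; rewrite /K !setrow_mul mulmxDl -scalemxAl.
  have /multilinearP := multilinear_dsub (u *m P) (mw (u *m segment_mx t)).
  exact.
have cx := cK (setrow i x A); have cy := cK (setrow i y A).
by rewrite int01D ?int01Z // => t; apply: cvgM; [exact: cvg_cst|exact: cx].
Qed.

Lemma local_homotopy_alternating u : alternating_rows (local_homotopy w u).
Proof.
move=> A i j ij Aij; rewrite -int01_0; apply: int01_eq => t _.
have ne : (lift ord0 i : 'I_(1 + q)) != lift ord0 j by rewrite (inj_eq lift_inj).
have er : row (lift ord0 i : 'I_(1 + q)) (col_mx (u *m P) (A *m segment_mx t)) =
    row (lift ord0 j : 'I_(1 + q)) (col_mx (u *m P) (A *m segment_mx t)).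
  by rewrite !rowS_col_mx !row_mul Aij.
exact: (aw (u *m segment_mx t) ne er).
Qed.

Hypothesis sw : forall B, Ck 1 U (fun u => w u B).

(** After differentiation under the integral, closedness identifies the integrand with the
    t-derivative of the form pulled back by [segment_mx]; the fundamental theorem of calculus gives
    the difference of the end values. *)
Lemma homotopy_formula u (A : 'M[R]_(q.+1, a)) : U u ->
  (forall v B, U v -> local_extd w v B = 0) ->
  local_extd (local_homotopy w) u A = w (u *m segment_mx 1) (A *m segment_mx 1) - w
    (u *m segment_mx 0) (A *m segment_mx 0).
Proof.
move=> Uu dw0.
have Uut t : U (u *m segment_mx t) by exact: SU.
have dw v B : U v -> differentiable (fun y => w y B) v by have [+ _] := sw B; apply.
have sf i := Ck_f (row' i A) sw.
pose g (i : 'I_q.+1) (t : R) : R := 'D_(inr_rV (row i A)) (f (row' i A)) (cons_rV t u).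
have cg i : continuous (g i).
  exact: (continuous_slice Uu ((sf i).2 (inr_rV (row i A)))).
have gE i t : g i t = 'D_(row i A *m segment_mx t)
      (fun y => w y (col_mx (u *m P) (row' i A *m segment_mx t) : 'M[R]_(1 + q, a)))
        (u *m segment_mx t)
    + w (u *m segment_mx t) (col_mx (row i A *m P) (row' i A *m segment_mx t) : 'M[R]_(1 + q, a)).
  rewrite /g -derive_cons_rV.
  rewrite (_ : (fun v => _) = fun v =>
      w (v *m segment_mx t) (col_mx (v *m P) (row' i A *m segment_mx t) : 'M[R]_(1 + q, a)));
        last first.
    by apply/funext => v; exact: f_cons_rV.
  have dF k j := (derive_front (row' i A *m segment_mx t) u (row i A) k j).1.
  have [dS DS] := differentiable_mulmx (segment_mx t) u (row i A).
  have rB (k : 'I_(1 + q)) : \row_j 'D_(row i A)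
      (fun y => (col_mx (y *m P) (row' i A *m segment_mx t) : 'M[R]_(1 + q, a)) k j) u
      = row k (col_mx (row i A *m P) 0).
    by apply/rowP => j; rewrite mxE [RHS]mxE; exact: (derive_front _ _ _ _ _).2.
  rewrite (derive_multi_eq (F := fun v => v *m segment_mx t) mw (fun B => dw _ B (Uut t)) dS dF
    DS erefl rB).
  congr (_ + _); rewrite big_ord_recl big1 ?addr0.
    by rewrite setrow_col_mxu row0_col_mx.
  move=> l _; rewrite rowS_col_mx linear0.
  exact: multilinear_setrow0.
have dK : local_extd (local_homotopy w) u A = int01
  (fun t : R => \sum_(i < q.+1) (-1) ^+ i * g i t).
  rewrite int01_sum; last by move=> i t; apply: cvgM; [exact: cvg_cst|exact: cg].
  apply: eq_bigr => i _; rewrite int01Z //; congr (_ * _).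
  have -> : (fun v => local_homotopy w v (row' i A))
    = fun v => int01 (fun t => f (row' i A) (cons_rV t v)).
    by apply/funext => v; apply: int01_eq => t _; rewrite f_cons_rV.
  rewrite ((derive_int01 oU Uu (sf i)).2 (row i A)).
  by apply: int01_eq => t _; rewrite /g.
rewrite dK; pose G t := w (u *m segment_mx t) (A *m segment_mx t).
have -> : w (u *m segment_mx 1) (A *m segment_mx 1) - w (u *m segment_mx 0) (A *m segment_mx 0)
  = G 1 - G 0 by [].
apply: int01_derive; last first.
  by apply: continuous_sumfun => i t; apply: cvgM; [exact: cvg_cst|exact: cg].
move=> t; have [dF DF] := derive_affine (u *m S0) (u *m P) t.
have FE (v : 'rV[R]_a) : (fun s => v *m segment_mx s) = (fun s : R => v *m S0 + s *: (v *m P)).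
  by apply/funext => s; rewrite /segment_mx mulmxDr -scalemxAr.
have BE k j : (fun s => (A *m segment_mx s) k j) =
    fun s : R => ((A *m S0) k j : R^o) + s *: ((A *m P) k j : R^o).
  by apply/funext => s; rewrite /segment_mx mulmxDr -scalemxAr mxE [X in _ + X]mxE.
have dB k j : differentiable (fun s => (A *m segment_mx s) k j) t.
  by rewrite BE; exact: (derive_affine _ _ _).1.
have rB k : \row_j 'D_1 (fun s => (A *m segment_mx s) k j) t = row k (A *m P).
  by apply/rowP => j; rewrite mxE [RHS]mxE BE; exact: (derive_affine _ _ _).2.
rewrite -FE in dF; rewrite -FE in DF.
apply: DeriveDef.
  apply: diff_derivable; exact: (derive_multi (F := fun s => u *m segment_mx s)
    (B := fun s => A *m segment_mx s) 1 mw (fun B => dw _ B (Uut t)) dF dB).1.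
rewrite /G (derive_multi_eq (F := fun s => u *m segment_mx s) mw (fun B => dw _ B (Uut t)) dF dB
  DF erefl rB).
(* Closedness, with the velocity as first vector, replaces the derivative along u P by derivatives
   along the rows of A. *)
have := dw0 _ (col_mx (u *m P) (A *m segment_mx t) : 'M[R]_(1 + q.+1, a)) (Uut t).
rewrite local_extd_col_mx => /eqP; rewrite subr_eq0 => /eqP ->.
rewrite -big_split /=; apply: eq_bigr => i _; rewrite gE mulrDr; congr (_ + _).
  by rewrite row_mul row'_mul.
by rewrite alternating_front // row_mul row'_mul.
Qed.

End Fixed.
End HomotopyFormula.

(** * Differential forms on manifolds *)

Section FormsOnManifolds.
Context {R : realType}.

Lemma jacobian_chain a b c (F : 'rV[R]_a -> 'rV[R]_b) (G : 'rV[R]_b -> 'rV[R]_c)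
    (H : 'rV[R]_a -> 'rV[R]_c) u :
  (\near u, H u = (G \o F) u) -> differentiable F u -> differentiable G (F u) ->
  jacobian H u = jacobian F u *m jacobian G (F u).
Proof.
move=> HGF dF dG; apply: etrans (diff_jacobian dF dG).
exact: near_jacobian HGF (differentiable_comp dF dG).
Qed.

Section LocalPullback.
Context {M N : manifold R} (f : M -> N) (sf : smooth_map f).

Definition local_rep (x : M) (x' : N) : 'rV[R]_(dim M) -> 'rV[R]_(dim N) :=
  chart x' \o f \o chartV x.

Definition local_rep_dom (x : M) (x' : N) : set 'rV[R]_(dim M) :=
  img x `&` (f \o chartV x) @^-1` dom x'.

Lemma open_local_rep_dom x x' : open (local_rep_dom x x').
Proof. by apply: open_pre; [exact: sf.1|exact: open_dom]. Qed.

Lemma local_rep_dom_nbhs x x' u : local_rep_dom x x' u -> nbhs u (local_rep_dom x x').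
Proof. by move=> xu; apply: open_nbhs_nbhs; split; [exact: open_local_rep_dom|]. Qed.

Lemma local_rep_img x x' u : local_rep_dom x x' u -> img x' (local_rep x x' u).
Proof. by case=> _ /chart_img. Qed.

Lemma local_rep_diff x x' u : local_rep_dom x x' u -> differentiable (local_rep x x') u.
Proof. by move=> xu; apply: (sf.2 x x' 1%N).1. Qed.

Lemma transition_diff (P : manifold R) (x y : P) u : img x u -> dom y (chartV x u) ->
  differentiable (chart y \o chartV x) u.
Proof. by move=> xu yu; apply: (transition_smooth x y 1%N).1. Qed.

(** [tangent f y] refers to the charts selected at y and f y, the local expressions to those at x
    and x'. The chain rule absorbs the Jacobians of the transitions between them. *)
Lemma local_expr_pullback q (w : qfield N q) x x' u A : local_rep_dom x x' u ->
  local_expr (pullback f w) x u A = local_expr w x' (local_rep x x' u)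
    (A *m jacobian (local_rep x x') u).
Proof.
move=> xu; have [ixu fu] := xu; have dx := mem_dom.
rewrite /local_expr /pullback /=.
have -> : chartV x' (local_rep x x' u) = f (chartV x u) by rewrite /local_rep /= chartK.
set y := chartV x u; set z := f y; rewrite -!mulmxA; congr (w z (A *m _)).
have J1 : jacobian (chart z \o f \o chartV x) u =
    jacobian (chart y \o chartV x) u *m tangent f y.
  rewrite /tangent; have -> : chart y y = (chart y \o chartV x) u by [].
  apply: jacobian_chain.
  - have oV : open (img x `&` chartV x @^-1` dom y) by exact: open_chartV_pre (open_dom y).
    apply: filterS (open_nbhs_nbhs (conj oV _)) => [v [_ yv] /=|].
      by rewrite chartK.
    by split; [|exact: mem_dom].
  - by apply: transition_diff => //; exact: mem_dom.
  - exact: smooth_map_diff.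
rewrite -J1; apply: jacobian_chain.
- apply: filterS (local_rep_dom_nbhs xu) => v [_ fv] /=.
  by rewrite chartK.
- exact: local_rep_diff.
- apply: transition_diff; first exact: local_rep_img.
  by rewrite /local_rep /= chartK //; exact: mem_dom.
Qed.

Lemma is_form_pullback q (w : qfield N q) : is_form w -> is_form (pullback f w).
Proof.
move=> [mw sw]; split=> [x|x A].
  by split; [apply: multilinear_mulmx|apply: alternating_mulmx]; have [] := mw (f x).
move=> k; apply: Ck_local => u xu; set x' := f (chartV x u).
have xu' : local_rep_dom x x' u by split=> //; exact: mem_dom.
exists (local_rep_dom x x'), (fun u => local_expr w x' (local_rep x x' u)
  (A *m jacobian (local_rep x x') u)).
split; [exact: open_local_rep_dom|exact: xu'| |].
  by move=> v; exact: local_expr_pullback.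
have oD : open (local_rep_dom x x') by exact: open_local_rep_dom.
apply: (Ck_multi (V := img x') oD) => [v| v|B| |i j].
- exact: local_rep_img.
- by apply: multilinear_mulmx; have [] := mw (chartV x' v).
- exact: sw.
- exact: sf.2.
- by apply: Ck_mulmx => // k' l; apply: Ck_jacobian => //; exact: sf.2.
Qed.

End LocalPullback.

Lemma local_expr_multilinear (N : manifold R) q (w : qfield N q) x u :
  is_form w -> multilinear_rows (local_expr w x u).
Proof. by move=> [mw _]; apply: multilinear_mulmx; have [] := mw (chartV x u). Qed.

Lemma local_expr_alternating (N : manifold R) q (w : qfield N q) x u :
  is_form w -> alternating_rows (local_expr w x u).
Proof. by move=> [mw _]; apply: alternating_mulmx; have [] := mw (chartV x u). Qed.

Lemma chart_nbhs (N : manifold R) (x : N) : nbhs (chart x x) (img x).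
Proof. by apply: open_nbhs_nbhs; split; [exact: open_img|exact/chart_img/mem_dom]. Qed.

Lemma local_extd_rep (M N : manifold R) (f : M -> N) (sf : smooth_map f) q (w : qfield N q) x x'
  u A :
  is_form w -> local_rep_dom f x x' u ->
  local_extd (local_expr (pullback f w) x) u A =
  local_extd (local_expr w x') (local_rep f x x' u) (A *m jacobian (local_rep f x x') u).
Proof.
move=> fw xu.
rewrite -(local_extd_pullback (U := local_rep_dom f x x') (V := img x')) //.
- apply: near_local_extd => B; apply: filterS (local_rep_dom_nbhs sf xu) => v.
  exact: local_expr_pullback.
- exact: open_local_rep_dom.
- exact: local_rep_img.
- exact: sf.2.
- by move=> v; exact: local_expr_multilinear.
- by move=> v; exact: local_expr_alternating.
- by move=> B; exact: fw.2.
Qed.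

Lemma extd_pullback (M N : manifold R) (f : M -> N) q (w : qfield N q) :
  smooth_map f -> is_form w -> extd (pullback f w) = pullback f (extd w).
Proof.
move=> sf fw; apply/funext => x; apply/funext => A.
have xx : local_rep_dom f x (f x) (chart x x).
  split; first by apply/chart_img/mem_dom.
  by rewrite /= chartK; exact: mem_dom.
apply: etrans (local_extd_rep sf A fw xx) _.
by rewrite /local_rep /= chartK //; exact: mem_dom.
Qed.

(** Naturality for the identity map, read from the chart at x to the chart selected at the point
    itself: the values of [extd], each computed in its own chart, agree with one computation in the
    chart at x. *)
Lemma local_expr_extd (N : manifold R) q (w : qfield N q) x u A : is_form w -> img x u ->
  local_expr (extd w) x u A = local_extd (local_expr w x) u A.
Proof.
move=> fw xu; have xu' : local_rep_dom id x (chartV x u) u by split=> //; exact: mem_dom.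
have := local_extd_rep (smooth_id N) A fw xu'; rewrite pullback_id => ->.
by [].
Qed.

End FormsOnManifolds.

(** * Linearity of the exterior derivative *)

Section LinearityOfForms.
Context {R : realType} {N : manifold R} {q : nat}.
Implicit Types w : qfield N q.

(** [qfield] carries only an additive structure; this combination supplies scalars and yields sums
    and opposites as special cases. *)
Definition lincomb (c : R) w w' : qfield N q := fun x A => c * w x A + w' x A.

Lemma is_form0 : is_form (0 : qfield N q).
Proof.
split=> [x|x A k]; last exact: (Ck_cst k (img x) (0 : R^o)).
by split=> [A B C i b c _ _ _|A i j _ _] //; rewrite !mulr0 addr0.
Qed.

Lemma is_form_lincomb c w w' : is_form w -> is_form w' -> is_form (lincomb c w w').
Proof.
move=> [mw sw] [mw' sw']; split=> [x|x A k].
  have [m1 a1] := mw x; have [m2 a2] := mw' x; split.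
    move=> A B C i b d rA rB rC; rewrite /lincomb.
    by rewrite (m1 _ _ _ _ _ _ rA rB rC) (m2 _ _ _ _ _ _ rA rB rC); ring.
  by move=> A i j ij rA; rewrite /lincomb (a1 _ _ _ ij rA) (a2 _ _ _ ij rA) mulr0 addr0.
have oI : open (img x) by exact: open_img.
apply: (@Ck_add _ _ k R^o _ (fun u => c * local_expr w x u A) (fun u => local_expr w' x u A)) => //.
  by apply: Ck_mul => //; [exact: Ck_cst|exact: sw].
exact: sw'.
Qed.

Lemma form_diff w x u A : is_form w -> img x u -> differentiable (fun v => local_expr w x v A) u.
Proof. by move=> [_ sw] xu; apply: (sw x A 1%N).1. Qed.

Lemma extd_lincomb c w w' : is_form w -> is_form w' ->
  extd (lincomb c w w') = fun x A => c * extd w x A + extd w' x A.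
Proof.
move=> fw fw'; apply/funext => x; apply/funext => A.
have xI : img x (chart x x) by exact/chart_img/mem_dom.
rewrite /extd mulr_sumr -big_split; apply: eq_bigr => i _ /=.
have d1 := form_diff (row' i A) fw xI; have d2 := form_diff (row' i A) fw' xI.
have d1' : differentiable (fun v => c * local_expr w x v (row' i A)) (chart x x).
  by apply: differentiable_mul => //; exact: differentiable_cst.
rewrite mulrCA -mulrDr; congr (_ * _).
rewrite -[LHS]/('D_(row i A) ((fun v => c * local_expr w x v (row' i A))
  + (fun v => local_expr w' x v (row' i A))) (chart x x)).
rewrite (deriveD (diff_derivable (v := row i A) d1') (diff_derivable (v := row i A) d2)).
congr (_ + _); rewrite (derive_mul _ (differentiable_cst _ _) d1).
by rewrite [X in _ + X * _]derive_cst mul0r addr0.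
Qed.

Lemma lincomb1 w w' : lincomb 1 w w' = w + w'.
Proof. by apply/funext => x; apply/funext => A; rewrite /lincomb mul1r. Qed.

Lemma lincombN w : lincomb (-1) w 0 = - w.
Proof. by apply/funext => x; apply/funext => A; rewrite /lincomb mulN1r addr0. Qed.

Lemma is_formD w w' : is_form w -> is_form w' -> is_form (w + w').
Proof. by rewrite -lincomb1; exact: is_form_lincomb. Qed.

Lemma is_formN w : is_form w -> is_form (- w).
Proof. by move=> fw; rewrite -lincombN; apply: is_form_lincomb => //; exact: is_form0. Qed.

Lemma extdD w w' : is_form w -> is_form w' -> extd (w + w') = extd w + extd w'.
Proof.
move=> fw fw'; rewrite -lincomb1 extd_lincomb //.
by apply/funext => x; apply/funext => A; rewrite mul1r.
Qed.

Lemma extd0 : extd (0 : qfield N q) = 0.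
Proof.
apply/funext => x; apply/funext => A; rewrite /extd big1 // => i _.
by rewrite [X in _ * X]derive_cst mulr0.
Qed.

Lemma extdN w : is_form w -> extd (- w) = - extd w.
Proof.
move=> fw; rewrite -lincombN extd_lincomb //; last exact: is_form0.
by apply/funext => x; apply/funext => A; rewrite extd0 mulN1r addr0.
Qed.

Lemma is_form_sum n (c : 'I_n -> qfield N q) : (forall i, is_form (c i)) ->
  is_form (\sum_i c i).
Proof.
move=> fc; elim/big_ind: _ => [|w w'|i _]; [exact: is_form0|exact: is_formD|exact: fc].
Qed.

Lemma extd_sum n (c : 'I_n -> qfield N q) : (forall i, is_form (c i)) ->
  extd (\sum_i c i) = \sum_i extd (c i).
Proof.
elim: n c => [|n IH] c fc; first by rewrite !big_ord0 extd0.
by rewrite !big_ord_recl extdD ?IH //; exact: is_form_sum.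
Qed.

Lemma sign_mulrz (V : zmodType) (v : V) k : v *~ (-1) ^+ k = if odd k then - v else v.
Proof. by rewrite -signr_odd; case: odd; rewrite ?expr1 ?mulrN1z ?expr0 ?mulr1z. Qed.

Lemma is_form_sign w k : is_form w -> is_form (w *~ (-1) ^+ k).
Proof. by rewrite sign_mulrz; case: odd => //; exact: is_formN. Qed.

Lemma extd_sign w k : is_form w -> extd (w *~ (-1) ^+ k) = extd w *~ (-1) ^+ k.
Proof. by move=> fw; rewrite !sign_mulrz; case: odd => //; exact: extdN. Qed.

End LinearityOfForms.

Section PullbackLinear.
Context {R : realType} {M N : manifold R} {q : nat} (f : M -> N).
Implicit Types w : qfield N q.

Lemma pullback0 : pullback f (0 : qfield N q) = 0.
Proof. by []. Qed.

Lemma pullbackN w : pullback f (- w) = - pullback f w.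
Proof. by []. Qed.

End PullbackLinear.

(** * Smooth maps into and out of products *)

Section SmoothMapConstructions.
Context {R : realType}.

Lemma smooth_cst (M N : manifold R) (y : N) : smooth_map (fun _ : M => y).
Proof.
by split=> [x|x z k]; [exact: cst_continuous|exact: (Ck_cst k _ (chart z y))].
Qed.

Lemma smooth_fst (M N : manifold R) : smooth_map (fst : prod_manifold M N -> M).
Proof.
split=> [x|x z k]; first exact: cvg_fst.
have oU : open (img x `&` (fst \o chartV x) @^-1` dom z).
  by apply: open_pre; [move=> y; exact: cvg_fst|exact: open_dom].
apply: (Ck_comp (f := lsubmx) (g := chart z \o chartV x.1)
  (V := img x.1 `&` chartV x.1 @^-1` dom z)) => //.
- by move=> u [[? ?] ?].
- exact: Ck_linear.
- exact: transition_smooth.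
Qed.

Lemma smooth_snd (M N : manifold R) : smooth_map (snd : prod_manifold M N -> N).
Proof.
split=> [x|x z k]; first exact: cvg_snd.
have oU : open (img x `&` (snd \o chartV x) @^-1` dom z).
  by apply: open_pre; [move=> y; exact: cvg_snd|exact: open_dom].
apply: (Ck_comp (f := rsubmx) (g := chart z \o chartV x.2)
  (V := img x.2 `&` chartV x.2 @^-1` dom z)) => //.
- by move=> u [[? ?] ?].
- exact: Ck_linear.
- exact: transition_smooth.
Qed.

Lemma smooth_pair (L M N : manifold R) (f : L -> M) (g : L -> N) :
  smooth_map f -> smooth_map g ->
  smooth_map (fun x => (f x, g x) : prod_manifold M N).
Proof.
move=> [cf sf] [cg sg].
have cfg : continuous (fun x => (f x, g x) : prod_manifold M N).
  by move=> x; exact: cvg_pair (cf x) (cg x).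
split=> // x z k.
set U := img x `&` _.
have oU : open U by apply: open_pre => //; exact: open_dom.
apply: (@Ck_eq _ _ _ _ _ _ ((inl_rV \o (chart z.1 \o f \o chartV x)) \+
    (inr_rV \o (chart z.2 \o g \o chartV x)))) => //.
  by move=> u _; rewrite /= /prod_chart row_mxE_inlr.
apply: Ck_add => //; (apply: Ck_lin => //; first exact: rV_linear_continuous).
  by apply: Ck_sub (sf x z.1 k) => u [? []].
by apply: Ck_sub (sg x z.2 k) => u [? []].
Qed.

Lemma smooth_euclid n m (f : 'rV[R]_n -> 'rV[R]_m) :
  smooth_on setT f -> smooth_map (f : euclid n -> euclid m).
Proof.
move=> sf; split=> [x|x z k].
  exact: (sf 0%N x I).
by apply: Ck_sub (sf k).
Qed.

End SmoothMapConstructions.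

(** * Cohomology of the product with a Euclidean space *)

Section PoincareLemma.
Context {R : realType} (n : nat) (M : manifold R).
Let N := prod_manifold (euclid n) M.
Let a := (n + dim M)%N.

Let S0 : 'M[R]_a := block_mx 0 0 0 1%:M.
Let P : 'M[R]_a := block_mx 1%:M 0 0 0.

Lemma rV_segment_mx t (u : 'rV[R]_a) : u *m segment_mx S0 P t = row_mx (t *: lsubmx u) (rsubmx u).
Proof.
rewrite /segment_mx mulmxDr -scalemxAr -{1 2}[u]hsubmxK /S0 /P !mul_row_block.
by rewrite !mulmx0 !mulmx1 !addr0 !add0r scale_row_mx scaler0 add_row_mx addr0 add0r.
Qed.

Lemma rV_P (u : 'rV[R]_a) : u *m P = row_mx (lsubmx u) 0.
Proof. by rewrite -{1}[u]hsubmxK /P mul_row_block !mulmx0 !mulmx1 !addr0. Qed.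

Definition scale_hom (t : R) (x : N) : N := (t *: (x.1 : 'rV[R]_n), x.2).

(** The velocity x.1 of the contraction and the matrix of its differential are the same in all
    product charts, so one formula defines the operator globally. *)
Definition homotopy {q} (w : qfield N q.+1) : qfield N q := fun x A =>
  int01 (fun t => w (scale_hom t x)
    (col_mx (row_mx (x.1 : 'rV[R]_n) 0) (A *m segment_mx S0 P t) : 'M[R]_(1 + q, a))).

Lemma jacobian_mulmxr b c (M' : 'M[R]_(b, c)) u : jacobian (fun v => v *m M') u = M'.
Proof.
have [d D] := differentiable_mulmx M' u 0.
by apply/row_matrixP => i; rewrite !rowE derive_jacobian // (differentiable_mulmx _ _ _).2.
Qed.

Section Chart.
Variables (x y : N) (u : 'rV[R]_a).
Hypotheses (xu : img x u) (yu : dom y (chartV x u)).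

Let G : 'rV[R]_a -> 'rV[R]_a := chart y \o chartV x.

Lemma transition_prodE v :
  G v = row_mx (lsubmx v) (chart y.2 (chartV x.2 (rsubmx v))).
Proof. by []. Qed.

Lemma transition_prod_diff : differentiable G u.
Proof. exact: (transition_diff xu yu). Qed.

(** Transition maps of the product change only the M-coordinates, hence commute with scaling the
    others; this is the derivative of that commutation. *)
Lemma transition_segment_mx t : differentiable G (u *m segment_mx S0 P t) ->
  segment_mx S0 P t *m jacobian G (u *m segment_mx S0 P t) = jacobian G u *m segment_mx S0 P t.
Proof.
move=> dG; have dS v := (differentiable_mulmx (segment_mx S0 P t) v 0).1.
have E1 := diff_jacobian (dS u) dG.
have E2 := diff_jacobian transition_prod_diff (dS (G u)).
rewrite jacobian_mulmxr in E1; rewrite jacobian_mulmxr in E2.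
apply: etrans (esym E1) _; apply: etrans _ E2.
congr (jacobian _ u); apply/funext => v.
rewrite -[LHS]/(G (v *m segment_mx S0 P t)) -[RHS]/(G v *m segment_mx S0 P t).
by rewrite !transition_prodE !rV_segment_mx !row_mxKl !row_mxKr.
Qed.

(** In the directions of R^n a transition map has the same difference quotients as the identity. *)
Lemma transition_P (v : 'rV[R]_a) : differentiable G u -> v *m P *m jacobian G u = v *m P.
Proof.
move=> dG; rewrite derive_jacobian // -[RHS](derive_id u (v *m P)) /derive.
set f1 := fun h : R => _; set f2 := fun h : R => _.
suff -> : f1 = f2 by [].
apply/funext => h; rewrite /f1 /f2 /=; congr (_ *: _).
rewrite addrK !transition_prodE rV_P.
rewrite linearD linearZ /= row_mxKl linearD linearZ /= row_mxKr scaler0 add0r.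
by rewrite opp_row_mx add_row_mx addrK subrr scale_row_mx scaler0.
Qed.

End Chart.

Lemma img_segment_mx (x : N) t (u : 'rV[R]_a) : img x u -> img x (u *m segment_mx S0 P t).
Proof. by move=> [_ xu]; rewrite rV_segment_mx; split=> //=; rewrite row_mxKr. Qed.

Lemma chartV_segment_mx (x : N) t (u : 'rV[R]_a) :
  chartV x (u *m segment_mx S0 P t) = scale_hom t (chartV x u).
Proof. by rewrite rV_segment_mx /= /prod_chartV row_mxKl row_mxKr. Qed.

(** By the two preceding commutation rules the change of chart passes through the integrand, so
    smoothness and the homotopy formula carry over from coordinates to N. *)
Lemma local_expr_homotopy q (w : qfield N q.+1) (x : N) u A : img x u ->
  local_expr (homotopy w) x u A = local_homotopy S0 P (local_expr w x) u A.
Proof.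
move=> xu; rewrite /local_expr /homotopy /local_homotopy; apply: int01_eq => t _.
set y := chartV x u.
have yy : dom y (chartV x u) by exact: mem_dom.
have xut := img_segment_mx t xu.
have yut : dom y (chartV x (u *m segment_mx S0 P t)).
  by rewrite chartV_segment_mx; split=> //=; exact: mem_dom.
have dGu := transition_prod_diff xu yy.
have dGut := transition_prod_diff xut yut.
have -> : chartV x (u *m segment_mx S0 P t) = scale_hom t y by rewrite chartV_segment_mx.
set J := jacobian (chart (scale_hom t y) \o chartV x) (u *m segment_mx S0 P t).
have E1 : segment_mx S0 P t *m J = jacobian (chart y \o chartV x) u *m segment_mx S0 P t.
  exact: (transition_segment_mx xu yy dGut).
have E2 : u *m P *m J = row_mx (lsubmx u) 0 by apply: etrans (transition_P u dGut) (rV_P u).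
congr (w _ _); apply: etrans (esym (@mul_col_mx _ 1 q a a (u *m P) (A *m segment_mx S0 P t) J)).
by rewrite E2 -[in RHS]mulmxA E1 mulmxA.
Qed.

Lemma local_expr_chart (N' : manifold R) q (w : qfield N' q) x A :
  local_expr w x (chart x x) A = w x A.
Proof.
rewrite /local_expr; have -> : chartV x (chart x x) = x by rewrite chartK //; exact: mem_dom.
by rewrite -[jacobian _ _]/(tangent id x) tangent_id mulmx1.
Qed.

Lemma is_form_homotopy q (w : qfield N q.+1) : is_form w -> is_form (homotopy w).
Proof.
move=> fw; have oI (x : N) : open (img x : set 'rV[R]_a) by exact: (@open_img R N x).
have SI (x : N) t (u : 'rV[R]_a) : img x u -> (img x : set 'rV[R]_a) (u *m segment_mx S0 P t)
  by exact: img_segment_mx.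
split=> [x|x A k].
  have xI : img x (chart x x) by exact/chart_img/mem_dom.
  have E : homotopy w x = local_homotopy S0 P (local_expr w x) (chart x x).
    by apply/funext => A; rewrite -local_expr_homotopy // local_expr_chart.
  rewrite E; split.
    apply: (local_homotopy_multilinear (oI x) (SI x)) => // [u|B].
      exact: (@local_expr_multilinear R N q.+1 w x u fw).
    exact: (fw.2 x B 0%N).
  by apply: local_homotopy_alternating => u; exact: (@local_expr_alternating R N q.+1 w x u fw).
apply: (@Ck_eq _ _ k _ _ _ (fun u => local_homotopy S0 P (local_expr w x) u A)) => //.
  by move=> u xu; rewrite local_expr_homotopy.
apply: (Ck_local_homotopy (oI x) (SI x)) => [u|B]; first exact:
  (@local_expr_multilinear R N q.+1 w x u fw).
exact: fw.2.
Qed.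

Definition retract (x : N) : N := (0 : 'rV[R]_n, x.2).

Lemma smooth_retract : smooth_map retract.
Proof.
apply: (smooth_pair (M := euclid n)); first exact: (@smooth_cst R N (euclid n) 0).
exact: smooth_snd.
Qed.

Lemma poincare_homotopy q (w : qfield N q.+1) : is_form w -> extd w = 0 ->
  extd (homotopy w) = w - pullback retract w.
Proof.
move=> fw dw; apply/funext => x; apply/funext => A.
have oI : open (img x : set 'rV[R]_a) by exact: (@open_img R N x).
have SI t (u : 'rV[R]_a) : img x u -> (img x : set 'rV[R]_a) (u *m segment_mx S0 P t)
  by exact: img_segment_mx.
have xI : img x (chart x x) by exact/chart_img/mem_dom.
set u0 : 'rV[R]_a := chart x x.
transitivity (local_extd (local_homotopy S0 P (local_expr w x)) u0 A).
  apply: near_local_extd => B; apply: filterS (chart_nbhs x) => u.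
  exact: local_expr_homotopy.
have mw (u : 'rV[R]_a) : multilinear_rows (local_expr w x u).
  exact: (@local_expr_multilinear R N q.+1 w x u fw).
have aw (u : 'rV[R]_a) : alternating_rows (local_expr w x u).
  exact: (@local_expr_alternating R N q.+1 w x u fw).
have dw0 (v : 'rV[R]_a) B : img x v -> local_extd (local_expr w x) v B = 0.
  by move=> xv; rewrite -(local_expr_extd B fw xv) dw.
have sw B := fw.2 x B 1%N.
have HF := homotopy_formula oI SI mw aw sw A xI dw0.
apply: etrans HF _.
have T1 : local_expr w x (u0 *m segment_mx S0 P 1) (A *m segment_mx S0 P 1) = w x A.
  have -> : segment_mx S0 P 1 = 1%:M.
    by rewrite /segment_mx scale1r /S0 /P add_block_mx !addr0 !add0r -scalar_mx_block.
  by rewrite (mulmx1 u0) (mulmx1 A); exact: local_expr_chart.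
have T2 : local_expr w x (u0 *m segment_mx S0 P 0) (A *m segment_mx S0 P 0)
  = pullback retract w x A.
  have rd : local_rep_dom retract x x u0.
    split=> //; rewrite /= prod_chartK; last exact: (@mem_dom R N x).
    by split=> //; exact: mem_dom.
  have RE v : img x v -> local_rep retract x x v = v *m segment_mx S0 P 0.
    move=> [_ xv]; rewrite rV_segment_mx scale0r.
    by rewrite -[LHS]/(row_mx 0 (chart x.2 (chartV x.2 (rsubmx v)))) chartVK.
  have JE : jacobian (local_rep retract x x) u0 = segment_mx S0 P 0.
    rewrite -(jacobian_mulmxr (segment_mx S0 P 0) u0); apply: near_jacobian.
      by apply: filterS (chart_nbhs x); exact: RE.
    exact: (differentiable_mulmx _ _ 0).1.
  have L := local_expr_pullback smooth_retract w A rd.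
  apply: etrans (congr2 (fun v J => local_expr w x v (A *m J)) (esym (RE u0 xI)) (esym JE)) _.
  by apply: etrans (esym L) _; exact: local_expr_chart.
by rewrite T1 T2.
Qed.

(** A closed w differs from its pullback under [retract] by an exact form. Since [retract] factors
    through M, that pullback comes from a closed form on M, which is exact by assumption. *)
Lemma deRham_trivial_prod q : deRham_trivial M q.+1 -> deRham_trivial N q.+1.
Proof.
move=> HM w fw dw.
pose inj (y : M) : N := (0 : 'rV[R]_n, y).
have sinj : smooth_map inj.
  apply: (smooth_pair (M := euclid n)); first exact: (@smooth_cst R M (euclid n) 0).
  exact: smooth_id.
have ssnd : smooth_map (snd : N -> M) by exact: smooth_snd.
have finj := is_form_pullback sinj fw.
have dinj : extd (pullback inj w) = 0.
  by rewrite (extd_pullback sinj fw) dw; exact: pullback0.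
have [h fh hE] := HM _ finj dinj.
have fK := is_form_homotopy fw; have fs := is_form_pullback ssnd fh.
exists (homotopy w + pullback (snd : N -> M) h); first exact: is_formD.
have E : pullback retract w = pullback (snd : N -> M) (extd h).
  by rewrite -hE -(pullback_comp w ssnd sinj).
by rewrite (extdD fK fs) (poincare_homotopy fw dw) (extd_pullback ssnd fh) E subrK.
Qed.

End PoincareLemma.

(** * Smooth paths *)

Section Connectedness.
Context {R : realType}.

Lemma derive_scalar_comp (V : normedModType R) (g dg : R -> R) (l : V -> R) x v :
  (forall y : R, is_derive y 1 g (dg y)) -> differentiable l x ->
  differentiable (g \o l) x /\ 'D_v (g \o l) x = dg (l x) * 'D_v l x.
Proof.
move=> Dg dl; have [dgx Dgx] := Dg (l x).
have dd : differentiable g (l x) by apply/derivable1_diffP.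
have dc : differentiable (g \o l) x by exact: differentiable_comp.
split=> //; rewrite deriveE // diff_comp // -[LHS]/('d g (l x) ('d l x v)) deriv1E //.
by rewrite derive1E Dgx mulrC -deriveE.
Qed.

(** Joint induction, because differentiation exchanges sine and cosine. The sine serves below as a
    bounded smooth reparametrization. *)
Lemma Ck_sin_cos a (l : 'rV[R]_a -> R) k : (forall j, Ck j setT l) ->
  Ck k setT (sin \o l) /\ Ck k setT (cos \o l).
Proof.
move=> sl; have oT : open [set: 'rV[R]_a] by exact: openT.
have cl : forall x, {for x, continuous l} by move=> x; exact: (sl 0%N x I).
have dl x : differentiable l x by exact: ((sl 1%N).1 x I).
elim: k => [|k [IHs IHc]].
  by split=> x _; apply: continuous_comp => //; [exact: continuous_sin|exact: continuous_cos].
have Dcos (y : R) : is_derive y 1 cos (- sin y) by exact: is_derive_cos.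
split; (split=> [x _|v]).
- exact: (derive_scalar_comp 0 (@is_derive_sin R) (dl x)).1.
- apply: (Ck_eq oT _ (Ck_mul oT IHc ((sl k.+1).2 v))) => x _.
  exact: (derive_scalar_comp v (@is_derive_sin R) (dl x)).2.
- exact: (derive_scalar_comp 0 Dcos (dl x)).1.
- apply: (Ck_eq oT _ (Ck_mul oT (Ck_mul oT (Ck_cst k _ (-1 : R^o)) IHs) ((sl k.+1).2 v))) => x _.
  by rewrite (derive_scalar_comp v Dcos (dl x)).2 /= mulN1r.
Qed.

(** The classes of an equivalence relation with open classes are also closed. *)
Lemma connected_rel (T : topologicalType) (E : T -> T -> Prop) :
  connected [set: T] -> (forall x, E x x) -> (forall x y, E x y -> E y x) ->
  (forall x y z, E x y -> E y z -> E x z) -> (forall x, \forall y \near x, E x y) ->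
  forall x y, E x y.
Proof.
move=> cT Er Es Et En x y.
have oE z : open [set u | E z u].
  rewrite openE => u /= zu; apply: filterS (En u) => v; exact: Et.
have cE z : closed [set u | E z u].
  rewrite -openC openE => u /= zu; apply: filterS (En u) => v uv zv.
  by apply: zu; apply: Et zv _; exact: Es.
suff AT : [set u | E x u] = setT by have : [set u | E x u] y by rewrite AT.
apply: cT; first by exists x; exact: Er.
  by exists [set u | E x u]; [exact: oE|rewrite setTI].
by exists [set u | E x u]; [exact: cE|rewrite setTI].
Qed.

(** Simplices are defined on the whole line, where a straight segment would leave the chart. The
    parameter sin (pi t / 2) takes the values 0 and 1 at the ends and never leaves [-1, 1], so the
    path stays in the ball around [c]. *)
Lemma near_smooth_path (N : manifold R) (x : N) : \forall y \near x,
  exists sigma : euclid (R := R) 1 -> N,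
    [/\ smooth_map sigma, sigma (const_mx 0) = x & sigma (const_mx 1) = y].
Proof.
set c := chart x x.
have /nbhs_ballP[e /= e0 eI] := chart_nbhs x.
have nx : nbhs x (dom x) by apply: open_nbhs_nbhs; split; [exact: open_dom|exact: mem_dom].
have ny : \forall y \near x, ball c e (chart x y).
  have cx := @chart_continuous R N x x (mem_dom x).
  have ne : nbhs c (ball c e) by exact: nbhsx_ballx.
  exact: cx ne.
apply: filterS2 nx ny => y xy cy.
pose s (t : 'rV[R]_1) : R := sin (pi / 2 * t 0 0).
pose g (t : 'rV[R]_1) := c + s t *: (chart x y - c).
have oT : open [set: 'rV[R]_1] by exact: openT.
have ss k : Ck k setT s.
  have [|+ _] := @Ck_sin_cos 1 (fun t => pi / 2 * t 0 0) k; last exact.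
  by move=> j; apply: Ck_mul => //; [exact: Ck_cst|apply: Ck_coord => //; exact: Ck_id].
have sg k : Ck k setT g.
  by apply: Ck_add => //; [exact: Ck_cst|apply: Ck_scale => //; exact: Ck_cst].
have gI t : img x (g t).
  apply: eI; move: cy; rewrite -!ball_normE /= /g opprD addNKr normrN normrZ distrC.
  by apply: le_lt_trans; rewrite ler_piMl // ler_norml sin_geN1 sin_le1.
exists (chartV x \o g); split.
- have cg : continuous (chartV x \o g).
    move=> t; apply: continuous_comp; first exact: (sg 0%N t I).
    exact: chartV_continuous.
  split=> // t z k.
  have oz : open (dom z) by exact: open_dom.
  have oU := open_pre (M := euclid 1) (x := t) cg oz.
  apply: (Ck_comp (f := g) (g := chart z \o chartV x) (V := img x `&` chartV x @^-1` dom z) oU)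
    => [v [_ zv]| |].
  + by split.
  + exact: Ck_sub (sg k).
  + exact: transition_smooth.
- rewrite /= /g /s mxE mulr0 sin0 scale0r addr0 /c chartK //; exact: mem_dom.
- by rewrite /= /g /s mxE mulr1 sin_pihalf scale1r addrC subrK chartK.
Qed.

Lemma closed_form0_path (N : manifold R) (f : qfield N 0) (sigma : euclid (R := R) 1 -> N) :
  is_form f -> extd f = 0 -> smooth_map sigma ->
  f (sigma (const_mx 0)) 0 = f (sigma (const_mx 1)) 0.
Proof.
move=> ff df ss.
pose w := pullback sigma f; pose g (t : 'rV[R]_1) := w t 0.
have fw : is_form w by exact: is_form_pullback.
have dw : extd w = 0 by rewrite /w (extd_pullback ss ff) df; exact: pullback0.
have lE u : local_expr w u = fun v _ => g v.
  by apply/funext => v; apply/funext => B; rewrite /local_expr /g; congr (w _ _);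
    rewrite [LHS]flatmx0.
have dg t : differentiable g t.
  by have := @form_diff R (euclid 1) 0 w t t 0 fw I; rewrite lE.
have Dg t v : 'D_v g t = 0.
  have := congr1 (fun W : qfield (euclid 1) 1 => W t v) dw.
  rewrite /extd big_ord_recl big_ord0 addr0 expr0 mul1r lE => E.
  apply: etrans E; congr (derive _ _ _).
  by apply/rowP => j; rewrite mxE; congr (v _ _); apply/val_inj; rewrite /= ord1.
have [|s _ Es] := @MVT_line R _ g (const_mx 0) (const_mx 1); first by [].
have gE u : g u = f (sigma u) 0 by congr (f _ _); rewrite [LHS]flatmx0.
have e1 : const_mx 0 + const_mx 1 = const_mx 1 :> 'rV[R]_1.
  by apply/rowP => j; rewrite !mxE add0r.
rewrite Dg e1 in Es; apply: etrans (esym (gE _)) (etrans _ (gE _)).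
exact: esym (subr0_eq Es).
Qed.

(** One principle for the homology of points and for the constancy of closed functions: move the
    R^n-coordinate along a line, then the M-coordinate by connectedness. Reflexivity comes from
    constant paths. *)
Lemma smooth_path_rel n (M : manifold R) (E : prod_manifold (euclid n) M ->
  prod_manifold (euclid n) M -> Prop) :
  connected [set: M] -> (forall x y, E x y -> E y x) ->
  (forall x y z, E x y -> E y z -> E x z) ->
  (forall sigma : euclid (R := R) 1 -> prod_manifold (euclid n) M, smooth_map sigma ->
     E (sigma (const_mx 0)) (sigma (const_mx 1))) ->
  forall x y, E x y.
Proof.
move=> cM Es Et Ep [v y] [v' y'].
pose N := prod_manifold (euclid n) M.
apply: (Et _ ((v', y) : N)).
  pose g (t : 'rV[R]_1) : 'rV[R]_n := v + t 0 0 *: (v' - v).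
  have sg : smooth_on setT g.
    move=> k; have oT : open [set: 'rV[R]_1] by exact: openT.
    apply: Ck_add => //; first exact: Ck_cst.
    by apply: Ck_scale => //; [apply: Ck_coord => //; exact: Ck_id|exact: Ck_cst].
  have := Ep _ (smooth_pair (smooth_euclid sg) (@smooth_cst R (euclid 1) M y)).
  by rewrite /g !mxE scale0r addr0 scale1r addrC subrK.
apply: (connected_rel (E := fun z z' => E ((v', z) : N) ((v', z') : N)) cM).
- move=> z; have := Ep _ (smooth_pair (@smooth_cst R (euclid 1) (euclid n) v')
  (@smooth_cst R (euclid 1) M z)).
  exact.
- by move=> z z'; exact: Es.
- by move=> z z' z''; exact: Et.
- move=> z; apply: filterS (near_smooth_path z) => z' [sigma [ss <- <-]].
  exact: (Ep _ (smooth_pair (@smooth_cst R (euclid 1) (euclid n) v') ss)).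
Qed.

End Connectedness.

(** * Homology of points *)

Section Homologous.
Context {R : realType} {N : manifold R}.

Lemma homologous_sym (x y : N) : homologous_points x y -> homologous_points y x.
Proof.
move=> [r [a [sigma [ss E]]]]; exists r, (fun i => - a i), sigma; split=> // z.
by rewrite -opprB E -sumrN; apply: eq_bigr => i _; rewrite mulNr.
Qed.

Lemma homologous_trans (x y z : N) :
  homologous_points x y -> homologous_points y z -> homologous_points x z.
Proof.
move=> [r [a [s [ss E]]]] [r' [a' [s' [ss' E']]]].
pose join T (f : 'I_r -> T) (f' : 'I_r' -> T) (i : 'I_(r + r')) :=
  match fintype.split i with inl j => f j | inr j => f' j end.
exists (r + r')%N, (join _ a a'), (join _ s s'); split.
  by move=> i; rewrite /join; case: fintype.split => j; [exact: ss|exact: ss'].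
move=> t; transitivity (((y == t)%:Z - (x == t)%:Z) + ((z == t)%:Z - (y == t)%:Z)).
  by rewrite [RHS]addrC [RHS]addrA subrK.
rewrite E E'.
rewrite big_split_ord /=; congr (_ + _); apply: eq_bigr => i _; rewrite /join.
  by rewrite (unsplitK (inl i)).
by rewrite (unsplitK (inr i)).
Qed.

Lemma homologous_path (sigma : euclid (R := R) 1 -> N) : smooth_map sigma ->
  homologous_points (sigma (const_mx 0)) (sigma (const_mx 1)).
Proof.
move=> ss; exists 1%N, (fun=> 1), (fun=> sigma); split=> // z.
by rewrite big_ord1 mul1r.
Qed.

End Homologous.

(** * The group differential squares to zero *)

Section CoboundarySquare.
Context {G : groupType} {A : zmodType} (act : A -> G -> A).
Hypotheses (actD : forall a b g, act (a + b) g = act a g + act b g)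
  (actM : forall a g h, act (act a g) h = act a (g * h)%g)
  (act1 : forall a, act a 1%g = a)
  (A2 : forall v : A, v + v = 0 -> v = 0).

Lemma act0 g : act 0 g = 0.
Proof. by apply: (addrI (act 0 g)); rewrite -actD !addr0. Qed.

Lemma actN a g : act (- a) g = - act a g.
Proof. by apply: (addrI (act a g)); rewrite -actD !subrr act0. Qed.

Lemma act_sign a g k : act (a *~ (-1) ^+ k) g = act a g *~ (-1) ^+ k.
Proof. by rewrite !sign_mulrz; case: odd => //; exact: actN. Qed.

Lemma act_sum n (a : 'I_n -> A) g : act (\sum_i a i) g = \sum_i act (a i) g.
Proof. by apply: (big_morph (fun a => act a g)) => [a' b'|]; [exact: actD|exact: act0]. Qed.

Definition ratio {s} (w : 'I_s.+1 -> G) : 'I_s -> G :=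
  fun k => (w (widen_ord (leqnSn s) k) * (w (lift ord0 k))^-1)%g.

(* [f] in homogeneous coordinates: g_k = w_k w_(k+1)^-1, translated back by the
   action of the last vertex. *)
Definition homog {s} (f : ('I_s -> G) -> A) (w : 'I_s.+1 -> G) : A :=
  act (f (ratio w)) (w ord_max).

(* In homogeneous coordinates the differential is the alternating sum over the
   omission of one vertex. *)
Lemma homog_cobd s (f : ('I_s -> G) -> A) (w : 'I_s.+2 -> G) :
  homog (cobd act f) w = \sum_(j < s.+2) homog f (w \o lift j) *~ (-1) ^+ j.
Proof.
rewrite /homog /cobd !actD act_sum big_ord_recl expr0 mulr1z -addrA; congr (_ + _).
  congr (act (f _) (w _)); last exact: val_inj.
  by apply/funext => k; rewrite /ratio; congr (w _ * (w _)^-1)%g; exact: val_inj.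
rewrite big_ord_recr; congr (_ + _).
  apply: eq_bigr => i _; rewrite act_sign; congr (act (f _) _ *~ _).
    apply/funext => k; rewrite /contract /ratio /=.
    case: ltngtP => ki.
    - by congr (w _ * (w _)^-1)%g; apply/val_inj; rewrite /= /bump; lia.
    - have -> : (k == i) = false by apply/negbTE/eqP => e; rewrite e ltnn in ki.
      by congr (w _ * (w _)^-1)%g; apply/val_inj; rewrite /= /bump; lia.
    (* The product of two neighbouring ratios telescopes: contracting at i means omitting vertex i +
       1. *)
    - have -> : (k == i) by apply/eqP/val_inj.
      have -> : widen_ord (leqnSn s.+1) (lift ord0 k) = lift ord0 (widen_ord (leqnSn s) k).
        exact: val_inj.
      rewrite mulgA mulgKV.
      by congr (w _ * (w _)^-1)%g; apply/val_inj; rewrite /= /bump; lia.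
  by congr (w _); apply/val_inj; rewrite /= /bump /=; have := ltn_ord i; lia.
(* The last ratio acts first and the last vertex then completes it to the action of the vertex
   before. *)
rewrite act_sign actM; congr (act (f _) _ *~ _).
  by apply/funext => k; rewrite /ratio; congr (w _ * (w _)^-1)%g; apply/val_inj;
    rewrite /= /bump; have := ltn_ord k; lia.
rewrite /ratio; have -> : lift ord0 ord_max = ord_max :> 'I_s.+2 by exact: val_inj.
by rewrite mulgKV; congr (w _); apply/val_inj; rewrite /= /bump; lia.
Qed.

(** The vertices are the tail products of g, ending with the empty product. *)
Lemma ratio_surj s (g : 'I_s -> G) : exists2 w : 'I_s.+1 -> G, ratio w = g & w ord_max = 1%g.
Proof.
pose l := [seq g i | i <- enum 'I_s].
have sl : size l = s by rewrite size_map size_enum_ord.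
exists (fun k => foldr (fun a b => a * b)%g 1%g (drop k l)).
  apply/funext => k; rewrite /ratio /=.
  have kl : (k < size l)%N by rewrite sl.
  rewrite (drop_nth 1%g kl) /= mulgK (nth_map k) ?size_enum_ord //.
  by rewrite nth_ord_enum.
by rewrite drop_oversize // sl.
Qed.

(** In homogeneous coordinates each differential omits one vertex, and omissions in the two orders
    cancel. *)
Lemma cobd_cobd s (f : ('I_s -> G) -> A) : cobd act (cobd act f) = 0.
Proof.
apply/funext => g; have [w <- w1] := ratio_surj g.
rewrite -[LHS]act1 -w1 -/(homog _ _) homog_cobd.
rewrite -[RHS](@alternating_double_sum A _ (fun i j => homog f (w \o lift i \o lift j)) A2).
  apply: eq_bigr => i _; rewrite homog_cobd.
  rewrite mulrz_suml; apply: eq_bigr => j _.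
  by rewrite -mulrzA exprD mulrC.
move=> i j i' j' li l'; congr homog; apply/funext => k /=; congr (w _).
apply/val_inj; move/(congr1 val): li; move/(congr1 val): l' => /=; rewrite /bump.
by do 6?[case: leqP => ? /=]; lia.
Qed.

End CoboundarySquare.

(** * The double complex *)

Section CoboundaryLinear.
Context {G : groupType} {A : zmodType} (act : A -> G -> A).
Hypothesis actD : forall a b g, act (a + b) g = act a g + act b g.

Lemma cobdD s (f f' : ('I_s -> G) -> A) :
  cobd act (fun g => f g + f' g) = fun g => cobd act f g + cobd act f' g.
Proof.
apply/funext => g; rewrite /cobd actD mulrzDl.
rewrite (eq_bigr (fun i : 'I_s => f (contract i g) *~ (-1) ^+ i.+1
  + f' (contract i g) *~ (-1) ^+ i.+1)); last by move=> i _; rewrite mulrzDl.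
by rewrite big_split /= [X in X + _ = _]addrACA [LHS]addrACA.
Qed.

Lemma cobdN s (f : ('I_s -> G) -> A) : cobd act (fun g => - f g) = fun g => - cobd act f g.
Proof.
apply/funext => g; rewrite /cobd (actN actD) !mulNrz !opprD; congr (_ + _ + _).
by rewrite -sumrN; apply: eq_bigr => i _; rewrite mulNrz.
Qed.

Lemma cobd_signz s (f : ('I_s -> G) -> A) k :
  cobd act (fun g => f g *~ (-1) ^+ k) = fun g => cobd act f g *~ (-1) ^+ k.
Proof.
have [ko|ke] := boolP (odd k).
  rewrite (_ : (fun g => _) = fun g => - f g) ?cobdN; apply/funext => g.
    by rewrite sign_mulrz ko.
  by rewrite sign_mulrz ko.
rewrite (_ : (fun g => f g *~ _) = f); apply/funext => g.
  by rewrite sign_mulrz (negbTE ke).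
by rewrite sign_mulrz (negbTE ke).
Qed.

End CoboundaryLinear.

(* Transport along [p = j]; the junk value is 0. *)
Definition form_at {R : realType} {N : manifold R} {p : nat} (b : qfield N p) (j : nat) :
    qfield N j :=
  if @eqP _ p j is ReflectT e then eq_rect p (fun j => qfield N j) b j e else 0.
Arguments form_at {R N p} b j.

Lemma form_at_id (R : realType) (N : manifold R) p (b : qfield N p) : form_at b p = b.
Proof. by rewrite /form_at; case: eqP => // e; rewrite (eq_axiomK e). Qed.

Section DoubleComplex.
Context {R : realType} {N : manifold R} {G : groupType} (rho : G -> N -> N).
Hypotheses (rhoS : forall g, smooth_map (rho g))
  (rhoM : forall g h, rho (g * h)%g = rho g \o rho h) (rho1 : rho 1%g = id).

Lemma form_actD q (b c : qfield N q) g : form_act rho (b + c) g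
  = form_act rho b g + form_act rho c g.
Proof. by []. Qed.

Lemma form_actM q (b : qfield N q) g h : form_act rho (form_act rho b g) h
  = form_act rho b (g * h)%g.
Proof. by rewrite /form_act rhoM pullback_comp. Qed.

Lemma form_act1 q (b : qfield N q) : form_act rho b 1%g = b.
Proof. by rewrite /form_act rho1 pullback_id. Qed.

Lemma qfieldV2 q (v : qfield N q) : v + v = 0 -> v = 0.
Proof.
move=> vv; apply/funext => x; apply/funext => A; apply: realV2.
exact: (congr1 (fun w : qfield N q => w x A) vv).
Qed.

Lemma delta1_delta1 s q (c : ('I_s -> G) -> qfield N q) : delta1 rho (delta1 rho c) = 0.
Proof.
apply: cobd_cobd => [b c' g|b g h|b|v]; [exact: form_actD|exact: form_actM|exact: form_act1|].
exact: qfieldV2.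
Qed.

Lemma is_form_delta1 s q (c : ('I_s -> G) -> qfield N q) g :
  (forall g, is_form (c g)) -> is_form (delta1 rho c g).
Proof.
move=> fc; rewrite /delta1 /cobd; apply: is_formD.
  apply: is_formD => //; apply: is_form_sum => i; exact: is_form_sign.
by apply: is_form_sign; exact: is_form_pullback.
Qed.

Lemma extd_delta1 s q (c : ('I_s -> G) -> qfield N q) g :
  (forall g, is_form (c g)) -> extd (delta1 rho c g) = delta1 rho (fun g => extd (c g)) g.
Proof.
move=> fc; rewrite /delta1 /cobd.
have fs i : is_form (c (contract i g) *~ (-1) ^+ i.+1) by exact: is_form_sign.
have fl : is_form (form_act rho (c (fun j => g (widen_ord (leqnSn s) j))) (g ord_max)).
  exact: is_form_pullback.
have fS := is_form_sum fs; have f0 := fc (fun j => g (lift ord0 j)).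
have E1 : extd (\sum_i (c (contract i g) *~ (-1) ^+ i.+1)) =
    \sum_i (extd (c (contract i g)) *~ (-1) ^+ i.+1).
  by rewrite (extd_sum fs); apply: eq_bigr => i _; exact: (extd_sign i.+1 (fc _)).
have E2 := extd_sign s.+1 fl.
have E3 := extd_pullback (rhoS (g ord_max)) (fc (fun j => g (widen_ord (leqnSn s) j))).
rewrite /form_act E3 in E2.
by rewrite (extdD (is_formD f0 fS) (is_form_sign s.+1 fl)) (extdD f0 fS) E1 E2.
Qed.

Lemma mulrz_signK (V : zmodType) (v : V) k : v *~ (-1) ^+ k *~ (-1) ^+ k = v.
Proof. by rewrite !sign_mulrz; case: odd; rewrite ?opprK. Qed.

Section Zigzag.
Context {p : nat} (w : qfield N p.+1).
Hypothesis w_inv : forall g, form_act rho w g = w.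

Section OneZigzag.
Context (phi : forall i j : nat, ('I_i -> G) -> qfield N j).
Arguments phi : clear implicits.
Hypothesis Z : zigzag rho w phi.

Lemma zigzag_extd i j g : (i + j.+1)%N = p ->
  extd (phi i.+1 j g) = delta1 rho (phi i j.+1) g *~ (-1) ^+ i.
Proof.
move=> ij; have /(congr1 (fun c => c g)) := zigzag_step Z ij.
rewrite -[X in X = _]/(delta1 rho (phi i j.+1) g + extd (phi i.+1 j g) *~ (-1) ^+ i.+1).
rewrite exprS mulN1r mulrNz => /eqP; rewrite subr_eq0 => /eqP ->.
by rewrite mulrz_signK.
Qed.

(** d commutes with [delta1], and d of the component is, up to sign, [delta1] of the preceding one,
    so [delta1_delta1] applies. For i = 0 it is the constant cochain -w, killed by invariance. *)
Lemma zigzag_delta1_closed i j g : (i + j)%N = p -> extd (delta1 rho (phi i j) g) = 0.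
Proof.
move=> ij; rewrite extd_delta1; last by move=> h; exact: (zigzag_form Z).
case: i j ij g => [|i] j ij g.
  have {ij} -> : j = p by rewrite -ij.
  rewrite (_ : (fun g => _) = fun=> - w); last first.
    by apply/funext => h; rewrite (zigzag_start Z h) opprK.
  rewrite /delta1 /cobd big_ord0 addr0 expr1 mulrN1z.
  by rewrite -[form_act _ _ _]/(- form_act rho w (g ord_max)) w_inv opprK addNr.
rewrite (_ : (fun g => _) = fun g => delta1 rho (phi i j.+1) g *~ (-1) ^+ i); last first.
  by apply/funext => h; rewrite zigzag_extd // addnS -addSn.
rewrite /delta1 (cobd_signz (@form_actD j.+1)) -/(delta1 rho _) delta1_delta1.
by rewrite sign_mulrz oppr0; case: odd.
Qed.

End OneZigzag.

Hypothesis HN : forall k, (1 <= k <= p)%N -> deRham_trivial N k.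

Lemma zigzag_step_exists i j (c : ('I_i -> G) -> qfield N j.+1) : (j.+1 <= p)%N ->
  (forall g, is_form (c g)) -> (forall g, extd (delta1 rho c g) = 0) ->
  exists c' : ('I_i.+1 -> G) -> qfield N j,
    (forall g, is_form (c' g)) /\ delta1 rho c + delta2 c' = 0.
Proof.
move=> jp fc dc.
have ex g : exists h : qfield N j, is_form h /\ delta1 rho c g = extd h.
  have [|h fh E] := HN _ (is_form_delta1 g fc) (dc g); first by rewrite jp.
  by exists h.
have [h hP] := choice ex.
(* The sign of [delta2] in degree i + 1 meets the same sign here and disappears. *)
exists (fun g => - (h g *~ (-1) ^+ i.+1)); split=> [g|].
  by apply/is_formN/is_form_sign; have [] := hP g.
apply/funext => g; have [fh E] := hP g.
rewrite -[LHS]/(delta1 rho c g + extd (- (h g *~ (-1) ^+ i.+1)) *~ (-1) ^+ i.+1).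
rewrite (extdN (is_form_sign _ fh)) (extd_sign _ fh) -E mulNrz mulrz_signK.
exact: addrN.
Qed.

(** A total choice with junk value 0, so that the recursion can be written down before closedness is
    established. *)
Definition zigzag_next i j (c : ('I_i -> G) -> qfield N j.+1) :
    ('I_i.+1 -> G) -> qfield N j :=
  if pselect (exists c' : ('I_i.+1 -> G) -> qfield N j,
      (forall g, is_form (c' g)) /\ delta1 rho c + delta2 c' = 0) is left e
  then projT1 (cid e) else 0.

Lemma zigzag_nextP i j (c : ('I_i -> G) -> qfield N j.+1) : (i + j.+1)%N = p ->
  (forall g, is_form (c g)) -> (forall g, extd (delta1 rho c g) = 0) ->
  (forall g, is_form (zigzag_next c g)) /\ delta1 rho c + delta2 (zigzag_next c) = 0.
Proof.
move=> ij fc dc; rewrite /zigzag_next; case: pselect => [e|[]]; first exact: projT2 (cid e).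
by apply: zigzag_step_exists => //; rewrite -ij leq_addl.
Qed.

(** Lowering i raises j, so component (i, j) starts from form degree i + j; it is meaningful when
    this equals p. *)
Fixpoint zigzag_of (b : qfield N p) i j : ('I_i -> G) -> qfield N j :=
  if i is i'.+1 then zigzag_next (@zigzag_of b i' j.+1)
  else fun _ => form_at b j.

Arguments zigzag_of : clear implicits.

Lemma zigzag_of0 b g : zigzag_of b 0 p g = b.
Proof. exact: form_at_id. Qed.

Lemma zigzag_ofP (b : qfield N p) : is_form b -> w = - extd b ->
  forall i j, (i + j)%N = p ->
  (forall g, is_form (zigzag_of b i j g)) /\
  (forall g, extd (delta1 rho (zigzag_of b i j) g) = 0).
Proof.
move=> fb wb; elim=> [|i IH] j ij.
  have {ij} -> : j = p by rewrite -ij.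
  split=> g; first by rewrite zigzag_of0.
  rewrite extd_delta1; last by move=> h; rewrite zigzag_of0.
  rewrite (_ : (fun g => _) = fun=> - w); last first.
    by apply/funext => h; rewrite zigzag_of0 wb opprK.
  rewrite /delta1 /cobd big_ord0 addr0 expr1 mulrN1z.
  by rewrite -[form_act _ _ _]/(- form_act rho w (g ord_max)) w_inv opprK addNr.
have ij' : (i + j.+1)%N = p by rewrite addnS.
have [fc dc] := IH _ ij'; have [fn En] := zigzag_nextP ij' fc dc.
split=> // g; rewrite extd_delta1 //.
rewrite (_ : (fun g => _) = fun g => delta1 rho (zigzag_of b i j.+1) g *~ (-1) ^+ i).
  rewrite /delta1 (cobd_signz (@form_actD j.+1)) -/(delta1 rho _) delta1_delta1.
  by rewrite sign_mulrz oppr0; case: odd.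
apply/funext => h; have := congr1 (fun c => c h) En.
rewrite -[X in X = _]/(delta1 rho (zigzag_of b i j.+1) h
  + extd (zigzag_of b i.+1 j h) *~ (-1) ^+ i.+1).
rewrite exprS mulN1r mulrNz => /eqP; rewrite subr_eq0 => /eqP ->.
by rewrite mulrz_signK.
Qed.

Lemma zigzag_exists : exact_form w ->
  exists phi : forall i j : nat, ('I_i -> G) -> qfield N j, zigzag rho w phi.
Proof.
move=> [h fh wh]; pose b := - h.
have fb : is_form b by exact: is_formN.
have wb : w = - extd b by rewrite /b (extdN fh) opprK.
exists (zigzag_of b); split.
- by move=> i j g ij; exact: (zigzag_ofP fb wb ij).1.
- by move=> g; rewrite zigzag_of0.
- move=> i j ij; have [fc dc] := zigzag_ofP fb wb ij.
  exact: (zigzag_nextP ij fc dc).2.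
Qed.

Section ClosedFunctions.
Hypothesis const0 :
  forall (f : qfield N 0) y z, is_form f -> extd f = 0 -> f y 0 = f z 0.

(** Only the last term differs: it is evaluated at the moved point, where a closed function has the
    same value as at x. *)
Lemma ev_cobd s (x : N) (c : ('I_s -> G) -> qfield N 0) :
  (forall g, is_form (c g)) -> (forall g, extd (c g) = 0) ->
  cobd trivial_act (fun g => c g x 0) = fun g => delta1 rho c g x 0.
Proof.
move=> fc dc; apply/funext => g; rewrite /delta1 /cobd.
have evD (b b' : qfield N 0) : (b + b') x 0 = b x 0 + b' x 0 by [].
have evS (b : qfield N 0) k : (b *~ (-1) ^+ k) x 0 = b x 0 *~ (-1) ^+ k.
  by rewrite !sign_mulrz; case: odd.
rewrite !evD evS; congr (_ + _ + _ *~ _).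
  elim/big_rec2: _ => // i u v _ E.
  by rewrite evD evS E.
rewrite /trivial_act /form_act /pullback mul0mx.
exact: const0.
Qed.

Lemma point_cocycle_cocycle (x : N) (phi : forall i j : nat, ('I_i -> G) -> qfield N j) :
  zigzag rho w phi -> cobd trivial_act (point_cocycle (p := p) rho phi x) = 0.
Proof.
move=> Z; rewrite /point_cocycle ev_cobd => [|g|g].
- by rewrite delta1_delta1.
- by apply: is_form_delta1 => h; apply: (zigzag_form Z); rewrite addn0.
- by apply: (zigzag_delta1_closed Z); rewrite addn0.
Qed.

(* The difference of two zigzags is corrected by [delta1]-coboundaries until, in
   form degree 0, it becomes a cochain [r] of closed functions, i.e. of constants. *)
Lemma zigzag_compare (x : N) (phi phi' : forall i j : nat, ('I_i -> G) -> qfield N j) :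
  zigzag rho w phi -> zigzag rho w phi' ->
  exists b : ('I_p -> G) -> R, forall g,
    point_cocycle rho phi x g - point_cocycle rho phi' x g = cobd trivial_act b g.
Proof.
move=> Z Z'.
have key i j : (i + j)%N = p -> exists r : ('I_i -> G) -> qfield N j,
    [/\ forall g, is_form (r g), forall g, extd (r g) = 0 &
     forall g, delta1 rho r g = delta1 rho (@phi i j) g - delta1 rho (@phi' i j) g].
  elim: i j => [|i IH] j ij.
    have {ij} -> : j = p by rewrite -ij.
    have f1 g : is_form (@phi 0 p g) by exact: (zigzag_form Z).
    have f2 g : is_form (@phi' 0 p g) by exact: (zigzag_form Z').
    exists (fun g => @phi 0 p g + - @phi' 0 p g); split=> g.
    - by apply: is_formD => //; exact: is_formN.
    - rewrite (extdD (f1 g) (is_formN (f2 g))) (extdN (f2 g)).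
      by rewrite -(zigzag_start Z' g) {1}(zigzag_start Z g) addrN.
    - by rewrite /delta1 (cobdD (@form_actD p)) (cobdN (@form_actD p)).
  have ij' : (i + j.+1)%N = p by rewrite addnS.
  have [r [fr dr Er]] := IH _ ij'.
  have ex g : exists h : qfield N j, is_form h /\ r g = extd h.
    have [|h fh E] := HN _ (fr g) (dr g); first by rewrite -ij' leq_addl.
    by exists h.
  have [h hP] := choice ex.
  have fh g : is_form (h g) by have [] := hP g.
  have f1 g : is_form (@phi i.+1 j g) by exact: (zigzag_form Z).
  have f2 g : is_form (@phi' i.+1 j g) by exact: (zigzag_form Z').
  have fdh g : is_form (delta1 rho h g) by exact: is_form_delta1.
  (* The derivative of the difference is (-1)^i [delta1 r], and r = dh; the correction removes it
     without changing [delta1], since [delta1] squares to zero. *)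
  exists (fun g => (@phi i.+1 j g + - @phi' i.+1 j g) + - (delta1 rho h g *~ (-1) ^+ i)).
  split=> g.
  - by apply: is_formD; [apply: is_formD => //; exact: is_formN|apply/is_formN/is_form_sign].
  - rewrite (extdD (is_formD (f1 g) (is_formN (f2 g))) (is_formN (is_form_sign i (fdh g)))).
    rewrite (extdD (f1 g) (is_formN (f2 g))) (extdN (f2 g)).
    rewrite (extdN (is_form_sign i (fdh g))) (extd_sign i (fdh g)) (extd_delta1 g fh).
    rewrite (_ : (fun g => extd (h g)) = r); last by apply/funext => g'; have [] := hP g'.
    by rewrite (zigzag_extd Z g ij') (zigzag_extd Z' g ij') Er mulrzBl addrN.
  - rewrite /delta1 (cobdD (@form_actD j)) (cobdD (@form_actD j)) !(cobdN (@form_actD j)).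
    by rewrite (cobd_signz (@form_actD j)) -!/(delta1 rho _) delta1_delta1 sign_mulrz oppr0
      if_same subr0.
have [r [fr dr Er]] := key p 0%N (addn0 p).
exists (fun g => r g x 0) => g; rewrite (ev_cobd x fr dr) Er.
by [].
Qed.

End ClosedFunctions.

End Zigzag.

End DoubleComplex.

(** * Coboundaries on commuting elements *)

Section Antisymmetrization.
Context {R : realType} {G : groupType} {p : nat}.

Lemma contract_tperm (g : 'I_p.+1 -> G) (i : 'I_p) (s : 'S_p.+1) :
  (forall k l, commute (g k) (g l)) ->
  contract i (g \o (tperm (widen_ord (leqnSn p) i) (lift ord0 i) * s)%g) = contract i (g \o s).
Proof.
move=> gC; apply/funext => k; rewrite /contract /= !permM.
case: ltngtP => ki.
- by rewrite tpermD // -val_eqE /= ?/bump ?leq0n; lia.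
- have -> : (k == i) = false by apply/negbTE/eqP => e; rewrite e ltnn in ki.
  by rewrite tpermD // -val_eqE /= ?/bump ?leq0n; lia.
- have -> : k = i by exact: val_inj.
  by rewrite eqxx tpermL tpermR; exact: gC.
Qed.

(* Exchanging two neighbours does not change their product, so the inner terms
   cancel in pairs; the two outer terms differ by a cyclic permutation. *)
Lemma antisym_cobd (b : ('I_p -> G) -> R) (g : 'I_p.+1 -> G) :
  (forall k l, commute (g k) (g l)) ->
  \sum_(s : 'S_p.+1) (-1) ^+ s * cobd trivial_act b (g \o s) = 0.
Proof.
move=> gC; rewrite /cobd /trivial_act.
under eq_bigr => s _ do rewrite !mulrDr mulr_sumr.
rewrite !big_split /= exchange_big /= [X in _ + X + _]big1 ?addr0; last first.
  move=> i _; set S := \sum_(s | _) _; apply: realV2.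
  pose t := tperm (widen_ord (leqnSn p) i) (lift ord0 i).
  rewrite {2}/S (reindex_inj (mulgI t)) /= -big_split big1 //= => s _.
  rewrite contract_tperm // odd_permM odd_tperm signr_addb.
  have -> : (widen_ord (leqnSn p) i != lift ord0 i) by rewrite -val_eqE /= /bump leq0n; lia.
  by rewrite expr1 mulN1r mulNr addrN.
(* The cycle carrying the first p positions to the last p has sign (-1)^p and turns the last outer
   term into minus the first. *)
pose c : 'S_p.+1 := lift_perm ord_max ord0 1.
rewrite [X in _ + X](reindex_inj (mulgI c)) /= -big_split big1 //= => s _.
have -> : (fun j => g ((c * s)%g (widen_ord (leqnSn p) j))) = (fun j => g (s (lift ord0 j))).
  apply/funext => k; rewrite permM; congr (g (s _)).
  have -> : widen_ord (leqnSn p) k = lift ord_max k.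
    by apply/val_inj; rewrite /= /bump; have := ltn_ord k; lia.
  by rewrite lift_perm_lift perm1.
rewrite odd_permM odd_lift_perm /= odd_perm1 addbF addbC /= signr_addb mulrz_sign.
rewrite addbF signr_odd exprS mulN1r mulNr mulrN -(mulrA ((-1) ^+ s)) (mulrA ((-1) ^+ p)).
by rewrite -expr2 sqrr_sign mul1r addrN.
Qed.

End Antisymmetrization.

(** * Multiadditive cochains on the translation group *)

Section TranslationGroup.
Context {R : realType} {n : nat}.

(** A copy of the row vectors whose multiplicative group law, as cochains require it, is
    addition. *)
Definition transl : Type := 'rV[R]_n.
HB.instance Definition _ := Choice.on transl.
HB.instance Definition _ := isGroup.Build transl
  (@addrA 'rV[R]_n) (@add0r 'rV[R]_n) (@addr0 'rV[R]_n) (@addNr 'rV[R]_n) (@addrN 'rV[R]_n).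

Definition multiadditive s (f : ('I_s -> transl) -> R) :=
  forall (k : 'I_s) (h h1 h2 : 'I_s -> 'rV[R]_n), h k = h1 k + h2 k ->
    (forall l, l != k -> h1 l = h l /\ h2 l = h l) -> f h = f h1 + f h2.

(** Additivity splits the i-th contracted term into a difference of two terms [V], each omitting one
    argument. The sum telescopes and cancels the two outer terms. *)
Lemma cobd_multiadditive s (f : ('I_s -> transl) -> R) :
  multiadditive f -> cobd trivial_act f = 0.
Proof.
move=> fA; apply/funext => g; rewrite /cobd /trivial_act.
pose V k := f (fun j => g (lift (inord k) j)) *~ (-1) ^+ k.
have E (i : 'I_s) : f (contract i g) *~ (-1) ^+ i.+1 = V i.+1 - V i.
  rewrite /V exprS mulN1r !mulrNz -opprD -mulrzDl; congr (- (_ *~ _)).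
  apply: (fA i) => [|l li].
    rewrite /contract ltnn eqxx; congr (_ + _); congr (g _); apply/val_inj => /=;
      rewrite inordK /bump //; have := ltn_ord i; lia.
  have lb := ltn_ord l; have ib := ltn_ord i.
  have lN : (l != i :> nat) by rewrite val_eqE.
  by split; rewrite /contract (negbTE li); case: ltnP => ki; congr (g _); apply/val_inj;
    rewrite /= inordK /bump; lia.
under eq_bigr => i _ do rewrite E.
rewrite -(big_mkord xpredT (fun i => V i.+1 - V i)) telescope_sumr //.
rewrite /V expr0 mulr1z exprS mulN1r mulrNz.
have -> : (fun j : 'I_s => g (lift (inord 0) j)) = (fun j => g (lift ord0 j)).
  by apply/funext => j; congr (g _); apply/val_inj; rewrite /= inordK.
have -> : (fun j : 'I_s => g (lift (inord s) j)) = (fun j => g (widen_ord (leqnSn s) j)).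
  by apply/funext => j; congr (g _); apply/val_inj; rewrite /= inordK // /bump;
    have := ltn_ord j; lia.
by rewrite addrCA subrr addr0 addrN.
Qed.

End TranslationGroup.

(** * Constant and linear coefficients *)

Section ConstantCoefficients.
Context {R : realType} {n : nat}.

Lemma derive_linear_fun (f : 'rV[R]_n -> R) u v : linear (f : _ -> R^o) ->
  (forall k, Ck k setT f) /\ 'D_v f u = f v.
Proof.
move=> lf; pose Lm := GRing.isLinear.Build _ _ _ _ _ lf.
pose L : {linear 'rV[R]_n -> R^o} := HB.pack (f : _ -> R^o) Lm.
have oT : open [set: 'rV[R]_n] by exact: openT.
split=> [k|]; first exact: (Ck_linear k L oT).
have cL : continuous L by exact: rV_linear_continuous.
rewrite -[LHS]/('D_v L u) deriveE; last exact: linear_differentiable.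
by rewrite diff_lin.
Qed.

Lemma jacobian_id (u : 'rV[R]_n) : jacobian id u = 1%:M.
Proof. by apply/row_matrixP => i; rewrite !rowE derive_jacobian // derive_id mulmx1. Qed.

Lemma local_expr_euclid q (w : qfield (euclid (R := R) n) q) (x u : euclid (R := R) n) A :
  local_expr w x u A = w u A.
Proof. by rewrite /local_expr /= (jacobian_id u) mulmx1. Qed.

Lemma is_form_const q (w : 'M[R]_(q, n) -> R) :
  multilinear_rows w -> alternating_rows w -> is_form (const_form w).
Proof.
move=> mw aw; split=> [//|x A]; rewrite (_ : (fun u => _) = cst (w A)).
  by move=> k; exact: Ck_cst.
by apply/funext => u; rewrite local_expr_euclid.
Qed.

Lemma extd_const q (w : 'M[R]_(q, n) -> R) : extd (const_form w) = 0.
Proof.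
apply/funext => u; apply/funext => A; rewrite /extd big1 // => i _.
rewrite (_ : (fun u => _) = cst (w (row' i A))); last first.
  by apply/funext => v; rewrite local_expr_euclid.
by rewrite derive_cst mulr0.
Qed.

Lemma tangent_shift (c u : 'rV[R]_n) :
  tangent ((fun v => v + c) : euclid (R := R) n -> euclid (R := R) n) u = 1%:M.
Proof.
rewrite /tangent; apply/row_matrixP => i; rewrite !rowE.
have di : differentiable (@id 'rV[R]_n) (u + c) by exact: ex_diff.
have [ds Ds] := differentiable_shift di.
by rewrite (derive_jacobian (F := fun v => v + c)) // Ds derive_id mulmx1.
Qed.

(* Contraction of F with the radial field [u], a primitive of F up to the factor q + 1. *)
Definition euler_contract {q} (F : 'M[R]_(q.+1, n) -> R) : qfield (euclid (R := R) n) q :=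
  fun u A => F (col_mx (u : 'rV[R]_n) A : 'M[R]_(1 + q, n)).

Section EulerContraction.
Context {q : nat} (F : 'M[R]_(q.+1, n) -> R).
Hypotheses (mF : multilinear_rows F) (aF : alternating_rows F).

Lemma is_form_euler_contract : is_form (euler_contract F).
Proof.
split=> [u|x A k].
  split; first exact: multilinear_dsub.
  move=> A i j ij Aij; apply: (aF (i := lift ord0 i) (j := lift ord0 j)).
    by rewrite (inj_eq lift_inj).
  by rewrite !rowS_col_mx.
have -> : (fun u => local_expr (euler_contract F) x u A)
  = (fun u => F (col_mx u A : 'M[R]_(1 + q, n))).
  by apply/funext => u; rewrite local_expr_euclid.
exact: (derive_linear_fun 0 0 (multilinear_col_mx A mF)).1.
Qed.

(** Each of the q + 1 summands returns the inserted row to its place; the sign of this move cancels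
    the sign in [extd]. *)
Lemma extd_euler_contract : extd (euler_contract F) = fun _ A => q.+1%:R * F A.
Proof.
apply/funext => u; apply/funext => A; rewrite /extd.
transitivity (\sum_(i < q.+1) F A); last by rewrite sumr_const card_ord [RHS]mulr_natl.
apply: eq_bigr => i _.
have -> : (fun v => local_expr (euler_contract F) u v (row' i A)) =
    (fun v => F (col_mx v (row' i A) : 'M[R]_(1 + q, n))).
  by apply/funext => v; rewrite local_expr_euclid.
rewrite (derive_linear_fun _ _ (multilinear_col_mx _ mF)).2.
by rewrite -alternating_front // setrow_id.
Qed.

End EulerContraction.
End ConstantCoefficients.

Section MixedForms.
Context {R : realType} {n p : nat} (w0 : 'M[R]_(p.+1, n) -> R).
Hypotheses (mw : multilinear_rows w0) (aw : alternating_rows w0).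

(** Indexing rows by natural numbers lets group elements and tangent vectors be concatenated without
    casts between i + q and p + 1. *)
Definition on_rows (s : nat -> 'rV[R]_n) : R := w0 (\matrix_(k < p.+1, l < n) s k 0 l).

Lemma on_rows_eq s s' : (forall k, (k < p.+1)%N -> s k = s' k) -> on_rows s = on_rows s'.
Proof. by move=> E; congr w0; apply/matrixP => k l; rewrite !mxE E. Qed.

Lemma on_rows_linear s s1 s2 c k : (k < p.+1)%N -> s k = c *: s1 k + s2 k ->
  (forall l, (l < p.+1)%N -> l != k -> s1 l = s l /\ s2 l = s l) ->
  on_rows s = c * on_rows s1 + on_rows s2.
Proof.
move=> kp sk E; rewrite /on_rows -[X in _ + X]mul1r; apply: (mw (i := Ordinal kp)).
- by apply/rowP => l; rewrite !mxE sk !mxE mul1r.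
- apply/matrixP => i l; rewrite !mxE (E _ _ _).1 //.
  by have := neq_lift (Ordinal kp) i; rewrite eq_sym -val_eqE.
- apply/matrixP => i l; rewrite !mxE (E _ _ _).2 //.
  by have := neq_lift (Ordinal kp) i; rewrite eq_sym -val_eqE.
Qed.

Lemma on_rows_alternating s k l : (k < p.+1)%N -> (l < p.+1)%N -> k != l -> s k = s l ->
  on_rows s = 0.
Proof.
move=> kp lp kl skl; apply: (aw (i := Ordinal kp) (j := Ordinal lp)) => //.
by apply/rowP => m; rewrite !mxE /= skl.
Qed.

Definition pad0 {q} (h : 'I_q -> 'rV[R]_n) (k : nat) : 'rV[R]_n := oapp h 0 (insub k).

Lemma pad0E q (h : 'I_q -> 'rV[R]_n) (k : 'I_q) : pad0 h k = h k.
Proof. by rewrite /pad0 valK. Qed.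

(* w0 (g_1, ..., g_i, B_1, ..., B_q) *)
Definition mixed_form {i q} (g : 'I_i -> 'rV[R]_n) (B : 'M[R]_(q, n)) : R :=
  on_rows (fun k => if (k < i)%N then pad0 g k else pad0 (fun l => row l B) (k - i)).

Lemma mixed_form_multilinear i q (g : 'I_i -> 'rV[R]_n) : (i + q)%N = p.+1 ->
  multilinear_rows (@mixed_form i q g).
Proof.
move=> iq; apply/multilinearP => k A c u v.
have kq := ltn_ord k; have ik : (i + k < i)%N = false by lia.
apply: (on_rows_linear (k := i + k)); first by lia.
  by rewrite ik addKn !pad0E !row_setrow.
move=> l lp lk; case: ltnP => // li.
have lq : (l - i < q)%N by lia.
rewrite -[(l - i)%N]/(nat_of_ord (Ordinal lq)) !pad0E !row_setrow_neq //;
  by rewrite -val_eqE /=; lia.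
Qed.

Lemma mixed_form_alternating i q (g : 'I_i -> 'rV[R]_n) : (i + q)%N = p.+1 ->
  alternating_rows (@mixed_form i q g).
Proof.
move=> iq A k l kl Akl; have kq := ltn_ord k; have lq := ltn_ord l.
apply: (@on_rows_alternating _ (i + k) (i + l)); [lia|lia|by rewrite eqn_add2l val_eqE|].
have -> : (i + k < i)%N = false by lia.
have -> : (i + l < i)%N = false by lia.
by rewrite !addKn !pad0E.
Qed.

Lemma mixed_form_multiadditive i q (B : 'M[R]_(q, n)) : (i <= p.+1)%N ->
  multiadditive (fun g : 'I_i -> transl (R := R) (n := n) => mixed_form g B).
Proof.
move=> ip k h h1 h2 hk E; have ki := ltn_ord k.
rewrite -[mixed_form h1 B]mul1r; apply: (on_rows_linear (k := k)); first by lia.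
  by rewrite ki !pad0E scale1r.
move=> l lp lk; case: ltnP => // li.
rewrite -[l]/(nat_of_ord (Ordinal li)) !pad0E; apply: E.
by rewrite -val_eqE.
Qed.

(** The last group element may be read as the first tangent vector; this identifies what [delta1]
    leaves of one component with the form needed for the next. *)
Lemma mixed_form_shift i q (g : 'I_i.+1 -> 'rV[R]_n) (A : 'M[R]_(q, n)) :
  mixed_form (fun k => g (widen_ord (leqnSn i) k)) (col_mx (g ord_max) A : 'M[R]_(1 + q, n))
    = mixed_form g A.
Proof.
apply: on_rows_eq => k kp; case: ltngtP => ki.
- rewrite ltnS (ltnW ki) -[k in LHS]/(nat_of_ord (Ordinal ki)) pad0E.
  have ki' : (k < i.+1)%N by lia.
  by rewrite -[k]/(nat_of_ord (Ordinal ki')) pad0E; congr g; exact: val_inj.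
- rewrite ltnNge ki /=.
  have -> : (k - i)%N = (k - i.+1).+1 by lia.
  rewrite /pad0; case: insubP => [l lq lE|].
    case: insubP => [m mq mE|]; last by move=> /negP[]; rewrite -ltnS.
    rewrite /= -(rowS_col_mx (g ord_max) A); congr (row _ _); apply/val_inj.
    by rewrite lE /= mE.
  by case: insubP => //= l lq lE; rewrite -[(_ < 1 + q)%N]/(_ < q.+1)%N ltnS lq.
- rewrite ki ltnSn subnn -[0%N]/(nat_of_ord (ord0 : 'I_(1 + q))) pad0E row0_col_mx.
  by rewrite -[i]/(nat_of_ord (ord_max : 'I_i.+1)) pad0E.
Qed.

Lemma mixed_form0 (g : 'I_0 -> 'rV[R]_n) (B : 'M[R]_(p.+1, n)) : mixed_form g B = w0 B.
Proof.
rewrite /mixed_form /on_rows; congr w0; apply/matrixP => k l; rewrite mxE /= subn0 pad0E mxE.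
by [].
Qed.

Lemma mixed_form_full (g : 'I_p.+1 -> 'rV[R]_n) (B : 'M[R]_(0, n)) :
  mixed_form g B = w0 (\matrix_(k, l) g k 0 l).
Proof. by congr w0; apply/matrixP => k l; rewrite !mxE ltn_ord pad0E. Qed.

Lemma w0_perm (g : 'I_p.+1 -> 'rV[R]_n) (s : 'S_p.+1) :
  w0 (\matrix_(k, l) (g \o s) k 0 l) = (-1) ^+ s * w0 (\matrix_(k, l) g k 0 l).
Proof.
rewrite -(alternating_row_perm mw aw); congr w0.
by apply/matrixP => k l; rewrite !mxE.
Qed.

End MixedForms.

(** * The translation cocycle *)

Section Restriction.
Context {G T : groupType} (iota : T -> G).
Hypothesis iotaM : forall s t, iota (s * t)%g = (iota s * iota t)%g.

Lemma contract_hom s (i : 'I_s) (g : 'I_s.+1 -> T) :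
  contract i (iota \o g) = iota \o contract i g.
Proof.
apply/funext => j; rewrite /contract /=; case: ifP => // _.
by case: ifP.
Qed.

Lemma cobd_hom (A : zmodType) (act : A -> G -> A) s (f : ('I_s -> G) -> A) (g : 'I_s.+1 -> T) :
  cobd act f (iota \o g) = cobd (fun a t => act a (iota t)) (fun h => f (iota \o h)) g.
Proof.
rewrite /cobd; congr (_ + _ + _).
by apply: eq_bigr => i _; rewrite contract_hom.
Qed.

Lemma zigzag_hom (R : realType) (N : manifold R) (rho : G -> N -> N) p (w : qfield N p.+1)
    (phi : forall i j : nat, ('I_i -> G) -> qfield N j) :
  zigzag rho w phi ->
  zigzag (fun t => rho (iota t)) w (fun i j g => @phi i j (iota \o g)).
Proof.
move=> Z; split.
- by move=> i j g ij; exact: (zigzag_form Z).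
- by move=> g; exact: (zigzag_start Z).
- move=> i j ij; apply/funext => g.
  have := congr1 (fun c => c (iota \o g)) (zigzag_step Z ij).
  rewrite -[X in X = _ -> _]/(delta1 rho (@phi i j.+1) (iota \o g) + delta2 (@phi i.+1 j)
    (iota \o g)).
  by rewrite /delta1 cobd_hom.
Qed.

End Restriction.

Section CobdPointwise.
Context {R : realType} {N : manifold R} {G : groupType} (rho : G -> N -> N).

Lemma delta1E s q (c : ('I_s -> G) -> qfield N q) g x A :
  delta1 rho c g x A = c (fun k => g (lift ord0 k)) x A
    + \sum_(k < s) c (contract k g) x A *~ (-1) ^+ k.+1
    + c (fun k => g (widen_ord (leqnSn s) k)) (rho (g ord_max) x)
        (A *m tangent (rho (g ord_max)) x) *~ (-1) ^+ s.+1.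
Proof.
have evS (b : qfield N q) k : (b *~ (-1) ^+ k) x A = b x A *~ (-1) ^+ k.
  by rewrite !sign_mulrz; case: odd.
have evSum (F : 'I_s -> qfield N q) : (\sum_k F k) x A = \sum_k F k x A.
  by elim/big_rec2: _ => // k u v _ <-.
pose ct k := c (contract k g) *~ (-1) ^+ k.+1.
have ES : (\sum_k ct k) x A = \sum_k c (contract k g) x A *~ (-1) ^+ k.+1.
  exact: etrans (evSum ct) (eq_bigr _ (fun k _ => evS _ _)).
exact (f_equal2 (fun a b => c (fun k => g (lift ord0 k)) x A + a + b) ES
  (evS (form_act rho (c (fun k => g (widen_ord (leqnSn s) k))) (g ord_max)) s.+1)).
Qed.

Lemma delta1_lincomb s q a (c c' : ('I_s -> G) -> qfield N q) g x A :
  delta1 rho (fun h => lincomb a (c h) (c' h)) g x A =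
  a * delta1 rho c g x A + delta1 rho c' g x A.
Proof.
rewrite !delta1E /lincomb !mulrDr mulrzDl mulr_sumr.
have -> : forall f f' : 'I_s -> R, \sum_k (a * f k + f' k) *~ (-1) ^+ k.+1 =
    \sum_k a * (f k *~ (-1) ^+ k.+1) + \sum_k f' k *~ (-1) ^+ k.+1.
  by move=> f f'; rewrite -big_split; apply: eq_bigr => k _; rewrite mulrzDl mulrzAr.
rewrite -mulrzAr; set u1 := c _ x A; set u2 := c' _ x A.
rewrite [X in X + _ = _]addrACA [LHS]addrACA; congr (_ + _).
Qed.

End CobdPointwise.

(** * The explicit zigzag over translations *)

Section ExplicitZigzag.
Context {R : realType} {n p : nat} {M : manifold R}.
Let E := euclid (R := R) n.
Let N := prod_manifold E M.
Variables (w0 : 'M[R]_(p.+1, n) -> R) (hM : qfield M p).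
Hypotheses (mw : multilinear_rows w0) (aw : alternating_rows w0) (fh : is_form hM).

Let pr1 : N -> E := fst.
Let pr2 : N -> M := snd.
Let s1 : smooth_map pr1. Proof. exact: smooth_fst. Qed.
Let s2 : smooth_map pr2. Proof. exact: smooth_snd. Qed.

Let w : qfield N p.+1 :=
  pullback (fst : N -> E) (const_form w0) + pullback (snd : N -> M) (extd hM).

Definition shift_euclid (c : 'rV[R]_n) : E -> E := fun v => (v : 'rV[R]_n) + c.

Lemma smooth_shift_euclid c : smooth_map (shift_euclid c).
Proof.
apply: smooth_euclid => k; apply: Ck_add; [exact: openT|exact: Ck_id|exact: Ck_cst].
Qed.

Definition shift_prod (c : transl (R := R) (n := n)) : N -> N := fun x => (shift_euclid c x.1, x.2).

Lemma smooth_shift_prod c : smooth_map (shift_prod c).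
Proof. exact: (smooth_pair (smooth_comp s1 (smooth_shift_euclid c)) s2). Qed.

Lemma shift_prodM c d : shift_prod (c * d)%g = shift_prod c \o shift_prod d.
Proof.
apply/funext => x; rewrite /shift_prod /shift_euclid /=; congr (_, _).
by rewrite -addrA; congr (_ + _); exact: addrC.
Qed.

Lemma shift_prod1 : shift_prod 1%g = id.
Proof. by apply/funext => -[x y]; rewrite /shift_prod /shift_euclid /= addr0. Qed.

Lemma tangent_shift_prod c x :
  tangent (shift_prod c) x *m tangent pr1 (shift_prod c x) = tangent pr1 x.
Proof.
rewrite -(tangent_comp _ (smooth_shift_prod c) s1).
rewrite -[pr1 \o shift_prod c]/(shift_euclid c \o pr1) (tangent_comp _ s1 (smooth_shift_euclid c)).
by rewrite tangent_shift mulmx1.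
Qed.

Lemma pullback_shift_snd q (b : qfield M q) c :
  pullback (shift_prod c) (pullback pr2 b) = pullback pr2 b.
Proof. by rewrite -(pullback_comp b (smooth_shift_prod c) s2). Qed.

Lemma pullback_shift_const c :
  pullback (shift_prod c) (pullback pr1 (const_form w0)) = pullback pr1 (const_form w0).
Proof.
apply/funext => x; apply/funext => A.
have tA := congr1 (fun T => A *m T) (tangent_shift_prod c x).
have Am := mulmxA A (tangent (shift_prod c) x) (tangent pr1 (shift_prod c x)).
exact (f_equal (w0 : 'M[R]_(p.+1, dim E) -> R) (etrans (esym Am) tA)).
Qed.

Lemma form_act_shift c : form_act shift_prod w c = w.
Proof.
exact (f_equal2 (fun a b : qfield N p.+1 => a + b) (pullback_shift_const c)
  (pullback_shift_snd (extd hM) c)).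
Qed.

Lemma is_form_w : is_form (extd hM) -> is_form w.
Proof.
by move=> fe; apply: is_formD; apply: is_form_pullback => //; exact: is_form_const mw aw.
Qed.

(* Determined by c(0,p) (p+1) = -1 and c(i,j+1) + c(i+1,j) (j+1) = 0. *)
Definition zigzag_coef i j : R := (-1) ^+ i.+1 * (j`!)%:R / ((i + j).+1)`!%:R.

(** [hM] occurs for i = 0 only, with a minus sign because w = - d phi_(0,p). *)
Definition transl_zigzag i j (g : 'I_i -> transl (R := R) (n := n)) : qfield N j :=
  lincomb (zigzag_coef i j) (pullback pr1 (euler_contract (mixed_form w0 (q := j.+1) g)))
    (if i is 0 then form_at (- pullback pr2 hM) j else 0).

Lemma is_form_transl_zigzag i j g : (i + j)%N = p -> is_form (@transl_zigzag i j g).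
Proof.
move=> ij; apply: is_form_lincomb.
  apply: is_form_pullback => //; apply: is_form_euler_contract.
    by apply: mixed_form_multilinear => //; lia.
  by apply: mixed_form_alternating => //; lia.
case: i ij g => [|i] ij g; last exact: is_form0.
have -> : j = p by rewrite -ij.
rewrite form_at_id; apply: is_formN; exact: is_form_pullback.
Qed.

(** With the position u fixed, the cochain is multiadditive and its trivial coboundary vanishes. The
    true last term is taken at u + g_(i+1); by linearity in the position the excess is the mixed
    form with g_(i+1) inserted. *)
Lemma delta1_euler_contract i j g x A : (i + j)%N = p ->
  delta1 shift_prod (fun h : 'I_i -> transl (R := R) (n := n) =>
    pullback pr1 (euler_contract (mixed_form w0 (q := j.+1) h))) g x A =
  (-1) ^+ i.+1 * mixed_form w0 g (A *m tangent pr1 x).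
Proof.
move=> ij.
pose B := A *m tangent pr1 x.
pose F (v : 'rV[R]_n) : ('I_i -> transl (R := R) (n := n)) -> R :=
  fun h => mixed_form w0 h (col_mx v B : 'M[R]_(1 + j, n)).
have last g0 (h : 'I_i -> transl (R := R) (n := n)) :
    pullback pr1 (euler_contract (mixed_form w0 (q := j.+1) h)) (shift_prod g0 x)
      (A *m tangent (shift_prod g0) x)
    = F (x.1 + g0) h.
  have Am := mulmxA A (tangent (shift_prod g0) x) (tangent pr1 (shift_prod g0 x)).
  have tA := congr1 (fun T => A *m T) (tangent_shift_prod g0 x).
  exact (f_equal (fun B : 'M[R]_(j, dim E) => mixed_form w0 h
    (col_mx (x.1 + g0 : 'rV[R]_n) B : 'M[R]_(1 + j, n))) (etrans (esym Am) tA)).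
have mF h : multilinear_rows (mixed_form w0 (q := j.+1) (h : 'I_i -> transl (R := R) (n := n))).
  by apply: mixed_form_multilinear => //; lia.
have FD u v h : F (u + v) h = F u h + F v h.
  have := multilinear_col_mx B (mF h) 1 u v; rewrite !scale1r.
  by [].
have F0 : cobd trivial_act (F x.1) = 0.
  apply: cobd_multiadditive; apply: mixed_form_multiadditive => //; lia.
pose T := fun k => g (widen_ord (leqnSn i) k).
have FT : F (g ord_max) T = mixed_form w0 g B by exact: (mixed_form_shift w0 g B).
have := congr1 (fun c => c g) F0; rewrite /cobd /trivial_act -/T => H.
apply: etrans (delta1E shift_prod _ g x A) _.
have E0 : F x.1 (fun k => g (lift ord0 k)) + \sum_k F x.1 (contract k g) *~ (-1) ^+ k.+1
    + F (x.1 + g ord_max) T *~ (-1) ^+ i.+1 = (-1) ^+ i.+1 * mixed_form w0 g B.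
  by rewrite FD FT mulrzDl addrA H [LHS]add0r; exact: mulrz_sign.
exact (etrans (f_equal (fun a => _ + _ + a *~ (-1) ^+ i.+1) (last (g ord_max) T)) E0).
Qed.

Lemma delta1_base i j g x A : (i + j)%N = p ->
  delta1 shift_prod (fun _ : 'I_i -> transl (R := R) (n := n) =>
    if i is 0 then form_at (- pullback pr2 hM) j else (0 : qfield N j)) g x A = 0.
Proof.
case: i g => [|i] g ij; last first.
  rewrite (delta1E shift_prod) big1 => [|k _]; last exact: mul0rz.
  by rewrite -[LHS]/(0 + 0 + 0 *~ (-1) ^+ i.+2) mul0rz !addr0.
move: A; have -> : j = p by rewrite -ij.
move=> A; rewrite (delta1E shift_prod) big_ord0 addr0 expr1 mulrN1z.
rewrite form_at_id -[X in _ - X]/(pullback (shift_prod (g ord_max)) (- pullback pr2 hM) x A).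
rewrite pullbackN pullback_shift_snd; exact: addrN.
Qed.

Lemma zigzag_coef0 : zigzag_coef 0 p * p.+1%:R = -1.
Proof.
have n0 : p.+1%:R != 0 :> R by rewrite pnatr_eq0.
have f0 : p`!%:R != 0 :> R by rewrite pnatr_eq0 -lt0n fact_gt0.
rewrite /zigzag_coef expr1 add0n factS natrM; move: (p.+1%:R) (p`!%:R) n0 f0 => a b a0 b0.
by field; rewrite a0 b0.
Qed.

Lemma zigzag_coefS i j : zigzag_coef i j.+1 + zigzag_coef i.+1 j * j.+1%:R = 0.
Proof.
rewrite /zigzag_coef [(-1) ^+ i.+2]exprS addnS addSn factS natrM.
by move: ((i + j).+2)`!%:R^-1 => a; ring.
Qed.

Lemma extd_mixed_form i j (g : 'I_i -> transl (R := R) (n := n)) x A : (i + j)%N = p ->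
  extd (pullback pr1 (euler_contract (mixed_form w0 (q := j.+1) g))) x A
  = j.+1%:R * mixed_form w0 g (A *m tangent pr1 x).
Proof.
move=> ij.
have mF : multilinear_rows (mixed_form w0 (q := j.+1) g) by apply: mixed_form_multilinear => //;
  lia.
have aF : alternating_rows (mixed_form w0 (q := j.+1) g) by apply: mixed_form_alternating => //;
  lia.
by rewrite (extd_pullback s1 (is_form_euler_contract mF aF)) (extd_euler_contract mF aF).
Qed.

(** In each step both [delta1] and [delta2] give (-1)^(i+1) times a multiple of the same mixed form,
    so only the recurrence [zigzag_coefS] remains. *)
Lemma zigzag_transl_zigzag : zigzag shift_prod w transl_zigzag.
Proof.
have fE i j (g : 'I_i -> transl (R := R) (n := n)) : (i + j)%N = p ->
    is_form (pullback pr1 (euler_contract (mixed_form w0 (q := j.+1) g))).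
  move=> ij; apply: is_form_pullback => //; apply: is_form_euler_contract.
    by apply: mixed_form_multilinear => //; lia.
  by apply: mixed_form_alternating => //; lia.
have f2 : is_form (pullback pr2 hM) by exact: is_form_pullback.
have mE k (v : qfield N k) m x A : (v *~ (-1) ^+ m) x A = (-1) ^+ m * v x A.
  by rewrite -mulrz_sign !sign_mulrz; case: odd.
split.
- by move=> i j g; exact: is_form_transl_zigzag.
- move=> g; apply/funext => x; apply/funext => A.
  have E0 : transl_zigzag g = lincomb (zigzag_coef 0 p)
    (pullback pr1 (euler_contract (mixed_form w0 (q := p.+1) g)))
      (- pullback pr2 hM) by rewrite /transl_zigzag form_at_id.
  have E1 := congr1 (fun b : qfield N p.+1 => b x A)
    (extd_lincomb (zigzag_coef 0 p) (fE 0 p g (add0n p)) (is_formN f2)).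
  have E2 := extd_mixed_form g x A (add0n p); rewrite mixed_form0 in E2.
  have E3 : extd (- pullback pr2 hM) x A = - pullback pr2 (extd hM) x A.
    by rewrite (extdN f2) (extd_pullback s2 fh).
  rewrite E0; apply: etrans (esym (f_equal -%R E1)).
  rewrite E2 E3 mulrA zigzag_coef0 mulN1r -opprD opprK.
  by [].
- move=> i j ij; apply/funext => g; apply/funext => x; apply/funext => A.
  have ij' : (i.+1 + j)%N = p by rewrite -ij addnS.
  have D1 := delta1_lincomb shift_prod (zigzag_coef i j.+1)
    (fun h : 'I_i -> transl (R := R) (n := n) => pullback pr1
      (euler_contract (mixed_form w0 (q := j.+2) h)))
    (fun _ => if i is 0 then form_at (- pullback pr2 hM) j.+1 else 0) g x A.
  rewrite (delta1_euler_contract g x A ij) (delta1_base g x A ij) addr0 in D1.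
  have D2 : extd (@transl_zigzag i.+1 j g) x A =
      zigzag_coef i.+1 j * (j.+1%:R * mixed_form w0 g (A *m tangent pr1 x)).
    have E1 := congr1 (fun b : qfield N j.+1 => b x A)
      (extd_lincomb (zigzag_coef i.+1 j) (fE i.+1 j g ij') (@is_form0 _ N j)).
    apply: etrans E1 _.
    by rewrite (extd_mixed_form g x A ij') extd0 addr0.
  have D3 := mE _ (extd (@transl_zigzag i.+1 j g)) i.+1 x A; rewrite D2 in D3.
  apply: etrans (f_equal2 +%R D1 D3) _.
  rewrite mulrCA -mulrDr mulrA -mulrDl zigzag_coefS mul0r; exact: mulr0.
Qed.

(** [delta1] and [zigzag_coef p 0] both carry the sign (-1)^(p+1), which leaves 0! / (p+1)!. *)
Lemma point_cocycle_transl_zigzag x g :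
  point_cocycle shift_prod transl_zigzag x g = (p.+1)`!%:R^-1 * w0 (\matrix_(k, l) g k 0 l).
Proof.
have p0 := addn0 p.
have D1 := delta1_lincomb shift_prod (zigzag_coef p 0)
  (fun h : 'I_p -> transl (R := R) (n := n) => pullback pr1
    (euler_contract (mixed_form w0 (q := 1) h)))
  (fun _ => if p is 0 then form_at (- pullback pr2 hM) 0 else 0) g x 0.
rewrite (delta1_euler_contract g x 0 p0) (delta1_base g x 0 p0) addr0 mixed_form_full in D1.
apply: etrans D1 _.
by rewrite /zigzag_coef p0 mulr1 mulrACA mulrA -expr2 sqrr_sign mul1r.
Qed.

End ExplicitZigzag.

Lemma translation_cocycle_nontrivial (R : realType) (n p : nat) (M : manifold R)
    (w0 : 'M[R]_(p.+1, n) -> R) (hM : qfield M p) (x : prod_manifold (euclid n) M)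
    (b : ('I_p -> transl (R := R) (n := n)) -> R) :
  multilinear_rows w0 -> alternating_rows w0 -> (exists A, w0 A <> 0) ->
  cobd trivial_act b <> point_cocycle (shift_prod (M := M)) (transl_zigzag w0 hM) x.
Proof.
move=> mw aw [A A0] bE; apply: A0.
pose g (k : 'I_p.+1) : transl (R := R) (n := n) := row k A.
have gC k l : commute (g k) (g l) by exact: addrC.
have gA : w0 (\matrix_(k, l) g k 0 l) = w0 A.
  by congr w0; apply/matrixP => k l; rewrite !mxE.
have := antisym_cobd b gC; rewrite bE.
(* The sign of the permutation occurs twice, from the antisymmetrization and from w0, so all (p+1)!
   summands are equal. *)
rewrite (eq_bigr (fun _ => (p.+1)`!%:R^-1 * w0 A)); last first.
  move=> s _; rewrite (point_cocycle_transl_zigzag hM mw x (g \o s)) (w0_perm mw aw g s) gA.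
  by rewrite mulrCA; congr (_ * _); rewrite mulrA -expr2 sqrr_sign mul1r.
have f0 : p.+1`!%:R != 0 :> R by rewrite pnatr_eq0 -lt0n fact_gt0.
rewrite sumr_const card_Sn -[X in X = _]mulr_natl mulrA divff // mul1r.
by [].
Qed.

(* The degree of the forms is m = p + 1. *)
Theorem corollary6p2 (R : realType) (p n : nat) (hm : (2 <= p.+1)%N)
    (M : manifold R) (M_connected : connected [set: M])
    (M_cohomology : forall k : nat, (1 <= k <= p)%N -> deRham_trivial M k)
    (w0 : 'M[R]_(p.+1, n) -> R)
    (w0_multilinear : multilinear_rows w0) (w0_alternating : alternating_rows w0)
    (w0_neq0 : exists A, w0 A <> 0)
    (wM : qfield M p.+1) (wM_form : is_form wM) (wM_exact : exact_form wM)
    (x : prod_manifold (euclid n) M) :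
  let N := prod_manifold (euclid n) M in
  let w : qfield N p.+1 :=
    pullback (fst : N -> euclid n) (const_form w0)
    + pullback (snd : N -> M) wM in
  let G := Diff w in
  let rho : G -> N -> N := fun g => diff_fun g in
  point_cocycle_defined rho w x /\
  (exists phi : forall i j : nat, ('I_i -> G) -> qfield N j,
     zigzag rho w phi) /\
  (forall phi : forall i j : nat, ('I_i -> G) -> qfield N j,
     zigzag rho w phi ->
     let c : ('I_p.+1 -> G) -> R := point_cocycle rho phi x in
     cobd trivial_act c = 0 /\
     ~ exists b : ('I_p -> G) -> R, cobd trivial_act b = c).
Proof.
move=> N w G rho.
have [hM fh wME] := wM_exact; subst wM.
have sw (g : G) : [/\ smooth_map (rho g),
    exists g' : N -> N, [/\ smooth_map g', cancel (rho g) g' & cancel g' (rho g)]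
  & pullback (rho g) w = w] by exact/asboolP/(diffP g).
have rhoS g : smooth_map (rho g) by have [] := sw g.
have rhoM (g h : G) : rho (g * h)%g = rho g \o rho h by [].
have rho1 : rho 1%g = id by [].
have w_inv g : form_act rho w g = w by have [] := sw g.
have fw : is_form w by exact: is_form_w.
have w_exact : exact_form w.
  (* The first component of the explicit zigzag is a primitive of -w. *)
  have Z := zigzag_transl_zigzag w0_multilinear w0_alternating fh.
  pose g0 (i : 'I_0) : transl (R := R) (n := n) := 0.
  have fp := zigzag_form Z g0 (add0n p).
  exists (- transl_zigzag w0 hM g0); first exact: is_formN.
  by rewrite (extdN fp) -(zigzag_start Z).
have p0 : (1 <= p)%N by [].
have HN k : (1 <= k <= p)%N -> deRham_trivial N k.
  by case: k => // k kp; apply: deRham_trivial_prod; exact: M_cohomology.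
have const0 (f : qfield N 0) y z : is_form f -> extd f = 0 -> f y 0 = f z 0.
  move=> ff df; move: y z; apply: (smooth_path_rel (E := fun y z => f y 0 = f z 0)) => //.
    by move=> y z t ->.
  by move=> sigma; exact: closed_form0_path.
split; [split=> //|split].
(* The constant function 1 is closed, whereas in degree 0 exact means zero. *)
- move=> H0; pose one (_ : 'M[R]_(0, n)) : R := 1.
  have m1 : multilinear_rows one by move=> A B C [].
  have a1 : alternating_rows one by move=> A [].
  have s1 : smooth_map (fst : N -> euclid n) by exact: smooth_fst.
  have f1 : is_form (pullback (fst : N -> euclid n) (const_form one)).
    exact (is_form_pullback s1 (is_form_const m1 a1)).
  have d1 : extd (pullback (fst : N -> euclid n) (const_form one)) = 0.
    by rewrite (extd_pullback s1 (is_form_const m1 a1)) extd_const.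
  have := congr1 (fun b : qfield N 0 => b x 0) (H0 _ f1 d1).
  by move/eqP; apply/negP; exact: oner_neq0.
- move=> g; move: x (rho g x).
  apply: smooth_path_rel => //; [exact: homologous_sym|exact: homologous_trans|].
  exact: homologous_path.
- exact: zigzag_exists.
- move=> phi Z c; split; first exact: (point_cocycle_cocycle rhoS rhoM rho1 w_inv const0).
  move=> [b bE].
  have pT (t : transl (R := R) (n := n)) : `[< preserving_diffeo w (shift_prod (M := M) t) >].
    apply/asboolP; split; [exact: smooth_shift_prod| |exact: form_act_shift].
    exists (shift_prod t^-1%g); split; first exact: smooth_shift_prod.
      by move=> y; rewrite -[LHS]/((shift_prod t^-1%g \o shift_prod t) y) -shift_prodM mulVg
        shift_prod1.
    by move=> y; rewrite -[LHS]/((shift_prod t \o shift_prod t^-1%g) y) -shift_prodM mulgV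
      shift_prod1.
  pose iota (t : transl (R := R) (n := n)) : G := MkDiff (pT t).
  have iotaM s t : iota (s * t)%g = (iota s * iota t)%g.
    by apply/val_inj; exact: shift_prodM.
  have ZT := zigzag_hom iotaM Z.
  (* The comparison takes place over the translation group, where the restricted zigzag and the
     explicit one both live. *)
  have [b' Eb'] := zigzag_compare (@smooth_shift_prod R n M) (@shift_prodM R n M)
    (@shift_prod1 R n M)
    HN const0 x ZT (zigzag_transl_zigzag w0_multilinear w0_alternating fh).
  (* If the cocycle were the coboundary of b, then b restricted to translations and corrected by b'
     would bound the explicit cocycle. *)
  apply: (translation_cocycle_nontrivial (hM := hM) (x := x)
    (b := fun h => b (iota \o h) - b' h) w0_multilinear w0_alternating w0_neq0).
  apply/funext => g; have Eg := Eb' g; have Bg := congr1 (fun f => f (iota \o g)) bE.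
  have Hc : point_cocycle (fun t => rho (iota t))
      (fun i j (h : 'I_i -> transl (R := R) (n := n)) => @phi i j (iota \o h)) x g = c (iota \o g).
    exact (esym (f_equal (fun v : qfield N 0 => v x 0)
      (cobd_hom iotaM (form_act rho) (@phi p 0) g))).
  have Hb : cobd trivial_act (fun h => b (iota \o h)) g = c (iota \o g).
    exact: etrans (esym (cobd_hom iotaM trivial_act b g)) Bg.
  have tD (u v : R) (t : transl (R := R) (n := n)) :
    trivial_act (u + v) t = trivial_act u t + trivial_act v t by [].
  rewrite (cobdD tD) (cobdN tD) Hb -Eg Hc opprB addrC; exact: subrK.
Qed.
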